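(* Let $\mathcal H_N(q,s)$ be the $K$-algebra of $K$-linear operators on $K[x_1^{\pm1},\dots,x_N^{\pm1}]$ generated by the operators $T_1^x,\dots,T_{N-1}^x$, $(w^x)^{\pm1}$ and multiplication by $x_1^{\pm1},\dots,x_N^{\pm1}$. Then the assignment $T_i^x\mapsto\mathbf T_i$, $w^x\mapsto\mathbf w$, $x_i\mapsto x_i$ extends to an algebra isomorphism from $\mathcal H_N(q,s)$ onto the $K$-algebra of operators on $K[x_1^{\pm1},\dots,x_N^{\pm1}]\otimes_K V_\lambda$ generated by $\mathbf T_1,\dots,\mathbf T_{N-1}$, $\mathbf w^{\pm1}$, $x_1^{\pm1},\dots,x_N^{\pm1}$.
   Context: $N\ge2$, $q,s$ indeterminates, $K=\mathbb C(q,s)$. All operators act on the right and products are composed left to right ($fAB=(fA)B$). For a (Laurent) polynomial $p$, $p^{s_i}$ denotes $p$ with $x_i$ and $x_{i+1}$ exchanged. On $K[x^{\pm1}]$: $pT_i^x=(1-s)\frac{x_{i+1}(p-p^{s_i})}{x_i-x_{i+1}}+s\,p^{s_i}$ and $pw^x=p(qx_N,x_1,\dots,x_{N-1})$. $\mathcal H_N(s)$ is the $K$-algebra generated by $T_1,\dots,T_{N-1}$ with $(T_i+1)(T_i-s)=0$, $T_iT_{i+1}T_i=T_{i+1}T_iT_{i+1}$, $T_iT_j=T_jT_i$ ($|i-j|>1$). $\lambda$ is a partition of $N$ (French convention, rows numbered bottom to top); $\mathrm{Tab}_\lambda$ is the set of reverse standard tableaux (bijective fillings by $1,\dots,N$ strictly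 decreasing left to right along rows and bottom to top along columns); $\mathrm{CT}_{\mathbb T}[i]$ = column minus row of the cell of $i$; $\mathbb T^{(i,j)}$ exchanges $i,j$. $V_\lambda$ is the $K$-space with basis $\mathrm{Tab}_\lambda$ and right $\mathcal H_N(s)$-action: $\mathbb TT_i=s\mathbb T$ if $i,i+1$ in the same row; $-\mathbb T$ if in the same column; if $i$ is in a higher row than $i+1$, with $m=\mathrm{CT}_{\mathbb T}[i+1]-\mathrm{CT}_{\mathbb T}[i]>0$, $\mathbb TT_i=\frac{s-1}{1-s^m}\mathbb T+\frac{s(1-s^{m+1})(1-s^{m-1})}{(1-s^m)^2}\mathbb T^{(i,i+1)}$; otherwise determined by this formula for $\mathbb T^{(i,i+1)}$ and the quadratic relation. On $K[x^{\pm1}]\otimes V_\lambda$: $(p\otimes u)\mathbf T_i=(1-s)\frac{x_{i+1}(p-p^{s_i})}{x_i-x_{i+1}}\otimes u+p^{s_i}\otimes uT_i$; $(p\otimes u)\mathbf w=p(qx_N,x_1,\dots,x_{N-1})\otimes uT_1T_2\cdots T_{N-1}$; $(p\otimes u)x_i=x_ip\otimes u$. *)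

(* Defs.v *)
From HB Require Import structures.
From mathcomp Require Import all_boot all_order all_algebra all_fingroup.
From mathcomp Require Import mpoly.
From mathcomp Require Import complex.
From mathcomp Require Import Rstruct.
From Stdlib Require Import ClassicalEpsilon.

Set Implicit Arguments.
Unset Strict Implicit.
Unset Printing Implicit Defensive.

Import GRing.Theory Num.Theory.
Local Open Scope ring_scope.

Local Notation "x %:F" := (@FracField.tofrac _ x).

Definition CC : numClosedFieldType := (Rdefinitions.R)[i].
Definition K : fieldType := {fraction {mpoly CC[2]}}.
Definition qK : K := ('X_(0 : 'I_2) : {mpoly CC[2]})%:F.
Definition sK : K := ('X_(1 : 'I_2) : {mpoly CC[2]})%:F.

(* Laurent polynomials K[x_1^{+-1},...,x_N^{+-1}], realised inside the *)
(* field of rational functions Fx N = K(x_1,...,x_N).                  *)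
(* Variable x_k (1 <= k <= N) is 'X_(k-1).                             *)
Definition Fx (N : nat) : fieldType := {fraction {mpoly K[N]}}.
Definition xF N (i : 'I_N) : Fx N := ('X_i : {mpoly K[N]})%:F.
Definition cF N (c : K) : Fx N := (c%:MP : {mpoly K[N]})%:F.
Definition xprod N : Fx N := \prod_(i < N) xF i.

Definition laurent N (f : Fx N) : Prop :=
  exists (P : {mpoly K[N]}) (m : nat), f = P%:F / xprod N ^+ m.

Lemma laurent0 N : laurent (0 : Fx N).
Proof. by exists 0, 0%N; rewrite rmorph0 mul0r. Qed.

Definition L N := {f : Fx N | laurent f}.
Definition zeroL N : L N := exist _ 0 (laurent0 N).

(* Total coercion Fx N -> L N (identity on Laurent polynomials; it is
   only ever applied to values that are Laurent polynomials). *)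
Definition toL N (f : Fx N) : L N :=
  match excluded_middle_informative (laurent f) with
  | left h => exist _ f h
  | right _ => zeroL N
  end.

Definition addL N (p p' : L N) : L N := toL (proj1_sig p + proj1_sig p').
Definition scaleL N (c : K) (p : L N) : L N := toL (cF N c * proj1_sig p).

(* extension to K(x) of an endomorphism of K[x] (used for injective ones) *)
Definition fmap N (sg : {mpoly K[N]} -> {mpoly K[N]}) (f : Fx N) : Fx N :=
  let r := generic_quotient.repr (f : {fraction {mpoly K[N]}}) in (sg \n_r)%:F / (sg \d_r)%:F.

(* indices: j : 'I_N.-1 stands for the paper's i = j+1, i.e. the pair of
   variables x_i, x_{i+1} = 'X_(lo j), 'X_(hi j). *)
Lemma lo_subproof N (j : 'I_N.-1) : (j < N)%N.
Proof. by case: N j => [|n] [j hj] //=; apply: ltnW. Qed.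
Lemma hi_subproof N (j : 'I_N.-1) : (j.+1 < N)%N.
Proof. by case: N j => [|n] [j hj]. Qed.
Definition lo N (j : 'I_N.-1) : 'I_N := Ordinal (lo_subproof j).
Definition hi N (j : 'I_N.-1) : 'I_N := Ordinal (hi_subproof j).

Definition swp N (j : 'I_N.-1) (P : {mpoly K[N]}) : {mpoly K[N]} :=
  msym (tperm (lo j) (hi j)) P.
Definition fsw N (j : 'I_N.-1) (f : Fx N) : Fx N := fmap (@swp N j) f.

Definition wsubst N : N.-tuple {mpoly K[N]} :=
  [tuple (if (i : nat) == 0%N then qK *: 'X_(ord_pred i) else 'X_(ord_pred i))
   | i < N].
Definition wpol N (P : {mpoly K[N]}) : {mpoly K[N]} := P \mPo wsubst N.
Definition fw N (f : Fx N) : Fx N := fmap (@wpol N) f.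

Definition divdiff N (j : 'I_N.-1) (f : Fx N) : Fx N :=
  (1 - cF N sK) * xF (hi j) * (f - fsw j f) / (xF (lo j) - xF (hi j)).

Definition TxL N (j : 'I_N.-1) (p : L N) : L N :=
  toL (divdiff j (proj1_sig p) + cF N sK * fsw j (proj1_sig p)).
Definition wL N (p : L N) : L N := toL (fw (proj1_sig p)).
Definition mulxL N (i : 'I_N) (p : L N) : L N := toL (xF i * proj1_sig p).

(* Partitions and reverse standard tableaux (French convention).       *)
(* lam = [:: lam_1; lam_2; ...], row r (0-based, bottom to top) has     *)
(* length nth 0 lam r.  Entries 1..N are encoded as 'I_N (k <-> k+1).   *)
(* A tableau is encoded by the position (row, column) of each entry.    *)
Definition is_partition (N : nat) (lam : seq nat) : bool :=
  [&& sorted geq lam, all (fun k => 0 < k)%N lam & sumn lam == N].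

Definition is_rst N (lam : seq nat) (t : {ffun 'I_N -> 'I_N * 'I_N}) : bool :=
  [&& [forall k, ((t k).1 < size lam)%N && ((t k).2 < nth 0%N lam (t k).1)%N],
      injectiveb t,
      [forall k, forall l,
         (((t k).1 == (t l).1) && ((t k).2 < (t l).2)%N) ==> (l < k)%N] &
      [forall k, forall l,
         (((t k).2 == (t l).2) && ((t k).1 < (t l).1)%N) ==> (l < k)%N]].

Notation Tab N lam := {t : {ffun 'I_N -> 'I_N * 'I_N} | is_rst lam t}.

Definition tabf N lam (T : Tab N lam) := proj1_sig T.
Definition rowT N lam (T : Tab N lam) (k : 'I_N) : nat := (tabf T k).1.
Definition colT N lam (T : Tab N lam) (k : 'I_N) : nat := (tabf T k).2.
Definition CT N lam (T : Tab N lam) (k : 'I_N) : int :=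
  (colT T k)%:Z - (rowT T k)%:Z.

(* T^{(a,b)}: exchange the entries a and b (defaults to T if the result
   is not a reverse standard tableau; it is only used when it is one) *)
Definition tswap N lam (T : Tab N lam) (a b : 'I_N) : Tab N lam :=
  insubd T [ffun k => tabf T (tperm a b k)].

Notation V N lam := {ffun Tab N lam -> K^o}.
Definition basisV N lam (T : Tab N lam) : V N lam := [ffun T' => (T == T')%:R].

Definition coefA (m : int) : K := (sK - 1) / (1 - sK ^ m).
Definition coefB (m : int) : K :=
  sK * (1 - sK ^ (m + 1)) * (1 - sK ^ (m - 1)) / (1 - sK ^ m) ^+ 2.

Definition heckeBasis N lam (j : 'I_N.-1) (T : Tab N lam) : V N lam :=
  let a := lo j in let b := hi j in
  if rowT T a == rowT T b then sK *: basisV T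
  else if colT T a == colT T b then - basisV T
  else if (rowT T b < rowT T a)%N then
    let m := CT T b - CT T a in
    coefA m *: basisV T + coefB m *: basisV (tswap T a b)
  else
    (* determined by the previous formula applied to T' = T^{(i,i+1)},
       T' T_i = A T' + B T, and the quadratic relation
       T_i^2 = (s-1) T_i + s : hence
       T T_i = B^{-1} ((s-1-A) (T' T_i) + s T') *)
    let T' := tswap T a b in
    let m := CT T' b - CT T' a in
    let T'Ti := coefA m *: basisV T' + coefB m *: basisV T in
    (coefB m)^-1 *: ((sK - 1 - coefA m) *: T'Ti + sK *: basisV T').

Definition heckeV N lam (j : 'I_N.-1) (u : V N lam) : V N lam :=
  \sum_(T : Tab N lam) u T *: heckeBasis j T.

Definition wV N lam (u : V N lam) : V N lam :=
  foldl (fun v j => heckeV j v) u (enum 'I_N.-1).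

(* K[x^{+-1}] (x)_K V_lam, realised as Tab_lam -> K[x^{+-1}]:           *)
(* the function G represents  sum_T G(T) (x) T.                        *)
Definition LV N lam := Tab N lam -> L N.
Definition addLV N lam (G G' : LV N lam) : LV N lam := fun T => addL (G T) (G' T).
Definition scaleLV N lam (c : K) (G : LV N lam) : LV N lam :=
  fun T => scaleL c (G T).

(* bold T_i : (p (x) u) |-> divdiff(p) (x) u + p^{s_i} (x) u T_i *)
Definition BT N lam (j : 'I_N.-1) (G : LV N lam) : LV N lam :=
  fun T' => toL (divdiff j (proj1_sig (G T'))
     + \sum_(T : Tab N lam) fsw j (proj1_sig (G T)) * cF N (heckeBasis j T T')).

(* bold w : (p (x) u) |-> p(q x_N, x_1, ..) (x) u T_1 ... T_{N-1} *)
Definition Bw N lam (G : LV N lam) : LV N lam :=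
  fun T' => toL (\sum_(T : Tab N lam)
                   fw (proj1_sig (G T)) * cF N (wV (basisV T) T')).

Definition Bx N lam (i : 'I_N) (G : LV N lam) : LV N lam :=
  fun T => toL (xF i * proj1_sig (G T)).

(* Operators act on the right; the product A B means "first A, then B" *)
(* i.e. the function fun x => B (A x).                                 *)
Section OpAlg.
Variables (X : Type) (add : X -> X -> X) (scl : K -> X -> X).

Definition opadd (f g : X -> X) : X -> X := fun x => add (f x) (g x).
Definition opscl (c : K) (f : X -> X) : X -> X := fun x => scl c (f x).
Definition opmul (f g : X -> X) : X -> X := fun x => g (f x).

Definition isinv (f g : X -> X) : Prop := cancel f g /\ cancel g f.

Inductive gen_alg (gens : (X -> X) -> Prop) : (X -> X) -> Prop :=
  | ga_gen f : gens f -> gen_alg gens f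
  | ga_one : gen_alg gens id
  | ga_add f g : gen_alg gens f -> gen_alg gens g -> gen_alg gens (opadd f g)
  | ga_scl c f : gen_alg gens f -> gen_alg gens (opscl c f)
  | ga_mul f g : gen_alg gens f -> gen_alg gens g -> gen_alg gens (opmul f g).
End OpAlg.

Definition is_alg_iso (X Y : Type)
    (addX : X -> X -> X) (sclX : K -> X -> X) (gX : (X -> X) -> Prop)
    (addY : Y -> Y -> Y) (sclY : K -> Y -> Y) (gY : (Y -> Y) -> Prop)
    (phi : (X -> X) -> (Y -> Y)) : Prop :=
  (forall f, gen_alg addX sclX gX f -> gen_alg addY sclY gY (phi f)) /\
      (forall g, gen_alg addY sclY gY g ->
          exists2 f, gen_alg addX sclX gX f & phi f = g) /\
      (forall f f', gen_alg addX sclX gX f -> gen_alg addX sclX gX f' ->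
          phi f = phi f' -> f = f') /\
      (forall f f', gen_alg addX sclX gX f -> gen_alg addX sclX gX f' ->
          phi (opadd addX f f') = opadd addY (phi f) (phi f')) /\
      (forall c f, gen_alg addX sclX gX f ->
          phi (opscl sclX c f) = opscl sclY c (phi f)) /\
      (forall f f', gen_alg addX sclX gX f -> gen_alg addX sclX gX f' ->
          phi (opmul f f') = opmul (phi f) (phi f')) /\
      phi id = id.

Definition gens_x N (f : L N -> L N) : Prop :=
  (exists j : 'I_N.-1, f = TxL j) \/ f = @wL N \/ isinv (@wL N) f \/
  (exists i : 'I_N, f = mulxL i) \/ (exists i : 'I_N, isinv (mulxL i) f).

Definition gens_bold N lam (f : LV N lam -> LV N lam) : Prop :=
  (exists j : 'I_N.-1, f = BT j) \/ f = @Bw N lam \/ isinv (@Bw N lam) f \/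
  (exists i : 'I_N, f = Bx i) \/ (exists i : 'I_N, isinv (Bx i) f).

(* Main.v *)
Require Import Defs.
From HB Require Import structures.
From mathcomp Require Import all_boot all_order all_algebra all_fingroup.
From mathcomp Require Import mpoly.
From mathcomp Require Import zify ring.
From Stdlib Require Import ClassicalEpsilon FunctionalExtensionality.

(** Put [b_i = (1-s) x_{i+1} / (x_i - x_{i+1})].  On rational functions
    [T_i^x = b_i + (s - b_i) s_i], so the polynomial operators lie in the span over
    [K(x)] of the extended affine symmetric group generated by the [s_i] and [w].
    Likewise the bold [T_i] is [b_i + (s - b_i) S_i], where the intertwiner
    [S_i = (T_i - b_i) s_i / (s - b_i)] is semilinear over [s_i].  By the Yang-Baxter
    equation the [S_i] and the bold [w] satisfy the defining relations of that
    group, hence [s_i |-> S_i], [w |-> w] extends to an action on [K(x) (x) V] in which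
    every element is still semilinear over the same automorphism of [K(x)].  Distinct
    group elements induce distinct automorphisms, as [q] is not a root of unity; by
    Dedekind independence a sum [sum_g a_g g] therefore vanishes on Laurent
    polynomials iff all [a_g] vanish, iff its image vanishes on
    [K[x^{+-1}] (x) V]. *)

Set Implicit Arguments.
Unset Strict Implicit.
Unset Printing Implicit Defensive.
Import GRing.Theory.
Local Open Scope ring_scope.

(** The extended affine group is never constructed. Its two actions are generated together, as pairs
    of an automorphism of K(x) and a semilinear map, and the point to settle is that a word acting
    trivially on the variables also acts trivially on vectors. This concerns the relations alone:
    modulo them, every word is a product of commuting translations followed by a permutation word,
    and both parts can be read off from the images of the q^a x_i. It is proved for an arbitrary set
    containing such points, then applied to the product of the two modules.

    Passing to K(x) is forced by the denominators of b_i and of 1 / (s - b_i): in general an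
    intertwiner does not preserve Laurent vectors. The way back is open because Dedekind's argument
    only ever multiplies test vectors by variables.

    The Hecke relations on V are not part of the definition of the tableau action; they are derived
    from its seminormal form, where they become identities between rational functions of contents.
    The isomorphism itself is a relation, having a common formal sum, that is single-valued in both
    directions. *)

Local Notation "x %:F" := (@FracField.tofrac _ x).

(** * Words in braid and symmetric generators *)

(* The head of the word acts first: operators act on the right in the paper. *)
Definition word_act (X : Type) (s : nat -> X -> X) (l : seq nat) (x : X) : X :=
  foldl (fun y i => s i y) x l.

Lemma word_act_cons (X : Type) (s : nat -> X -> X) i l x :
  word_act s (i :: l) x = word_act s l (s i x).
Proof. by []. Qed.

Lemma word_act_cat (X : Type) (s : nat -> X -> X) l l' x :
  word_act s (l ++ l') x = word_act s l' (word_act s l x).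
Proof. exact: foldl_cat. Qed.

Section Braid.
Variables (X : Type) (n : nat) (s : nat -> X -> X).
Hypothesis s_braid : forall i x, (i.+1 < n)%N ->
  s i (s i.+1 (s i x)) = s i.+1 (s i (s i.+1 x)).
Hypothesis s_comm : forall i j x, (i.+1 < j)%N -> (j < n)%N ->
  s i (s j x) = s j (s i x).

Lemma s_far i j x : (i < n)%N -> (j < n)%N -> (i.+1 < j)%N || (j.+1 < i)%N ->
  s i (s j x) = s j (s i x).
Proof.
by move=> hi hj /orP[h|h]; [exact: s_comm | rewrite [RHS]s_comm].
Qed.

Lemma word_act_far l j x : (j < n)%N ->
  all (fun i => (i < n)%N && ((i.+1 < j)%N || (j.+1 < i)%N)) l ->
  word_act s l (s j x) = s j (word_act s l x).
Proof.
move=> hj; elim: l x => [|i l IH] x //= /andP[/andP[hi hij] hl].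
by rewrite /word_act /= s_far // -/(word_act s l _) IH.
Qed.

(** The letter [j] commutes with the letters below [j-1], becomes [j-1] by the braid relation when
    it meets [j-1, j], and then commutes with the rest. No quadratic relation enters, so the lemma
    serves involutions and Hecke generators alike. *)
Lemma word_act_iota k m j x : (k < j < k + m)%N -> (k + m <= n)%N ->
  word_act s (iota k m) (s j x) = s j.-1 (word_act s (iota k m) x).
Proof.
elim: m k x => [|m IH] k x hj hn; first by lia.
rewrite /= /word_act /= -!/(word_act s _ _).
have [hjk|hjk] := ltnP k.+1 j.
  by rewrite s_comm ?IH //; lia.
have -> : j = k.+1 by lia.
case: m IH hj hn => [|m] IH hj hn; first by lia.
rewrite /= /word_act /= -!/(word_act s _ _) -s_braid; last by lia.
rewrite word_act_far //; first by lia.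
by apply/allP => i; rewrite mem_iota; lia.
Qed.

Definition coxeter := word_act s (iota 0 n).

Lemma coxeter_shift i x : (i.+1 < n)%N -> coxeter (s i.+1 x) = s i (coxeter x).
Proof. by move=> hi; rewrite /coxeter word_act_iota. Qed.

Lemma coxeter_word_shift l x : all (fun i => i.+1 < n)%N l ->
  coxeter (word_act s (map succn l) x) = word_act s l (coxeter x).
Proof.
elim: l x => [|i l IH] x //= /andP[hi hl].
by rewrite /word_act /= -!/(word_act s _ _) IH // coxeter_shift.
Qed.

(** Splitting off the last letter [n-1] of the outer factor leaves the word [0, ..., n-2]; moved
    inside the inner factor it becomes [1, ..., n-1], which together with [s 0] rebuilds a full
    [coxeter]. *)
Lemma coxeter2 x : (0 < n)%N ->
  coxeter (coxeter (s 0 x)) = s n.-1 (coxeter (coxeter x)).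
Proof.
move=> n0; have hl : all (fun i => i.+1 < n)%N (iota 0 n.-1).
  by apply/allP => i; rewrite mem_iota; lia.
have E y : coxeter y = word_act s (iota 1 n.-1) (s 0 y).
  by rewrite /coxeter -{1}(prednK n0).
have E' y : coxeter y = s n.-1 (word_act s (iota 0 n.-1) y).
  by rewrite /coxeter -{1}(prednK n0) -addn1 iotaD word_act_cat.
rewrite [in LHS]E' -coxeter_word_shift // -[map _ _](iotaDl 1) addn0.
by rewrite -E.
Qed.

End Braid.

Definition sw (j i : nat) : nat :=
  if i == j then j.+1 else if i == j.+1 then j else i.

Lemma swK j : involutive (sw j).
Proof. by move=> i; rewrite /sw; do !case: eqP; lia. Qed.

Lemma sw_ltn n j i : (j < n)%N -> (sw j i <= n)%N = (i <= n)%N.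
Proof. by rewrite /sw => h; do !case: eqP; lia. Qed.

Section SymmetricWords.
Variables (X : Type) (n : nat) (s : nat -> X -> X).
Hypothesis s_invol : forall i x, (i < n)%N -> s i (s i x) = x.
Hypothesis s_braid : forall i x, (i.+1 < n)%N ->
  s i (s i.+1 (s i x)) = s i.+1 (s i (s i.+1 x)).
Hypothesis s_comm : forall i j x, (i.+1 < j)%N -> (j < n)%N ->
  s i (s j x) = s j (s i x).

Lemma word_act_revK l x : all (fun i => i < n)%N l ->
  word_act s (rev l) (word_act s l x) = x.
Proof.
elim: l x => [|i l IH] x //= /andP[hi hl].
rewrite rev_cons -cats1 word_act_cat /word_act /= -!/(word_act s _ _).
by rewrite IH // s_invol.
Qed.

Lemma word_act_Krev l x : all (fun i => i < n)%N l ->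
  word_act s l (word_act s (rev l) x) = x.
Proof.
by move=> hl; rewrite -{1}(revK l) word_act_revK // all_rev.
Qed.

(** The word [m-1, ..., k], empty for [m <= k]; as a permutation it carries the point [m] to [k] and
    raises the points from [k] to [m-1] by one. *)
Definition descent k m := rev (iota k (m - k)).

Lemma descent_shift k m j x : (k < j < m)%N -> (m <= n)%N ->
  s j (word_act s (descent k m) x) = word_act s (descent k m) (s j.-1 x).
Proof.
move=> hj hm; rewrite /descent; set l := iota _ _.
have hl : all (fun i => i < n)%N l by apply/allP => i; rewrite mem_iota; lia.
rewrite -[LHS](word_act_revK _ hl) (@word_act_iota _ n) //; try lia.
by rewrite word_act_Krev.
Qed.

Lemma descent_word_shift k m l x :
  all (fun j => k <= j < m.-1)%N l -> (m <= n)%N ->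
  word_act s (map succn l) (word_act s (descent k m) x)
  = word_act s (descent k m) (word_act s l x).
Proof.
move=> + hm; elim: l x => [|j l IH] x //= /andP[hj hl].
rewrite /word_act /= -!/(word_act s _ _) descent_shift ?IH //; lia.
Qed.

Lemma descentS k m : (k < m)%N -> descent k m = rcons (descent k.+1 m) k.
Proof.
move=> h; rewrite /descent -rev_cons -[k :: _]/(iota k _.+1); congr (rev (iota _ _));
  lia.
Qed.

Lemma descent_top k m : (k <= m)%N -> descent k m.+1 = m :: descent k m.
Proof.
move=> h; rewrite /descent subSn // -addn1 iotaD rev_cat /=.
by congr (_ :: _); lia.
Qed.

(* The words [descent k m.+1], [k <= m.+1], represent the right cosets of the parabolic
   subgroup generated by the [s i], [i < m]. *)
Lemma word_normal_form m l : (m < n)%N -> all (fun i => i <= m)%N l ->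
  exists l' k, [/\ all (fun i => i < m)%N l', (k <= m.+1)%N &
    forall x, word_act s l x = word_act s (l' ++ descent k m.+1) x].
Proof.
move=> hm; elim/last_ind: l => [|l i IH].
  by exists [::], m.+1; split=> // x; rewrite /descent subnn.
rewrite all_rcons => /andP[hi /IH[l' [k [hl' hk E]]]].
have E' x : word_act s (rcons l i) x
    = s i (word_act s (descent k m.+1) (word_act s l' x)).
  by rewrite -cats1 word_act_cat E word_act_cat.
(* The appended letter [i] meets the coset word: for [k < i] it passes through as [i-1]; for
   [i = k-1] it lengthens the word, and for smaller [i] it commutes with it; for [i = k] it cancels
   the last letter. *)
have [hki|hki|hki] := ltngtP k i.
- exists (rcons l' i.-1), k; split=> //; first by rewrite all_rcons hl' andbT; lia.
  move=> x; rewrite E' descent_shift; try lia.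
  by rewrite word_act_cat -cats1 word_act_cat.
- have [hk1|hk1] := ltnP i.+1 k; last first.
    exists l', i; split=> //; first by lia.
    have Ek : k = i.+1 by lia.
    by move=> x; rewrite E' Ek word_act_cat (@descentS i) ?ltnS // -cats1 [RHS]word_act_cat.
  exists (rcons l' i), k; split=> //; first by rewrite all_rcons hl' andbT; lia.
  move=> x; rewrite E' word_act_cat -cats1 word_act_cat /=.
  rewrite [RHS](@word_act_far _ n) //; first by lia.
  by apply/allP => j; rewrite mem_rev mem_iota; lia.
- rewrite -hki in E' *; exists l', k.+1; split=> //; first by lia.
  move=> x; rewrite E' word_act_cat descentS; last by lia.
  by rewrite -cats1 word_act_cat s_invol //; lia.
Qed.

Variable e : nat -> X.
Hypothesis s_e : forall j i, (j < n)%N -> s j (e i) = e (sw j i).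
Hypothesis e_inj : forall i j, (i <= n)%N -> (j <= n)%N -> e i = e j -> i = j.

Lemma word_act_descent_e k m : (k <= m)%N -> (m <= n)%N ->
  word_act s (descent k m) (e m) = e k.
Proof.
move=> hk hm; move: hk; rewrite leq_eqVlt => /orP[/eqP<-|].
  by rewrite /descent subnn.
elim: m hm => // m IH hm; rewrite ltnS => hkm.
rewrite descent_top // /word_act /= -/(word_act s _ _) s_e //.
have -> : sw m m.+1 = m by rewrite /sw; do !case: eqP; lia.
move: hkm; rewrite leq_eqVlt => /orP[/eqP<-|hkm].
  by rewrite /descent subnn.
by apply: IH => //; lia.
Qed.

Lemma word_act_fix_e l m i : all (fun j => j < m)%N l -> (m < i)%N -> (i <= n)%N ->
  word_act s l (e i) = e i.
Proof.
move=> + hm hi; elim: l => //= j l IH /andP[hj hl].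
rewrite /word_act /= -/(word_act s _ _) s_e; last by lia.
have -> : sw j i = i by rewrite /sw; do !case: eqP; lia.
exact: IH.
Qed.

(** Faithfulness from the Coxeter relations alone: the normal form sends the top point to [e k], so
    fixing that point forces an empty coset word, and only smaller letters remain. The conclusion
    concerns every [x], although only the points [e i] are tested. *)
Lemma word_act_trivial l : all (fun i => i < n)%N l ->
  (forall i, (i <= n)%N -> word_act s l (e i) = e i) ->
  forall x, word_act s l x = x.
Proof.
move: {-2}n (leqnn n) => m; elim: m l => [|m IH] l hmn.
  by case: l => [|i l] //=; rewrite ltn0.
move=> hl htriv x.
have [//|l' [k [hl' hk E]]] := @word_normal_form m l hmn.
have hk' : k = m.+1.
  apply: e_inj; [by lia | by [] |].
  rewrite -[RHS]htriv // E word_act_cat (word_act_fix_e hl') //.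
  by rewrite word_act_descent_e.
have E' y : word_act s l y = word_act s l' y.
  by rewrite E word_act_cat hk' /descent subnn.
rewrite E'; apply: IH => //; first exact: ltnW.
by move=> i hi; rewrite -E' htriv // leqW.
Qed.

End SymmetricWords.

(** * Kernel of the extended affine symmetric group *)

Section AffineWords.
Variables (X : Type) (n : nat) (s : nat -> X -> X) (w wi : X -> X).
Hypothesis n_gt0 : (0 < n)%N.
Hypothesis s_invol : forall i x, (i < n)%N -> s i (s i x) = x.
Hypothesis s_braid : forall i x, (i.+1 < n)%N ->
  s i (s i.+1 (s i x)) = s i.+1 (s i (s i.+1 x)).
Hypothesis s_comm : forall i j x, (i.+1 < j)%N -> (j < n)%N ->
  s i (s j x) = s j (s i x).
Hypotheses (wK : cancel w wi) (wiK : cancel wi w).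
Hypothesis w_s : forall i x, (i.+1 < n)%N -> w (s i.+1 x) = s i (w x).
Hypothesis w2_s : forall x, w (w (s 0 x)) = s n.-1 (w (w x)).

(** Conjugation by [s 0, ..., s k.-1]: a translation [z] in coordinate 0 becomes the same
    translation in coordinate [k]. *)
Fixpoint transl (z : X -> X) (k : nat) (x : X) : X :=
  if k is k'.+1 then s k' (transl z k' (s k' x)) else z x.

(** Commutation with the stabiliser of coordinate 0; it makes the conjugates of [z] depend on the
    target coordinate only. *)
Definition zcomm (z : X -> X) := forall j x, (0 < j < n)%N -> z (s j x) = s j (z x).

Lemma transl_far z j k x : zcomm z -> (k < j < n)%N ->
  s j (transl z k x) = transl z k (s j x).
Proof.
move=> hz; elim: k x => [|k IH] x hj /=; first by rewrite hz.
rewrite (@s_far _ n) //; try lia.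
by rewrite IH ?(@s_far _ n s s_comm k) //; lia.
Qed.

Lemma transl_s z j k x : zcomm z -> (j < n)%N -> (k <= n)%N ->
  s j (transl z k x) = transl z (sw j k) (s j x).
Proof.
move=> hz hj; elim: k j hj x => [|k IH] j hj x hk.
  rewrite /sw; case: eqP => [<-|h0] /=; first by rewrite s_invol.
  by rewrite hz //; lia.
rewrite /sw /=; case: eqP => [E|h1] /=; first by subst j; rewrite /= s_invol.
case: eqP => [[E]|h2] /=; first by subst j; rewrite s_invol.
have [hjk|hjk] := ltnP j k; last first.
  by apply: (@transl_far z j k.+1) => //; lia.
case: k IH hk h1 h2 hjk => [|k] IH hk h1 h2 hjk //=.
have [ejk|hjk'] := eqVneq j k.
  rewrite ejk s_braid; last by lia.
  by rewrite transl_far ?s_braid //; lia.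
rewrite (@s_far _ n s s_comm j) //; try lia.
have := IH j hj (s k.+1 x); rewrite /= => ->; last by lia.
have -> : sw j k.+1 = k.+1 by rewrite /sw; do !case: eqP; lia.
by rewrite /= (@s_far _ n s s_comm k.+1 j) //; lia.
Qed.

Definition commutes (f g : X -> X) := forall x, f (g x) = g (f x).

Lemma transl_comm_sw z z' i j k : zcomm z -> zcomm z' ->
  (i <= n)%N -> (j <= n)%N -> (k < n)%N ->
  commutes (transl z i) (transl z' j) ->
  commutes (transl z (sw k i)) (transl z' (sw k j)).
Proof.
move=> hz hz' hi hj hk h x; rewrite -[x](@s_invol k) //.
by rewrite -!transl_s // h.
Qed.

(** The symmetric group has two orbits on pairs of coordinates, equal and distinct ones, so
    commutation has to be known only for the pairs (0, 0) and (0, 1). *)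
Lemma transl_comm_le z z' i j : zcomm z -> zcomm z' ->
  commutes z z' -> commutes z (transl z' 1) ->
  (i <= j)%N -> (j <= n)%N -> commutes (transl z i) (transl z' j).
Proof.
move=> hz hz' h0 h1; have h0j k : (k <= n)%N -> commutes z (transl z' k).
  case: k => // k; elim: k => // k IH hk.
  have := @transl_comm_sw z z' 0 k.+1 k.+1 hz hz' isT (ltnW hk) hk (IH (ltnW hk)).
  by rewrite /sw /= eqxx.
elim: i j => [|i IH] j hij hj; first exact: h0j.
case: j hij hj => // j; rewrite ltnS leq_eqVlt => /orP[/eqP<-|hij] hj.
  have := @transl_comm_sw z z' i i i hz hz' (ltnW hj) (ltnW hj) hj (IH _ (leqnn _) (ltnW hj)).
  by rewrite /sw eqxx.
have := @transl_comm_sw z z' i j.+1 i hz hz' _ hj _ (IH _ _ hj).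
have -> : sw i j.+1 = j.+1 by rewrite /sw; do !case: eqP; lia.
by rewrite /sw eqxx; apply; lia.
Qed.

(* The translation [x_0 |-> q x_0] and its inverse. *)
Definition t0 x := word_act s (descent 0 n) (w x).
Definition t0i x := wi (word_act s (iota 0 n) x).

Let iota_ok k m : (k + m <= n)%N -> all (fun i => i < n)%N (iota k m).
Proof. by move=> h; apply/allP => i; rewrite mem_iota; lia. Qed.

Lemma t0K : cancel t0 t0i.
Proof.
move=> x; rewrite /t0 /t0i /descent subn0 (@word_act_Krev _ n) ?wK //.
exact: iota_ok.
Qed.

Lemma t0iK : cancel t0i t0.
Proof.
move=> x; rewrite /t0 /t0i wiK /descent subn0 (@word_act_revK _ n) //.
exact: iota_ok.
Qed.

Lemma t0_zcomm : zcomm t0.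
Proof.
move=> [|j] x // hj; rewrite /t0 w_s; last by lia.
by rewrite (@descent_shift _ n).
Qed.

Lemma t0i_zcomm : zcomm t0i.
Proof.
move=> j x hj; apply: (can_inj t0K); rewrite t0iK t0_zcomm //.
by rewrite t0iK.
Qed.

(** Let [D] be [descent 0 n]. Collecting both [w] innermost turns each order into a permutation word
    applied to [w (w x)]. When the translation at 1 acts first, an [s 0] is left under the two [w],
    and [w2_s] is the relation that brings it out as [s n.-1]; both words then equal [D D]. *)
Lemma t0_comm1 : commutes t0 (transl t0 1).
Proof.
have wl l x : all (fun i => i.+1 < n)%N l ->
    w (word_act s (map succn l) x) = word_act s l (w x).
  elim: l x => [|i l IH] x //= /andP[hi hl].
  by rewrite /word_act /= -!/(word_act s _ _) IH // w_s.
have D0 x : word_act s (descent 0 n) x = s 0 (word_act s (descent 1 n) x).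
  by rewrite descentS // -cats1 word_act_cat.
have D1 x : word_act s (descent 0 n) x = word_act s (descent 0 n.-1) (s n.-1 x).
  by rewrite -{1}(prednK n_gt0) descent_top.
have D10 : descent 1 n = map succn (descent 0 n.-1).
  by rewrite /descent map_rev subn0 -(iotaDl 1) subn1.
have hl : all (fun i => i.+1 < n)%N (descent 0 n.-1).
  by apply/allP => i; rewrite mem_rev mem_iota; lia.
have s0D x : s 0 (word_act s (descent 0 n) x) = word_act s (descent 1 n) x.
  by rewrite D0 s_invol.
move=> x; rewrite /= /t0 !s0D D10 !wl // w2_s -D1 -D10.
rewrite [word_act s (descent 0 n) (w _)]D1 -(@descent_word_shift _ n) //.
  by rewrite -D10 D1 s_invol //; lia.
by apply/allP => i; rewrite mem_rev mem_iota; lia.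
Qed.

(** The test points model q^a x_i: permutations move [i] and translations move [a], so these points
    detect both parts of a word. *)
Variable e : int -> nat -> X.
Hypothesis s_e : forall j a i, (j < n)%N -> s j (e a i) = e a (sw j i).
Hypothesis w_e0 : forall a, w (e a 0) = e (a + 1) n.
Hypothesis w_eS : forall a i, (i < n)%N -> w (e a i.+1) = e a i.
Hypothesis e_inj : forall a b i j, (i <= n)%N -> (j <= n)%N ->
  e a i = e b j -> a = b /\ i = j.

Lemma descent_e_lt a k m i : (k <= i < m)%N -> (m <= n)%N ->
  word_act s (descent k m) (e a i) = e a i.+1.
Proof.
elim: m => [|m IH] hi hm; first by lia.
rewrite descent_top; last by lia.
rewrite /word_act /= -/(word_act s _ _) s_e //.
have [->|him] := eqVneq i m.
  have -> : sw m m = m.+1 by rewrite /sw eqxx.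
  apply: (@word_act_fix_e X n s (e a) _ _ m) => //; first by move=> *; exact: s_e.
  by apply/allP => j; rewrite mem_rev mem_iota; lia.
have -> : sw m i = i by rewrite /sw; do !case: eqP; lia.
by apply: IH; lia.
Qed.

Lemma t0_e a i : (i <= n)%N -> t0 (e a i) = if i == 0%N then e (a + 1) i else e a i.
Proof.
case: i => [|i] hi; rewrite /t0 /=.
  rewrite w_e0 (@word_act_descent_e X n s (e (a + 1))) //.
  by move=> *; exact: s_e.
by rewrite w_eS // descent_e_lt.
Qed.

Lemma t0i_e a i : (i <= n)%N -> t0i (e a i) = if i == 0%N then e (a - 1) i else e a i.
Proof.
move=> hi; apply: (can_inj t0K); rewrite t0iK.
by case: ifP => h; rewrite t0_e // h // subrK.
Qed.

Lemma transl_e z c a k i : (k <= n)%N -> (i <= n)%N ->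
  (forall a i, (i <= n)%N -> z (e a i) = if i == 0%N then e (a + c) i else e a i) ->
  transl z k (e a i) = if i == k then e (a + c) i else e a i.
Proof.
move=> hk hi hz; elim: k i hk hi => [|k IH] i hk hi /=; first exact: hz.
rewrite s_e // IH ?sw_ltn //; last exact: ltnW.
have -> : (sw k i == k) = (i == k.+1) by rewrite /sw; do !case: eqP; lia.
by case: ifP => h; rewrite s_e // swK.
Qed.

Definition letter (p : nat * bool) : X -> X :=
  transl (if p.2 then t0 else t0i) p.1.

Definition letters (l : seq (nat * bool)) (x : X) := foldl (fun y p => letter p y) x l.
Arguments letters : simpl never.

Lemma letters_cat l l' x : letters (l ++ l') x = letters l' (letters l x).
Proof. exact: foldl_cat. Qed.

Let zb (b : bool) := if b then t0 else t0i.

Lemma zb_zcomm b : zcomm (zb b).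
Proof. by case: b; [exact: t0_zcomm | exact: t0i_zcomm]. Qed.

Lemma zb_comm b b' : commutes (zb b) (zb b').
Proof. by case: b; case: b' => x //=; rewrite ?t0K ?t0iK. Qed.

Lemma transl1K (z z' : X -> X) : cancel z z' -> cancel (transl z 1) (transl z' 1).
Proof. by move=> h x /=; rewrite !s_invol // h s_invol. Qed.

Lemma commutes_canl (f f' g : X -> X) : cancel f f' -> cancel f' f ->
  commutes f g -> commutes f' g.
Proof. by move=> fK f'K h x; apply: (can_inj fK); rewrite f'K h f'K. Qed.

Lemma commutes_sym (f g : X -> X) : commutes f g -> commutes g f.
Proof. by move=> h x; rewrite h. Qed.

Lemma zb_comm1 b b' : commutes (zb b) (transl (zb b') 1).
Proof.
have H b0 : commutes (zb b0) (transl t0 1).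
  case: b0; first exact: t0_comm1.
  exact: (commutes_canl t0K t0iK t0_comm1).
case: b'; first exact: H.
apply: commutes_sym; apply: (@commutes_canl (transl t0 1)).
- exact/transl1K/t0K.
- exact/transl1K/t0iK.
- exact/commutes_sym/H.
Qed.

Lemma letter_comm p p' : (p.1 <= n)%N -> (p'.1 <= n)%N ->
  commutes (letter p) (letter p').
Proof.
case: p p' => [i b] [j b'] /= hi hj.
have [hij|/ltnW hij] := leqP i j.
  by apply: transl_comm_le (zb_zcomm b) (zb_zcomm b') (@zb_comm b b') (@zb_comm1 b b') _ _.
apply: commutes_sym.
by apply: transl_comm_le (zb_zcomm b') (zb_zcomm b) (@zb_comm b' b) (@zb_comm1 b' b) _ _.
Qed.

Lemma s_letter j p x : (j < n)%N -> (p.1 <= n)%N ->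
  s j (letter p x) = letter (sw j p.1, p.2) (s j x).
Proof. by move=> hj hp; apply: transl_s => //; exact: zb_zcomm. Qed.

Lemma letterK i b : (i <= n)%N -> cancel (letter (i, b)) (letter (i, ~~ b)).
Proof.
rewrite /letter /=; elim: i => [|i IH] hi x /=.
  by case: b => /=; rewrite ?t0K ?t0iK.
have h := IH (ltnW hi).
by rewrite s_invol // h s_invol.
Qed.

Lemma word_act_letter l p : all (fun i => i < n)%N l -> (p.1 <= n)%N ->
  exists2 p', (p'.1 <= n)%N & forall x,
    word_act s l (letter p x) = letter p' (word_act s l x).
Proof.
elim: l p => [|i l IH] p /=; first by move=> _ hp; exists p.
move=> /andP[hi hl] hp; have [|p' hp' E] := IH (sw i p.1, p.2) hl.
  by rewrite sw_ltn.
by exists p' => // x; rewrite /word_act /= -!/(word_act s _ _) s_letter.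
Qed.

Lemma letter_word_act l p : all (fun i => i < n)%N l -> (p.1 <= n)%N ->
  exists2 p', (p'.1 <= n)%N & forall x,
    letter p (word_act s l x) = word_act s l (letter p' x).
Proof.
move=> hl hp; have hl' : all (fun i => i < n)%N (rev l) by rewrite all_rev.
have [p' hp' E] := word_act_letter hl' hp.
exists p' => // x.
by rewrite -[LHS](@word_act_Krev _ n s s_invol l) // E (@word_act_revK _ n).
Qed.

Lemma letters_perm l l' x : all (fun p => p.1 <= n)%N l -> perm_eq l l' ->
  letters l x = letters l' x.
Proof.
elim: l l' x => [|p l IH] l' x; first by move=> _; rewrite perm_sym => /perm_nilP ->.
move=> /= /andP[hp hl] hpl; have hp' : p \in l' by rewrite -(perm_mem hpl) inE eqxx.
case/splitPr: hp' hpl => l1 l2 hpl.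
have hpl' : perm_eq l (l1 ++ l2).
  by have := perm_trans hpl (permEl (perm_catCA l1 [:: p] l2)); rewrite /= perm_cons.
have hl1 : all (fun p => p.1 <= n)%N l1.
  by move: hl; rewrite (perm_all _ hpl') all_cat => /andP[].
rewrite -[letters (p :: l) x]/(letters l (letter p x)) (IH _ _ hl hpl') !letters_cat.
rewrite -[letters (p :: l2) _]/(letters l2 (letter p _)); congr (letters l2 _).
elim: l1 x hl1 {hpl hpl'} => [|p1 l1 IH1] x //= /andP[hp1 hl1].
rewrite -![letters (p1 :: l1) _]/(letters l1 (letter p1 _)).
by rewrite letter_comm // IH1.
Qed.

Definition exponent (l : seq (nat * bool)) (i : nat) : int :=
  (count_mem (i, true) l)%:Z - (count_mem (i, false) l)%:Z.

Lemma letters_e l a i : all (fun p => p.1 <= n)%N l -> (i <= n)%N ->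
  letters l (e a i) = e (a + exponent l i) i.
Proof.
move=> + hi; elim: l a => [|[k b] l IH] a /=.
  by rewrite /exponent /= subrr addr0.
move=> /andP[hk hl]; rewrite /letters /= -/(letters l _).
have -> : letter (k, b) (e a i)
    = if i == k then e (a + (if b then 1 else -1)) i else e a i.
  rewrite /letter /=; apply: transl_e => // a' i' hi'.
  by case: b; [exact: t0_e | exact: t0i_e].
rewrite /exponent /= !xpair_eqE (eq_sym k) in IH *.
case: eqP => _; rewrite IH //=; case: b => /=; congr (e _ _);
  rewrite /exponent; lia.
Qed.

(** As the letters commute, the first one can be brought next to an inverse, which occurs because
    the exponent of its coordinate vanishes; cancelling the pair shortens the word. *)
Lemma letters_trivial l x : all (fun p => p.1 <= n)%N l ->
  (forall i, (i <= n)%N -> exponent l i = 0) -> letters l x = x.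
Proof.
move: {2}(size l) (leqnn (size l)) => m; elim: m l => [|m IH] l.
  by rewrite leqn0 size_eq0 => /eqP ->.
case: l => [|[k b] l] //= hsz /andP[hk hl] h0.
have hp : (k, ~~ b) \in l.
  rewrite -has_pred1 has_count.
  by have := h0 k hk; rewrite /exponent /=; case: b {hsz h0};
     rewrite !xpair_eqE eqxx /=; lia.
have hpl := perm_to_rem hp; rewrite /letters /= -/(letters l _).
rewrite (letters_perm _ hl hpl) /letters /= -/(letters _ _) letterK //.
have hsz' := perm_size hpl; rewrite /= in hsz'.
apply: IH; first by lia.
  by move: hl; rewrite (perm_all _ hpl) => /andP[].
move=> i hi; rewrite -[RHS](h0 i hi) /exponent /=.
by rewrite !(seq.permP hpl) /= !xpair_eqE; case: (k == i); case: b {hp hpl h0 hsz hsz'} => /=; lia.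
Qed.

Inductive affine_reach : (X -> X) -> Prop :=
| affine_reach_id : affine_reach id
| affine_reach_s f i : (i < n)%N -> affine_reach f -> affine_reach (fun x => s i (f x))
| affine_reach_w f : affine_reach f -> affine_reach (fun x => w (f x))
| affine_reach_wi f : affine_reach f -> affine_reach (fun x => wi (f x)).

Lemma affine_reach_normal f : affine_reach f ->
  exists lt ls, [/\ all (fun p => p.1 <= n)%N lt, all (fun i => i < n)%N ls &
    forall x, f x = word_act s ls (letters lt x)].
Proof.
have step ls lt p : all (fun i => i < n)%N ls -> all (fun p => p.1 <= n)%N lt ->
    (p.1 <= n)%N -> exists2 lt', all (fun p => p.1 <= n)%N lt' & forall x,
      letter p (word_act s ls (letters lt x)) = word_act s ls (letters lt' x).
  move=> hls hlt hp; have [p' hp' E] := letter_word_act hls hp.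
  exists (rcons lt p'); first by rewrite all_rcons hp'.
  by move=> x; rewrite -cats1 letters_cat E.
have hD : all (fun i => i < n)%N (descent 0 n) by rewrite all_rev subn0 iota_ok.
elim=> [|{}f i hi _ [lt [ls [hlt hls E]]]|{}f _ [lt [ls [hlt hls E]]]
  |{}f _ [lt [ls [hlt hls E]]]].
- by exists [::], [::].
- exists lt, (rcons ls i); split=> // [|x]; first by rewrite all_rcons hi.
  by rewrite E -cats1 word_act_cat.
(* By definition of [t0], [w] is the translation at 0 followed by the word [0, ..., n-1]; dually,
   [wi] is the word [descent 0 n] followed by the inverse translation. *)
- have [lt' hlt' E'] := step ls lt (0%N, true) hls hlt isT.
  exists lt', (ls ++ iota 0 n); split=> // [|x]; first by rewrite all_cat hls iota_ok.
  rewrite E word_act_cat -E' /letter /= /t0 /descent subn0 (@word_act_Krev _ n) //.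
  exact: iota_ok.
- have hlsD : all (fun i => i < n)%N (ls ++ descent 0 n) by rewrite all_cat hls.
  have [lt' hlt' E'] := step _ lt (0%N, false) hlsD hlt isT.
  exists lt', (ls ++ descent 0 n); split=> // x.
  rewrite E -E' /letter /= /t0i word_act_cat /descent subn0 (@word_act_Krev _ n) //.
  exact: iota_ok.
Qed.

Lemma word_act_e l a i : all (fun j => j < n)%N l -> (i <= n)%N ->
  word_act s l (e a i) = e a (word_act sw l i) /\ (word_act sw l i <= n)%N.
Proof.
elim: l i => [|j l IH] i //= /andP[hj hl] hi.
by rewrite /word_act /= -!/(word_act _ _ _) s_e //; apply: IH; rewrite // sw_ltn.
Qed.

(** The image of [e 0 i] displays the exponent of the translation at [i] and the image of [i] under
    the permutation part, so fixing these points kills both parts of the normal form. *)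
Lemma affine_reach_trivial f : affine_reach f ->
  (forall i, (i <= n)%N -> f (e 0 i) = e 0 i) -> forall x, f x = x.
Proof.
move=> /affine_reach_normal[lt [ls [hlt hls E]]] h.
have key i : (i <= n)%N -> exponent lt i = 0 /\ word_act sw ls i = i.
  move=> hi; have [E1 hi'] := word_act_e (0 + exponent lt i) hls hi.
  have := h i hi; rewrite E letters_e // E1 add0r => hE.
  exact: e_inj hE.
move=> x; rewrite E letters_trivial //; last by move=> i /key[].
apply: (@word_act_trivial X n s _ _ _ (e 0)) => //.
- by move=> *; exact: s_e.
- by move=> i j hi hj /(e_inj hi hj)[].
- by move=> i hi; have [-> _] := word_act_e 0 hls hi; rewrite (key i hi).2.
Qed.

Lemma affine_reach_comp f g : affine_reach f -> affine_reach g ->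
  affine_reach (fun x => f (g x)).
Proof.
move=> + hg; elim=> // *; [exact: affine_reach_s | exact: affine_reach_w |].
exact: affine_reach_wi.
Qed.

Lemma affine_reach_inv f : affine_reach f ->
  exists g, [/\ affine_reach g, cancel f g & cancel g f].
Proof.
elim=> [|{}f i hi _ [g [hg fK gK]]|{}f _ [g [hg fK gK]]|{}f _ [g [hg fK gK]]].
- by exists id; split=> //; exact: affine_reach_id.
- exists (fun x => g (s i x)); split=> [|x|x]; rewrite ?gK ?s_invol ?fK //.
  exact: affine_reach_comp hg (affine_reach_s hi affine_reach_id).
- exists (fun x => g (wi x)); split=> [|x|x]; rewrite ?gK ?wK ?fK ?wiK //.
  exact: affine_reach_comp hg (affine_reach_wi affine_reach_id).
- exists (fun x => g (w x)); split=> [|x|x]; rewrite ?gK ?wiK ?fK ?wK //.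
  exact: affine_reach_comp hg (affine_reach_w affine_reach_id).
Qed.

Lemma affine_reach_eq f f' : affine_reach f -> affine_reach f' ->
  (forall i, (i <= n)%N -> f (e 0 i) = f' (e 0 i)) -> forall x, f x = f' x.
Proof.
move=> hf /affine_reach_inv[g [hg fK gK]] h x.
apply: (can_inj gK); rewrite fK.
apply: (@affine_reach_trivial (fun x => g (f x))); first exact: affine_reach_comp.
by move=> i hi; rewrite h // fK.
Qed.

End AffineWords.

(** * Intertwiners *)

(** Linear combinations as syntax. Agreement of all coefficients suffices for equality of the
    values, whether or not the vectors are independent, and leaves goals about scalars for [ring]
    and [field]. *)
Inductive lmod_expr (F : Type) : Type :=
| LVar of nat | LZero | LAdd of lmod_expr F & lmod_expr F
| LOpp of lmod_expr F | LScale of F & lmod_expr F.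
Arguments LVar {F}.
Arguments LZero {F}.

Fixpoint lmod_eval (F : pzRingType) (U : lmodType F) (vs : seq U) (e : lmod_expr F) : U :=
  match e with
  | LVar i => nth 0 vs i
  | LZero => 0
  | LAdd e1 e2 => lmod_eval vs e1 + lmod_eval vs e2
  | LOpp e1 => - lmod_eval vs e1
  | LScale c e1 => c *: lmod_eval vs e1
  end.

Fixpoint lmod_coef (F : pzRingType) (i : nat) (e : lmod_expr F) : F :=
  match e with
  | LVar j => if i == j then 1 else 0
  | LZero => 0
  | LAdd e1 e2 => lmod_coef i e1 + lmod_coef i e2
  | LOpp e1 => - lmod_coef i e1
  | LScale c e1 => c * lmod_coef i e1
  end.

Fixpoint lmod_same (F : pzRingType) (k : nat) (e1 e2 : lmod_expr F) : Prop :=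
  if k is k'.+1 then lmod_coef k' e1 = lmod_coef k' e2 /\ lmod_same k' e1 e2 else True.

Lemma lmod_eval_coef (F : pzRingType) (U : lmodType F) (vs : seq U) e :
  lmod_eval vs e = \sum_(i < size vs) lmod_coef i e *: vs`_i.
Proof.
elim: e => [j||e1 IH1 e2 IH2|e IH|c e IH] /=.
- have [hj|hj] := ltnP j (size vs).
    rewrite (bigD1 (Ordinal hj)) //= eqxx scale1r big1 ?addr0 // => i.
    by rewrite -val_eqE /= => /negPf->; rewrite scale0r.
  rewrite nth_default // big1 // => i _; case: eqP => [ei|_]; last by rewrite scale0r.
  by have := ltn_ord i; rewrite ei ltnNge hj.
- by rewrite big1 // => i _; rewrite scale0r.
- by rewrite IH1 IH2 -big_split /=; apply: eq_bigr => i _; rewrite scalerDl.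
- by rewrite IH -sumrN; apply: eq_bigr => i _; rewrite scaleNr.
- by rewrite IH scaler_sumr; apply: eq_bigr => i _; rewrite scalerA.
Qed.

Lemma lmod_eval_eq (F : pzRingType) (U : lmodType F) (vs : seq U) e1 e2 :
  lmod_same (size vs) e1 e2 -> lmod_eval vs e1 = lmod_eval vs e2.
Proof.
move=> h; rewrite !lmod_eval_coef; apply: eq_bigr => i _; congr (_ *: _).
move: (size vs) i h => m; elim: m => [|m IH] [i hi] //= [h1 h2].
move: hi; rewrite ltnS leq_eqVlt => /orP[/eqP->//|hi].
exact: (IH (Ordinal hi)).
Qed.

Ltac lmod_index t vs :=
  lazymatch vs with
  | ?v :: ?vs' =>
    match v with
    | t => constr:(0%N)
    | _ => let k := lmod_index t vs' in constr:(S k)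
    end
  end.

Ltac lmod_reify F vs t :=
  lazymatch t with
  | ?a + ?b => let x := lmod_reify F vs a in let y := lmod_reify F vs b in constr:(@LAdd F x y)
  | - ?a => let x := lmod_reify F vs a in constr:(@LOpp F x)
  | ?c *: ?a => let x := lmod_reify F vs a in constr:(@LScale F c x)
  | 0 => constr:(@LZero F)
  | _ => let k := lmod_index t vs in constr:(@LVar F k)
  end.

(* Turns an equation between linear combinations of the vectors [vs] into the
   equations between their coefficients. *)
Ltac lmod_coefs F vs :=
  match goal with |- ?l = ?r =>
    let x := lmod_reify F vs l in let y := lmod_reify F vs r in
    change (lmod_eval vs x = lmod_eval vs y); apply: lmod_eval_eq;
    rewrite /=; repeat split
  end.

(** * Baxterised Hecke generators, intertwiners and the twisted rotation *)

Section Intertwiners.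
Variables (F : fieldType) (U : lmodType F) (n : nat) (q s : F).
Variables (x : nat -> F) (sF : nat -> {rmorphism F -> F}) (wF : {rmorphism F -> F}).
Variables (sU : nat -> U -> U) (wU wUi : U -> U) (h : nat -> {linear U -> U}).
Hypothesis n_gt0 : (0 < n)%N.
Hypothesis s_neq0 : s != 0.
Hypothesis q_neq0 : q != 0.
Hypothesis x_neq : forall i j, (i <= n)%N -> (j <= n)%N -> i != j -> x i != x j.
Hypothesis sx_neq : forall i j, (i <= n)%N -> (j <= n)%N -> i != j -> s * x i != x j.
Hypothesis sF_s : forall i, (i < n)%N -> sF i s = s.
Hypothesis sF_x : forall i j, (i < n)%N -> (j <= n)%N -> sF i (x j) = x (sw i j).
Hypothesis wF_s : wF s = s.
Hypothesis wF_x0 : wF (x 0) = q * x n.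
Hypothesis wF_xS : forall i, (i < n)%N -> wF (x i.+1) = x i.
Hypothesis wF_q : wF q = q.
Hypothesis sUD : forall i u v, sU i (u + v) = sU i u + sU i v.
Hypothesis sUZ : forall i a u, (i < n)%N -> sU i (a *: u) = sF i a *: sU i u.
Hypothesis wUD : forall u v, wU (u + v) = wU u + wU v.
Hypothesis wUZ : forall a u, wU (a *: u) = wF a *: wU u.
Hypothesis sU_invol : forall i u, (i < n)%N -> sU i (sU i u) = u.
Hypothesis sU_braid : forall i u, (i.+1 < n)%N ->
  sU i (sU i.+1 (sU i u)) = sU i.+1 (sU i (sU i.+1 u)).
Hypothesis sU_comm : forall i j u, (i.+1 < j)%N -> (j < n)%N ->
  sU i (sU j u) = sU j (sU i u).
Hypotheses (wUK : cancel wU wUi) (wUiK : cancel wUi wU).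
Hypothesis wU_s : forall i u, (i.+1 < n)%N -> wU (sU i.+1 u) = sU i (wU u).
Hypothesis wU2_s : forall u, wU (wU (sU 0 u)) = sU n.-1 (wU (wU u)).
Hypothesis h_sU : forall i j u, h i (sU j u) = sU j (h i u).
Hypothesis h_wU : forall i u, h i (wU u) = wU (h i u).
Hypothesis h_quad : forall i u, (i < n)%N -> h i (h i u) = (s - 1) *: h i u + s *: u.
Hypothesis h_braid : forall i u, (i.+1 < n)%N ->
  h i (h i.+1 (h i u)) = h i.+1 (h i (h i.+1 u)).
Hypothesis h_comm : forall i j u, (i.+1 < j)%N -> (j < n)%N ->
  h i (h j u) = h j (h i u).

Definition demazure (i j : nat) : F := (1 - s) * x j / (x i - x j).
Local Notation b := demazure.

(** The Hecke generator baxterised with spectral parameter [c]. The factor [(s - c)^-1] gives it the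
    value 1 on the eigenvalue [s] of [h i]; with this normalisation the intertwiners are
    involutions. *)
Definition spectral (i : nat) (c : F) (u : U) : U := (s - c)^-1 *: (h i u - c *: u).

Definition intertwiner (i : nat) (u : U) : U := spectral i (b i i.+1) (sU i u).

Let subx_neq0 i j : (i <= n)%N -> (j <= n)%N -> i != j -> x i - x j != 0.
Proof. by move=> *; rewrite subr_eq0 x_neq. Qed.

Lemma sub_demazure_neq0 i j : (i <= n)%N -> (j <= n)%N -> i != j -> s - b i j != 0.
Proof.
move=> hi hj hij; have hx := subx_neq0 hi hj hij.
have -> : s - b i j = (s * x i - x j) / (x i - x j) by rewrite /demazure; field.
by rewrite mulf_neq0 ?invr_eq0 // subr_eq0 sx_neq.
Qed.

Lemma demazure_add i j : (i <= n)%N -> (j <= n)%N -> i != j -> b i j + b j i = s - 1.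
Proof.
move=> hi hj hij; have hx := subx_neq0 hi hj hij.
have hx' : x j - x i != 0 by apply: subx_neq0; rewrite // eq_sym.
by rewrite /demazure; field; rewrite hx hx'.
Qed.

Lemma demazure_yb i j k : (i <= n)%N -> (j <= n)%N -> (k <= n)%N ->
  i != j -> j != k -> i != k ->
  b i k * b j k + b i j * b i k - b i j * b j k = (s - 1) * b i k.
Proof.
move=> hi hj hk hij hjk hik.
have h1 := subx_neq0 hi hj hij; have h2 := subx_neq0 hj hk hjk.
have h3 := subx_neq0 hi hk hik.
by rewrite /demazure; field; rewrite h1 h2 h3.
Qed.

Lemma sF_demazure k i j : (k < n)%N -> (i <= n)%N -> (j <= n)%N ->
  sF k (b i j) = b (sw k i) (sw k j).
Proof.
by move=> hk hi hj; rewrite /demazure fmorph_div rmorphM !rmorphB rmorph1 sF_s // !sF_x.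
Qed.

Lemma wF_demazureS i j : (i < n)%N -> (j < n)%N -> wF (b i.+1 j.+1) = b i j.
Proof.
by move=> hi hj; rewrite /demazure fmorph_div rmorphM !rmorphB rmorph1 wF_s // !wF_xS.
Qed.

(** Two rotations send x_0 and x_1 to q x_{n-1} and q x_n; the common factor q cancels because [b]
    is homogeneous of degree 0. *)
Lemma wF2_demazure : wF (wF (b 0 1)) = b n.-1 n.
Proof.
rewrite /demazure !(fmorph_div, rmorphM, rmorphB, rmorph1) /= !wF_s wF_x0 wF_xS //.
have wxn : wF (x n) = x n.-1 by rewrite -{1}(prednK n_gt0) wF_xS // prednK.
rewrite rmorphM wF_q wF_x0 wxn.
have hx : x n.-1 - x n != 0 by apply: subx_neq0; lia.
by rewrite -mulrBr mulrCA invfM; field; rewrite q_neq0 hx.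
Qed.

Lemma sU_spectral k i c u : (k < n)%N -> sU k (spectral i c u) = spectral i (sF k c) (sU k u).
Proof.
move=> hk; rewrite /spectral sUZ // fmorphV rmorphB sF_s //; congr (_ *: _).
by rewrite -!scaleN1r sUD !sUZ // rmorphN1 h_sU.
Qed.

Lemma wU_spectral i c u : wU (spectral i c u) = spectral i (wF c) (wU u).
Proof.
rewrite /spectral wUZ // fmorphV rmorphB wF_s //; congr (_ *: _).
by rewrite -!scaleN1r wUD !wUZ // rmorphN1 h_wU.
Qed.

Let hB i u v : h i (u - v) = h i u - h i v. Proof. exact: linearB. Qed.
Let hZ i a u : h i (a *: u) = a *: h i u. Proof. exact: linearZ. Qed.
Let hE := (hB, hZ).

(** By the quadratic relation and [c + c' = s - 1], the product (h - c)(h - c') is the scalar s + c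
    c', which is also (s - c)(s - c'). *)
Lemma spectral_inv i c c' u : (i < n)%N -> c + c' = s - 1 -> s - c != 0 -> s - c' != 0 ->
  spectral i c (spectral i c' u) = u.
Proof.
move=> hi e hc hc'; rewrite /spectral !hE h_quad //.
have es : s = c + c' + 1 by rewrite e; ring.
by lmod_coefs F [:: u; h i u]; rewrite es in hc hc' *; field; rewrite hc hc'.
Qed.

(** After expansion by the quadratic and braid relations, all coefficients of the two triple
    products agree except those of [h i] and [h i.+1], and each of these two comparisons is the
    hypothesis on [c], [d], [e]. *)
Lemma spectral_yb i c d e u : (i.+1 < n)%N ->
  e * d + c * e - c * d = (s - 1) * e ->
  spectral i c (spectral i.+1 e (spectral i d u))
  = spectral i.+1 d (spectral i e (spectral i.+1 c u)).
Proof.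
move=> hi hcde; have hi' := ltnW hi.
have hcd : c * d = e * d + c * e - (s - 1) * e by rewrite -hcde; ring.
rewrite /spectral !hE !h_quad // h_braid //.
set k1 := (s - c)^-1; set k2 := (s - d)^-1; set k3 := (s - e)^-1.
lmod_coefs F [:: u; h i u; h i.+1 u; h i (h i.+1 u); h i.+1 (h i u); h i.+1 (h i (h i.+1 u))];
  by ring: hcd.
Qed.

Lemma spectral_comm i j c d u : (i.+1 < j)%N -> (j < n)%N ->
  spectral i c (spectral j d u) = spectral j d (spectral i c u).
Proof.
move=> hij hj; rewrite /spectral !hE h_comm //.
by lmod_coefs F [:: u; h i u; h j u; h j (h i u)]; ring.
Qed.

Lemma intertwiner_invol i u : (i < n)%N -> intertwiner i (intertwiner i u) = u.
Proof.
move=> hi; have hi' := ltnW hi; rewrite /intertwiner sU_spectral // sF_demazure // sU_invol //.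
have -> : sw i i = i.+1 by rewrite /sw eqxx.
have -> : sw i i.+1 = i by rewrite /sw eqxx; case: eqP => //; lia.
have hii : i != i.+1 by lia.
have hii' : i.+1 != i by lia.
by rewrite spectral_inv ?demazure_add ?sub_demazure_neq0.
Qed.

Lemma intertwiner_braid i u : (i.+1 < n)%N ->
  intertwiner i (intertwiner i.+1 (intertwiner i u))
  = intertwiner i.+1 (intertwiner i (intertwiner i.+1 u)).
Proof.
move=> hi; have hi' := ltnW hi; have hi'' := ltnW hi'.
rewrite /intertwiner !sU_spectral // !sF_demazure ?sw_ltn //.
have E1 : sw i i = i.+1 by rewrite /sw eqxx.
have E2 : sw i i.+1 = i by rewrite /sw eqxx; case: eqP => //; lia.
have E3 : sw i i.+2 = i.+2 by rewrite /sw; do !case: eqP => //; lia.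
have E4 : sw i.+1 i = i by rewrite /sw; do !case: eqP => //; lia.
have E5 : sw i.+1 i.+1 = i.+2 by rewrite /sw eqxx.
have E6 : sw i.+1 i.+2 = i.+1 by rewrite /sw eqxx; case: eqP => //; lia.
rewrite !(E1, E2, E3, E4, E5, E6) sU_braid //.
(* With every [sU] moved inwards, the parameters are [b i i.+1], [b i i.+2], [b i.+1 i.+2], in
   opposite orders on the two sides. *)
apply: spectral_yb => //.
by rewrite -(@demazure_yb i i.+1 i.+2) //; try lia; ring.
Qed.

Lemma intertwiner_comm i j u : (i.+1 < j)%N -> (j < n)%N ->
  intertwiner i (intertwiner j u) = intertwiner j (intertwiner i u).
Proof.
move=> hij hj; have hi : (i < n)%N by lia.
rewrite /intertwiner !sU_spectral // !sF_demazure //; try lia.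
have -> : sw i j = j by rewrite /sw; do !case: eqP => //; lia.
have -> : sw i j.+1 = j.+1 by rewrite /sw; do !case: eqP => //; lia.
have -> : sw j i = i by rewrite /sw; do !case: eqP => //; lia.
have -> : sw j i.+1 = i.+1 by rewrite /sw; do !case: eqP => //; lia.
by rewrite spectral_comm // sU_comm.
Qed.

Definition wtwist (u : U) : U := coxeter n h (wU u).
Definition hinv (i : nat) (u : U) : U := s^-1 *: (h i u - (s - 1) *: u).
Definition wtwisti (u : U) : U := wUi (word_act hinv (descent 0 n) u).

Lemma hinvK i u : (i < n)%N -> h i (hinv i u) = u.
Proof.
by move=> hi; rewrite /hinv !hE h_quad //; lmod_coefs F [:: u; h i u]; field.
Qed.

Lemma hKinv i u : (i < n)%N -> hinv i (h i u) = u.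
Proof.
by move=> hi; rewrite /hinv h_quad //; lmod_coefs F [:: u; h i u]; field.
Qed.

Lemma word_hK l u : all (fun i => i < n)%N l ->
  word_act hinv (rev l) (word_act h l u) = u /\ word_act h l (word_act hinv (rev l) u) = u.
Proof.
move=> hl; split; elim: l u hl => [|i l IH] u //= /andP[hi hl];
  rewrite rev_cons -cats1 word_act_cat !word_act_cons.
  by rewrite IH // hKinv.
by rewrite hinvK // IH.
Qed.

Let iota_ok : all (fun i => i < n)%N (iota 0 n).
Proof. by apply/allP => i; rewrite mem_iota; lia. Qed.

Lemma wtwistK : cancel wtwist wtwisti.
Proof.
move=> u; rewrite /wtwist /wtwisti /coxeter /descent subn0.
by rewrite (word_hK _ iota_ok).1 wUK.
Qed.

Lemma wtwistiK : cancel wtwisti wtwist.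
Proof.
move=> u; rewrite /wtwist /wtwisti /coxeter /descent subn0 wUiK.
by rewrite (word_hK _ iota_ok).2.
Qed.

Lemma word_act_spectral l i j c u :
  (forall v, word_act h l (h i v) = h j (word_act h l v)) ->
  word_act h l (spectral i c u) = spectral j c (word_act h l u).
Proof.
have lin a v v' : word_act h l (a *: v + v') = a *: word_act h l v + word_act h l v'.
  by elim: l v v' => [|k l IH] v v' //; rewrite !word_act_cons linearP IH.
move=> E; rewrite /spectral -scaleNr [h i u + _]addrC.
rewrite -[in LHS](addr0 (_^-1 *: _)) lin lin E.
have -> : word_act h l 0 = 0.
  by have := lin (-1) 0 0; rewrite scaler0 addr0 scaleN1r addNr.
by rewrite addr0 scaleNr [- (_ *: _) + _]addrC.
Qed.

Lemma wtwist_intertwiner i u : (i.+1 < n)%N ->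
  wtwist (intertwiner i.+1 u) = intertwiner i (wtwist u).
Proof.
move=> hi; have hi' := ltnW hi.
rewrite /wtwist /intertwiner wU_spectral wF_demazureS // wU_s //.
rewrite /coxeter (@word_act_spectral _ i.+1 i); last first.
  by move=> v; exact: (@coxeter_shift _ n).
congr spectral; elim: (iota 0 n) (wU u) => [|k l IH] v //.
by rewrite !word_act_cons h_sU IH.
Qed.

(** Two shifts must match: [coxeter2] moves the Hecke index from 0 to [n.-1], and [wF2_demazure]
    moves the parameter from [b 0 1] to [b n.-1 n]. *)
Lemma wtwist2_intertwiner u :
  wtwist (wtwist (intertwiner 0 u)) = intertwiner n.-1 (wtwist (wtwist u)).
Proof.
have wH l v : wU (word_act h l v) = word_act h l (wU v).
  by elim: l v => [|k l IH] v //; rewrite !word_act_cons IH h_wU.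
have sH l v i : sU i (word_act h l v) = word_act h l (sU i v).
  by elim: l v => [|k l IH] v //; rewrite !word_act_cons IH h_sU.
rewrite /wtwist /intertwiner /coxeter !wH !wU_spectral wF2_demazure wU2_s prednK //.
rewrite !sH -!word_act_cat.
apply: word_act_spectral => v; rewrite !word_act_cat.
exact: (@coxeter2 _ n).
Qed.

Lemma intertwinerZ i a u : (i < n)%N -> intertwiner i (a *: u) = sF i a *: intertwiner i u.
Proof.
move=> hi; rewrite /intertwiner /spectral sUZ // !hE.
by lmod_coefs F [:: sU i u; h i (sU i u)]; ring.
Qed.

Lemma intertwinerD i u v : intertwiner i (u + v) = intertwiner i u + intertwiner i v.
Proof.
rewrite /intertwiner /spectral sUD (linearD (h i)) /=.
by lmod_coefs F [:: sU i u; h i (sU i u); sU i v; h i (sU i v)]; ring.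
Qed.

Lemma wtwistZ a u : wtwist (a *: u) = wF a *: wtwist u.
Proof.
rewrite /wtwist /coxeter wUZ; elim: (iota 0 n) (wU u) => [|k l IH] v //.
by rewrite !word_act_cons hZ IH.
Qed.

Lemma wtwistD u v : wtwist (u + v) = wtwist u + wtwist v.
Proof.
rewrite /wtwist /coxeter wUD; elim: (iota 0 n) (wU u) (wU v) => [|k l IH] v1 v2 //.
by rewrite !word_act_cons linearD IH.
Qed.

End Intertwiners.

(** * Formal sums of semilinear maps *)

Section FormalSums.
Variables (F : fieldType) (m : nat) (T : Type) (key : T -> {ffun 'I_m -> F}).

Definition formal_eval (U : lmodType F) (V : Type) (act : T -> V -> U)
    (l : seq (F * T)) (u : V) : U := \sum_(p <- l) p.1 *: act p.2 u.

Lemma formal_eval_nil (U : lmodType F) V (act : T -> V -> U) u :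
  formal_eval act [::] u = 0.
Proof. exact: big_nil. Qed.

Lemma formal_eval_cons (U : lmodType F) V (act : T -> V -> U) p l u :
  formal_eval act (p :: l) u = p.1 *: act p.2 u + formal_eval act l u.
Proof. exact: big_cons. Qed.

Lemma formal_eval_cat (U : lmodType F) V (act : T -> V -> U) l l' u :
  formal_eval act (l ++ l') u = formal_eval act l u + formal_eval act l' u.
Proof. exact: big_cat. Qed.

Lemma formal_eval_all0 (U : lmodType F) V (act : T -> V -> U) l u :
  all (fun p => p.1 == 0) l -> formal_eval act l u = 0.
Proof.
elim: l => [|p l IH] /=; first by rewrite formal_eval_nil.
by move=> /andP[/eqP p0 /IH hl]; rewrite formal_eval_cons hl p0 scale0r addr0.
Qed.

Lemma formal_insert a t l : uniq (map (key \o snd) l) ->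
  exists l', [/\ uniq (map (key \o snd) l'),
    {subset map (key \o snd) l' <= key t :: map (key \o snd) l} &
    forall (U : lmodType F) V (act : T -> V -> U) u,
      (forall t t', key t = key t' -> act t u = act t' u) ->
      formal_eval act l' u = formal_eval act ((a, t) :: l) u].
Proof.
elim: l => [|[b t'] l IH] /=; first by move=> _; exists [:: (a, t)]; split.
case/andP => ht' hl; have [htt'|htt'] := eqVneq (key t) (key t').
  exists ((a + b, t') :: l); split=> /=; first by rewrite ht'.
    by move=> k hk; rewrite inE hk orbT.
  move=> U V act u e; rewrite !formal_eval_cons /= (e _ _ htt') scalerDl addrA //.
have [l' [hl' sub E]] := IH hl; exists ((b, t') :: l'); split=> /=.
- rewrite hl' andbT; apply/negP => /sub; rewrite inE /= eq_sym (negPf htt') /=.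
  by rewrite (negPf ht').
- move=> k; rewrite !inE => /orP[->|/sub]; first by rewrite orbT.
  by rewrite inE => /orP[->|->] //; rewrite !orbT.
- by move=> U V act u e; rewrite !formal_eval_cons E // formal_eval_cons /= addrCA.
Qed.

(** The merged list is fixed before [U], [V] and [act], so the same coefficients can be tested in
    one action and used in another. *)
Lemma formal_merge l : exists2 l', uniq (map (key \o snd) l') &
    forall (U : lmodType F) V (act : T -> V -> U) u,
      (forall t t', key t = key t' -> act t u = act t' u) ->
      formal_eval act l' u = formal_eval act l u.
Proof.
elim: l => [|[a t] l [l' hl' E]]; first by exists [::].
have [l'' [hl'' _ E']] := formal_insert a t hl'.
exists l'' => // U V act u e; rewrite E' // !formal_eval_cons E //.
Qed.

Variables (x : 'I_m -> F).

(** Evaluating at [x i *: u] and subtracting [key t i] times the relation at [u] removes the head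
    term and multiplies the other coefficients by differences of keys. Test vectors are only
    multiplied by some [x i], which is why stability of [L] under these is the condition imposed on
    it. *)
Lemma dedekind (U V : lmodType F) (act : T -> V -> U) (L : V -> Prop) l :
  (forall i u, L u -> L (x i *: u)) ->
  (forall t i u, act t (x i *: u) = key t i *: act t u) ->
  (forall t, exists2 u, L u & act t u != 0) ->
  uniq (map (key \o snd) l) ->
  (forall u, L u -> formal_eval act l u = 0) -> all (fun p => p.1 == 0) l.
Proof.
move=> Lx semi nz; move: {2}(size l) (erefl (size l)) => k.
elim: k l => [|k IH] [|[a t] l] //= [hsz] /andP[ht hl] h0.
have step i : all (fun p => p.1 * (key p.2 i - key t i) == 0) l.
  pose f (p : F * T) := (p.1 * (key p.2 i - key t i), p.2).
  have := IH (map f l); rewrite size_map all_map; apply => //.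
    by rewrite -map_comp (eq_map (g := key \o snd)).
  move=> u Lu; rewrite /formal_eval big_map.
  transitivity (formal_eval act ((a, t) :: l) (x i *: u)
                - key t i *: formal_eval act ((a, t) :: l) u); last first.
    by rewrite !h0 ?scaler0 ?subr0 //; exact: Lx.
  rewrite !formal_eval_cons /= semi scalerDr !scalerA [key t i * a]mulrC opprD addrACA subrr add0r.
  rewrite /formal_eval scaler_sumr -sumrB; apply: eq_bigr => p _.
  by rewrite semi !scalerA -scalerBl; congr (_ *: _); ring.
have l0 : all (fun p => p.1 == 0) l.
  move: ht step {h0 hl hsz}; elim: l => //= p l IHl; rewrite inE negb_or.
  move=> /andP[hp hl] step; rewrite IHl // ?andbT; last first.
    by move=> i; case/andP: (step i).
  apply: contraT => p0; case/negP: hp; apply/eqP/ffunP => i.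
  have /andP[] := step i; rewrite mulf_eq0 (negPf p0) /= subr_eq0 => /eqP-> //.
rewrite l0 andbT; have [u Lu hu] := nz t; have := h0 u Lu.
rewrite formal_eval_cons /= (_ : formal_eval act l u = 0); last first.
  exact: formal_eval_all0.
by move/eqP; rewrite addr0 scaler_eq0 (negPf hu) orbF.
Qed.

Lemma formal_eval_transfer (U V U' V' : lmodType F) (act : T -> V -> U)
    (act' : T -> V' -> U') (L : V -> Prop) l :
  (forall i u, L u -> L (x i *: u)) ->
  (forall t i u, act t (x i *: u) = key t i *: act t u) ->
  (forall t, exists2 u, L u & act t u != 0) ->
  (forall t t', key t = key t' -> act t =1 act t') ->
  (forall t t', key t = key t' -> act' t =1 act' t') ->
  (forall u, L u -> formal_eval act l u = 0) -> forall u, formal_eval act' l u = 0.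
Proof.
move=> Lx semi nz e e' h0 u; have [l' hl' E] := formal_merge l.
rewrite -E; last by move=> t t' /e'.
apply: formal_eval_all0; apply: (dedekind Lx semi nz hl') => v Lv.
by rewrite E ?h0 // => t t' /e.
Qed.

End FormalSums.

(** * Seminormal representations *)

Section Seminormal.
Variables (F : fieldType) (U : lmodType F) (n : nat) (s : F).
Variables (I P : Type) (pos : I -> nat -> P) (cont : P -> F) (kap : P -> P -> F).
Variables (sg : nat -> I -> I) (e : I -> U) (h : nat -> {linear U -> U}).

(** With [cont] the power of s whose exponent is the content, this is (s - 1) / (1 - s^m), where m
    is the content of [p'] minus that of [p]. *)
Definition diag_coef (p p' : P) : F := (s - 1) / (1 - cont p' / cont p).
Local Notation A := diag_coef.

Hypothesis cont_neq0 : forall p, cont p != 0.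
Hypothesis pos_sg : forall i T, (i < n)%N -> kap (pos T i) (pos T i.+1) != 0 ->
  forall a, (a <= n)%N -> pos (sg i T) a = pos T (sw i a).
Hypothesis pos_inj : forall T T', (forall a, (a <= n)%N -> pos T a = pos T' a) -> T = T'.
Hypothesis kapK : forall i T, (i < n)%N ->
  kap (pos T i) (pos T i.+1) * kap (pos T i.+1) (pos T i)
  = (1 + A (pos T i) (pos T i.+1)) * (s - A (pos T i) (pos T i.+1)).
Hypothesis cont_neq1 : forall i T, (i < n)%N -> cont (pos T i) != cont (pos T i.+1).
Hypothesis cont_neq2 : forall i T, (i.+1 < n)%N -> cont (pos T i) != cont (pos T i.+2).
Hypothesis h_e : forall i T, (i < n)%N ->
  h i (e T) = A (pos T i) (pos T i.+1) *: e T
              + kap (pos T i) (pos T i.+1) *: e (sg i T).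

Let hD i u v : h i (u + v) = h i u + h i v. Proof. exact: linearD. Qed.
Let hZ i a u : h i (a *: u) = a *: h i u. Proof. exact: linearZ. Qed.
Let hE := (hD, hZ).

Let subq_neq0 p p' : cont p != cont p' -> cont p - cont p' != 0.
Proof. by rewrite subr_eq0. Qed.

Lemma diag_coefE p p' : cont p != cont p' ->
  A p p' = (s - 1) * cont p / (cont p - cont p').
Proof.
move=> /subq_neq0 hp; rewrite /diag_coef; field.
by rewrite cont_neq0 hp.
Qed.

Lemma diag_coefC p p' : cont p != cont p' -> A p p' + A p' p = s - 1.
Proof.
move=> hp; have hp' : cont p' != cont p by rewrite eq_sym.
rewrite !diag_coefE //; field.
by rewrite !subq_neq0.
Qed.

Lemma seminormal_sg_swap i T : (i < n)%N -> kap (pos T i) (pos T i.+1) != 0 ->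
  pos (sg i T) i = pos T i.+1 /\ pos (sg i T) i.+1 = pos T i.
Proof.
move=> hi hk; rewrite !(pos_sg hi hk) //; last exact: ltnW.
by rewrite /sw !eqxx; split=> //; case: eqP => //; lia.
Qed.

Let sg_swap_e i T : (i < n)%N ->
  h i (kap (pos T i) (pos T i.+1) *: e (sg i T))
  = A (pos T i.+1) (pos T i) *: (kap (pos T i) (pos T i.+1) *: e (sg i T))
    + ((1 + A (pos T i) (pos T i.+1)) * (s - A (pos T i) (pos T i.+1))) *: e T.
Proof.
move=> hi; rewrite -kapK //.
have [->|hk] := eqVneq (kap (pos T i) (pos T i.+1)) 0.
  by rewrite mul0r !scale0r linear0 scaler0 addr0.
have [E1 E2] := seminormal_sg_swap hi hk.
rewrite hZ h_e // E1 E2 scalerDr !scalerA [_ * A _ _]mulrC.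
have [->|hk'] := eqVneq (kap (pos T i.+1) (pos T i)) 0; first by rewrite !mulr0 !scale0r.
have -> // : sg i (sg i T) = T.
by apply: pos_inj => a ha; rewrite pos_sg ?E1 ?E2 // pos_sg ?sw_ltn // swK.
Qed.

(** The 2 by 2 matrix of [h i] on [e T] and its swap has trace s - 1 by [diag_coefC] and determinant
    -s by [kapK], so this is Cayley-Hamilton. Where the swap has coefficient 0, [kapK] leaves the
    eigenvalue -1 or s. *)
Lemma seminormal_quadratic i T : (i < n)%N ->
  h i (h i (e T)) = (s - 1) *: h i (e T) + s *: e T.
Proof.
move=> hi; rewrite h_e // hD sg_swap_e // hZ h_e //.
set E := _ *: e (sg i T); have hA := diag_coefC (cont_neq1 T hi).
have hA' : A (pos T i.+1) (pos T i) = s - 1 - A (pos T i) (pos T i.+1).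
  by rewrite -hA; ring.
rewrite hA'; move: (A (pos T i) (pos T i.+1)) => a.
by lmod_coefs F [:: e T; E]; ring.
Qed.

Let far_e i j T : (i < n)%N -> (j < n)%N -> (i.+1 < j)%N || (j.+1 < i)%N ->
  h j (kap (pos T i) (pos T i.+1) *: e (sg i T))
  = A (pos T j) (pos T j.+1) *: (kap (pos T i) (pos T i.+1) *: e (sg i T))
    + (kap (pos T i) (pos T i.+1) * kap (pos T j) (pos T j.+1)) *: e (sg j (sg i T)).
Proof.
move=> hi hj hij; have [->|hk] := eqVneq (kap (pos T i) (pos T i.+1)) 0.
  by rewrite mul0r !scale0r linear0 scaler0 addr0.
rewrite hZ h_e // !pos_sg //; last exact: ltnW.
have -> : sw i j = j by rewrite /sw; do !case: eqP => //; lia.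
have -> : sw i j.+1 = j.+1 by rewrite /sw; do !case: eqP => //; lia.
by rewrite scalerDr !scalerA mulrC.
Qed.

Lemma seminormal_comm i j T : (i.+1 < j)%N -> (j < n)%N ->
  h i (h j (e T)) = h j (h i (e T)).
Proof.
move=> hij hj; have hi : (i < n)%N by lia.
rewrite (h_e T hj) (h_e T hi) !hD.
rewrite !(far_e, hij, orbT) // ![h _ (A _ _ *: _)]hZ (h_e T hj) (h_e T hi).
have -> : (kap (pos T j) (pos T j.+1) * kap (pos T i) (pos T i.+1)) *: e (sg i (sg j T))
        = (kap (pos T i) (pos T i.+1) * kap (pos T j) (pos T j.+1)) *: e (sg j (sg i T)).
  rewrite mulrC; set ki := kap _ _; set kj := kap _ _.
  have [->|hki] := eqVneq ki 0; first by rewrite mul0r !scale0r.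
  have [->|hkj] := eqVneq kj 0; first by rewrite mulr0 !scale0r.
  congr (_ *: e _); apply: pos_inj => a ha.
  have Ei : pos (sg i T) j = pos T j /\ pos (sg i T) j.+1 = pos T j.+1.
    by rewrite !pos_sg // ?(ltnW hj) //; split; congr pos; rewrite /sw; do !case: eqP => //; lia.
  have Ej : pos (sg j T) i = pos T i /\ pos (sg j T) i.+1 = pos T i.+1.
    by rewrite !pos_sg // ?(ltnW hi) //; split; congr pos; rewrite /sw; do !case: eqP => //; lia.
  rewrite [LHS]pos_sg ?Ej.1 ?Ej.2 // [LHS]pos_sg ?sw_ltn //.
  rewrite [RHS]pos_sg ?Ei.1 ?Ei.2 // [RHS]pos_sg ?sw_ltn //.
  by congr pos; rewrite /sw; do !case: eqP => //; lia.
set E := _ *: e (sg j (sg i T)); set Ei := _ *: e (sg i T); set Ej := _ *: e (sg j T).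
by lmod_coefs F [:: e T; Ei; Ej; E]; ring.
Qed.

(** A swap can bring the cells of [i] and [i.+2] to consecutive entries, so their content difference
    becomes a denominator as well; [cont_neq2] controls it. Once the six vectors are named, the
    relation is a coefficientwise identity in three contents. *)
Lemma seminormal_braid i T : (i.+1 < n)%N ->
  h i (h i.+1 (h i (e T))) = h i.+1 (h i (h i.+1 (e T))).
Proof.
move=> hi1; have hi := ltnW hi1; have hi0 := ltnW hi.
have Ea : sw i i = i.+1 by rewrite /sw eqxx.
have Eb : sw i i.+1 = i by rewrite /sw eqxx; case: eqP => //; lia.
have Ec : sw i i.+2 = i.+2 by rewrite /sw; do !case: eqP => //; lia.
have Ed : sw i.+1 i = i by rewrite /sw; do !case: eqP => //; lia.
have Ee : sw i.+1 i.+1 = i.+2 by rewrite /sw eqxx.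
have Ef : sw i.+1 i.+2 = i.+1 by rewrite /sw eqxx; case: eqP => //; lia.
set p1 := pos T i; set p2 := pos T i.+1; set p3 := pos T i.+2.
set k12 := kap p1 p2; set k13 := kap p1 p3; set k23 := kap p2 p3.
have P1 : k12 != 0 ->
    [/\ pos (sg i T) i = p2, pos (sg i T) i.+1 = p1 & pos (sg i T) i.+2 = p3].
  by move=> hk; rewrite !(pos_sg hi hk) ?Ea ?Eb ?Ec.
have P2 : k23 != 0 ->
    [/\ pos (sg i.+1 T) i = p1, pos (sg i.+1 T) i.+1 = p3 & pos (sg i.+1 T) i.+2 = p2].
  by move=> hk; rewrite !(pos_sg hi1 hk) ?Ed ?Ee ?Ef.
(* Absorbing the coefficients into the vectors avoids a case analysis on which swaps
   are legal: an illegal one carries a zero coefficient. *)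
set E1 := k12 *: e (sg i T); set E2 := k23 *: e (sg i.+1 T).
set E21 := (k12 * k13) *: e (sg i.+1 (sg i T)).
set E12 := (k23 * k13) *: e (sg i (sg i.+1 T)).
set E121 := (k12 * k13 * k23) *: e (sg i (sg i.+1 (sg i T))).
have h1e : h i (e T) = A p1 p2 *: e T + E1 by rewrite h_e.
have h2e : h i.+1 (e T) = A p2 p3 *: e T + E2 by rewrite h_e.
have h1E1 : h i E1 = A p2 p1 *: E1 + ((1 + A p1 p2) * (s - A p1 p2)) *: e T.
  exact: sg_swap_e.
have h2E2 : h i.+1 E2 = A p3 p2 *: E2 + ((1 + A p2 p3) * (s - A p2 p3)) *: e T.
  exact: sg_swap_e.
have h2E1 : h i.+1 E1 = A p1 p3 *: E1 + E21.
  rewrite /E1 /E21; have [->|hk] := eqVneq k12 0.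
    by rewrite mul0r !scale0r linear0 scaler0 addr0.
  have [_ Q2 Q3] := P1 hk; rewrite hZ h_e // Q2 Q3 -/k13 scalerDr !scalerA.
  by rewrite [k12 * A _ _]mulrC.
have h1E2 : h i E2 = A p1 p3 *: E2 + E12.
  rewrite /E2 /E12; have [->|hk] := eqVneq k23 0.
    by rewrite mul0r !scale0r linear0 scaler0 addr0.
  have [Q1 Q2 _] := P2 hk; rewrite hZ h_e // Q1 Q2 -/k13 scalerDr !scalerA.
  by rewrite [k23 * A _ _]mulrC.
have P21 : k12 != 0 -> k13 != 0 -> forall a, (a <= n)%N ->
    pos (sg i.+1 (sg i T)) a = pos T (sw i (sw i.+1 a)).
  move=> hk hk' a ha; have [Q1 Q2 Q3] := P1 hk.
  by rewrite pos_sg ?Q2 ?Q3 // pos_sg ?sw_ltn.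
have P12 : k23 != 0 -> k13 != 0 -> forall a, (a <= n)%N ->
    pos (sg i (sg i.+1 T)) a = pos T (sw i.+1 (sw i a)).
  move=> hk hk' a ha; have [Q1 Q2 Q3] := P2 hk.
  by rewrite pos_sg ?Q1 ?Q2 // pos_sg ?sw_ltn.
have h1E21 : h i E21 = A p2 p3 *: E21 + E121.
  rewrite /E21 /E121; have [->|hk] := eqVneq k12 0.
    by rewrite !mul0r !scale0r linear0 scaler0 addr0.
  have [->|hk'] := eqVneq k13 0.
    by rewrite mulr0 mul0r !scale0r linear0 scaler0 addr0.
  rewrite hZ h_e // !(P21 hk hk') // Ed Ee Ea Ec -/p2 -/p3 -/k23 scalerDr !scalerA.
  by rewrite [_ * A _ _]mulrC.
have h2E12 : h i.+1 E12 = A p1 p2 *: E12 + E121.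
  rewrite /E12 /E121; have [->|hk] := eqVneq k23 0.
    by rewrite mulr0 !mul0r !scale0r linear0 scaler0 addr0.
  have [->|hk'] := eqVneq k13 0.
    by rewrite !mulr0 mul0r !scale0r linear0 scaler0 addr0.
  rewrite hZ h_e // !(P12 hk hk') // Eb Ec Ed Ef -/p1 -/p2 -/k12 scalerDr !scalerA.
  rewrite [_ * A _ _]mulrC; congr (_ + _).
  have [->|hk''] := eqVneq k12 0; first by rewrite mulr0 !mul0r !scale0r.
  have -> : k23 * k13 * k12 = k12 * k13 * k23 by ring.
  (* The two reduced words of the longest permutation of three entries reach the same tableau,
     recognised by its cells. *)
  congr (_ *: e _); apply: pos_inj => a ha.
  rewrite pos_sg //; last by rewrite !(P12 hk hk') // Eb Ec Ed Ef.
  rewrite [RHS]pos_sg //; last by rewrite !(P21 hk'' hk') // Ed Ee Ea Ec.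
  rewrite P12 ?P21 ?sw_ltn //; congr pos.
  by rewrite /sw; do !case: eqP => //; lia.
rewrite h1e h2e !(hE, h1e, h2e, h1E1, h2E2, h2E1, h1E2, h1E21, h2E12).
have n12 := cont_neq1 T hi; have n23 := cont_neq1 T hi1; have n13 := cont_neq2 T hi1.
rewrite -/p1 -/p2 -/p3 in n12 n23 n13.
have n21 : cont p2 != cont p1 by rewrite eq_sym.
have n32 : cont p3 != cont p2 by rewrite eq_sym.
rewrite !diag_coefE //.
have d12 := subq_neq0 n12; have d23 := subq_neq0 n23; have d13 := subq_neq0 n13.
have d21 := subq_neq0 n21; have d32 := subq_neq0 n32.
lmod_coefs F [:: e T; E1; E2; E21; E12; E121]; field; rewrite ?d12 ?d23 ?d13 ?d21 ?d32 //.
Qed.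

End Seminormal.

(** * The twisted action *)

Section AffineAction.
Variables (k F : fieldType) (c : {rmorphism k -> F}) (n : nat) (q s : k).
Variables (x : nat -> F) (sF : nat -> {rmorphism F -> F}) (wF wFi : {rmorphism F -> F}).
Hypothesis n_gt0 : (0 < n)%N.
Hypothesis q_neq0 : q != 0.
Hypothesis q_inj : forall a b : int, q ^ a = q ^ b -> a = b.
Hypothesis s_neq0 : s != 0.
Hypothesis sF_c : forall i a, sF i (c a) = c a.
Hypothesis wF_c : forall a, wF (c a) = c a.
Hypothesis sF_x : forall i j, (i < n)%N -> (j <= n)%N -> sF i (x j) = x (sw i j).
Hypothesis wF_x0 : wF (x 0) = c q * x n.
Hypothesis wF_xS : forall i, (i < n)%N -> wF (x i.+1) = x i.
Hypotheses (wFK : cancel wF wFi) (wFiK : cancel wFi wF).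
Hypothesis rmorph_eqP : forall g g' : {rmorphism F -> F},
  (forall a, g (c a) = g' (c a)) ->
  (forall j, (j <= n)%N -> g (x j) = g' (x j)) -> g =1 g'.
Hypothesis cx_inj : forall a b i j, (i <= n)%N -> (j <= n)%N -> a != 0 -> b != 0 ->
  c a * x i = c b * x j -> a = b /\ i = j.

Let sF_invol i f : (i < n)%N -> sF i (sF i f) = f.
Proof.
move=> hi; apply: (rmorph_eqP (g := sF i \o sF i) (g' := idfun)) => [a|j hj] /=.
  by rewrite !sF_c.
by rewrite !sF_x ?sw_ltn // swK.
Qed.

Let sF_braid i f : (i.+1 < n)%N -> sF i (sF i.+1 (sF i f)) = sF i.+1 (sF i (sF i.+1 f)).
Proof.
move=> hi1; have hi0 := ltnW hi1.
apply: (rmorph_eqP (g := sF i \o (sF i.+1 \o sF i))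
  (g' := sF i.+1 \o (sF i \o sF i.+1))) => [a|j hj] /=; first by rewrite !sF_c.
rewrite !sF_x ?sw_ltn //; congr x.
by rewrite /sw; do !case: eqP => //; lia.
Qed.

Let sF_comm i j f : (i.+1 < j)%N -> (j < n)%N -> sF i (sF j f) = sF j (sF i f).
Proof.
move=> hij hj; have hi0 : (i < n)%N by lia.
apply: (rmorph_eqP (g := sF i \o sF j) (g' := sF j \o sF i)) => [a|l hl] /=.
  by rewrite !sF_c.
rewrite !sF_x ?sw_ltn //; congr x.
by rewrite /sw; do !case: eqP => //; lia.
Qed.

Let wF_s i f : (i.+1 < n)%N -> wF (sF i.+1 f) = sF i (wF f).
Proof.
move=> hi1; have hi0 := ltnW hi1.
apply: (rmorph_eqP (g := wF \o sF i.+1) (g' := sF i \o wF)) => [a|j hj] /=.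
  by rewrite sF_c !wF_c sF_c.
rewrite sF_x //; case: j hj => [|j] hj.
  have -> : sw i.+1 0 = 0%N by rewrite /sw; do !case: eqP => //; lia.
  rewrite wF_x0 rmorphM /= sF_c sF_x //; congr (_ * x _).
  by rewrite /sw; do !case: eqP => //; lia.
have -> : sw i.+1 j.+1 = (sw i j).+1 by rewrite /sw; do !case: eqP => //; lia.
rewrite (wF_xS hj) sF_x ?(ltnW hj) // wF_xS //.
by move: hj; rewrite /sw; do !case: eqP; lia.
Qed.

Let wF2_s f : wF (wF (sF 0 f)) = sF n.-1 (wF (wF f)).
Proof.
apply: (rmorph_eqP (g := wF \o (wF \o sF 0)) (g' := sF n.-1 \o (wF \o wF))) => [a|j hj] /=.
  by rewrite sF_c !wF_c sF_c.
have w_n : wF (x n) = x n.-1 by rewrite -{1}(prednK n_gt0) wF_xS // prednK.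
have hn : (n.-1 < n)%N by rewrite prednK.
have s1 : sw n.-1 n.-1 = n by rewrite /sw eqxx prednK.
have s2 : sw n.-1 n = n.-1 by rewrite -[RHS](swK n.-1) s1.
rewrite sF_x //; case: j hj => [|[|j]] hj.
- by rewrite /sw /= wF_xS // !wF_x0 rmorphM /= wF_c w_n rmorphM /= sF_c sF_x ?s1 ?leq_pred.
- by rewrite /sw /= wF_xS // !wF_x0 rmorphM /= wF_c w_n rmorphM /= sF_c sF_x ?s2.
- have -> : sw 0 j.+2 = j.+2 by [].
  rewrite !wF_xS ?(ltnW hj) // sF_x ?(ltnW (ltnW hj)) //; congr x.
  by rewrite /sw; do !case: eqP => //; lia.
Qed.

Variable I : finType.
Variables (P : Type) (pos : I -> nat -> P) (cont : P -> k) (kap : P -> P -> k).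
Variables (sg : nat -> I -> I) (hb : nat -> I -> I -> k).
Local Notation A p p' := (diag_coef s cont p p').
Hypothesis cont_neq0 : forall p, cont p != 0.
Hypothesis pos_sg : forall i T, (i < n)%N -> kap (pos T i) (pos T i.+1) != 0 ->
  forall a, (a <= n)%N -> pos (sg i T) a = pos T (sw i a).
Hypothesis pos_inj : forall T T', (forall a, (a <= n)%N -> pos T a = pos T' a) -> T = T'.
Hypothesis kapK : forall i T, (i < n)%N ->
  kap (pos T i) (pos T i.+1) * kap (pos T i.+1) (pos T i)
  = (1 + A (pos T i) (pos T i.+1)) * (s - A (pos T i) (pos T i.+1)).
Hypothesis cont_neq1 : forall i T, (i < n)%N -> cont (pos T i) != cont (pos T i.+1).
Hypothesis cont_neq2 : forall i T, (i.+1 < n)%N -> cont (pos T i) != cont (pos T i.+2).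
Hypothesis hbE : forall i T T', (i < n)%N -> hb i T T'
  = A (pos T i) (pos T i.+1) * (T == T')%:R
    + kap (pos T i) (pos T i.+1) * (sg i T == T')%:R.

Definition FV := {ffun I -> F^o}.

Definition hecke (i : nat) (u : FV) : FV := [ffun T' => \sum_T u T * c (hb i T T')].

Lemma hecke_is_linear i : linear (hecke i).
Proof.
move=> a u v; apply/ffunP => T'; rewrite !ffunE /= scaler_sumr -big_split /=.
by apply: eq_bigr => T _; rewrite !ffunE mulrDl -mulrA.
Qed.
HB.instance Definition _ i := GRing.isLinear.Build F FV FV _ (hecke i) (hecke_is_linear i).

Definition fbasis (T : I) : FV := [ffun T' => (T == T')%:R].

Lemma fbasisE (u : FV) : u = \sum_T u T *: fbasis T.
Proof.
apply/ffunP => T'; rewrite sum_ffunE (bigD1 T') //= !ffunE eqxx [_ *: _]mulr1.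
by rewrite big1 ?addr0 // => T /negPf hT; rewrite !ffunE hT [_ *: _]mulr0.
Qed.

Lemma linear_basis_eq (f g : {linear FV -> FV}) :
  (forall T, f (fbasis T) = g (fbasis T)) -> f =1 g.
Proof.
move=> h u; rewrite (fbasisE u) !linear_sum; apply: eq_bigr => T _.
by rewrite !linearZ h.
Qed.

Lemma hecke_basis i T : (i < n)%N ->
  hecke i (fbasis T) = diag_coef (c s) (c \o cont) (pos T i) (pos T i.+1) *: fbasis T
    + c (kap (pos T i) (pos T i.+1)) *: fbasis (sg i T).
Proof.
move=> hi; apply/ffunP => T'; rewrite !ffunE (bigD1 T) //= !ffunE eqxx mul1r.
rewrite big1 ?addr0 => [|T0 /negPf hT0]; last first.
  by rewrite !ffunE eq_sym hT0 mul0r.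
rewrite hbE // rmorphD !rmorphM /= !rmorph_nat; congr (_ * _ + _).
by rewrite /diag_coef /= !(rmorphM, fmorphV, rmorphB, rmorph1).
Qed.

Let cont_neq0' p : (c \o cont) p != 0. Proof. by rewrite /= fmorph_eq0. Qed.
Let pos_sg' i T : (i < n)%N -> c (kap (pos T i) (pos T i.+1)) != 0 ->
  forall a, (a <= n)%N -> pos (sg i T) a = pos T (sw i a).
Proof. by move=> hi; rewrite fmorph_eq0; exact: pos_sg. Qed.
Let diagc p p' : diag_coef (c s) (c \o cont) p p' = c (A p p').
Proof. by rewrite /diag_coef /= !(rmorphM, fmorphV, rmorphB, rmorph1). Qed.
Let kapK' i T : (i < n)%N ->
  c (kap (pos T i) (pos T i.+1)) * c (kap (pos T i.+1) (pos T i))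
  = (1 + diag_coef (c s) (c \o cont) (pos T i) (pos T i.+1))
    * (c s - diag_coef (c s) (c \o cont) (pos T i) (pos T i.+1)).
Proof.
by move=> hi; rewrite !diagc -rmorphM kapK // rmorphM rmorphD rmorphB rmorph1.
Qed.
Let cont_neq1' i T : (i < n)%N -> (c \o cont) (pos T i) != (c \o cont) (pos T i.+1).
Proof. by move=> hi; rewrite /= (inj_eq (fmorph_inj c)) cont_neq1. Qed.
Let cont_neq2' i T : (i.+1 < n)%N -> (c \o cont) (pos T i) != (c \o cont) (pos T i.+2).
Proof. by move=> hi; rewrite /= (inj_eq (fmorph_inj c)) cont_neq2. Qed.

Let hl i : {linear FV -> FV} := hecke i.

Let hecke_quad i u : (i < n)%N -> hecke i (hecke i u) = (c s - 1) *: hecke i u + c s *: u.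
Proof.
move=> hi.
pose f : {linear FV -> FV} := hecke i \o hecke i.
pose g : {linear FV -> FV} := ((c s - 1) \*: hecke i) \+ (c s \*: idfun).
apply: (@linear_basis_eq f g) => T.
exact: (@seminormal_quadratic _ _ n _ _ _ pos _ (fun p p' => c (kap p p')) sg fbasis hl
  cont_neq0' pos_sg' pos_inj kapK' cont_neq1' hecke_basis).
Qed.

Let hecke_braid i u : (i.+1 < n)%N ->
  hecke i (hecke i.+1 (hecke i u)) = hecke i.+1 (hecke i (hecke i.+1 u)).
Proof.
move=> hi.
pose f : {linear FV -> FV} := hecke i \o (hecke i.+1 \o hecke i).
pose g : {linear FV -> FV} := hecke i.+1 \o (hecke i \o hecke i.+1).
apply: (@linear_basis_eq f g) => T.
exact: (@seminormal_braid _ _ n _ _ _ pos _ (fun p p' => c (kap p p')) sg fbasis hl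
  cont_neq0' pos_sg' pos_inj kapK' cont_neq1' cont_neq2' hecke_basis).
Qed.

Let hecke_comm i j u : (i.+1 < j)%N -> (j < n)%N ->
  hecke i (hecke j u) = hecke j (hecke i u).
Proof.
move=> hij hj.
pose f : {linear FV -> FV} := hecke i \o hecke j.
pose g : {linear FV -> FV} := hecke j \o hecke i.
apply: (@linear_basis_eq f g) => T.
exact: (@seminormal_comm _ _ n _ _ _ pos _ (fun p p' => c (kap p p')) sg fbasis hl
   pos_sg' pos_inj hecke_basis).
Qed.

Definition lift (g : F -> F) (u : FV) : FV := [ffun T => g (u T)].

Let liftD (g : {rmorphism F -> F}) u v : lift g (u + v) = lift g u + lift g v.
Proof. by apply/ffunP => T; rewrite !ffunE rmorphD. Qed.

Let liftZ (g : {rmorphism F -> F}) a u : lift g (a *: u) = g a *: lift g u.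
Proof. by apply/ffunP => T; rewrite !ffunE rmorphM. Qed.

Lemma hecke_lift (g : {rmorphism F -> F}) i u :
  (forall a, g (c a) = c a) -> hecke i (lift g u) = lift g (hecke i u).
Proof.
move=> gc; apply/ffunP => T; rewrite !ffunE rmorph_sum; apply: eq_bigr => T' _.
by rewrite ffunE rmorphM gc.
Qed.

Definition sV (i : nat) : FV -> FV := intertwiner (c s) x (fun i => lift (sF i)) hl i.
Definition rotV : FV -> FV := wtwist n (lift wF) hl.
Definition unrotV : FV -> FV := wtwisti n (c s) (lift wFi) hl.

Let cs0 : c s != 0. Proof. by rewrite fmorph_eq0. Qed.
Let cq0 : c q != 0. Proof. by rewrite fmorph_eq0. Qed.
Let x_neq i j : (i <= n)%N -> (j <= n)%N -> i != j -> x i != x j.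
Proof.
move=> hi hj; apply: contraNneq => e.
have := @cx_inj 1 1 i j hi hj (oner_neq0 _) (oner_neq0 _).
by rewrite rmorph1 !mul1r => /(_ e)[_ ->].
Qed.
Let sx_neq i j : (i <= n)%N -> (j <= n)%N -> i != j -> c s * x i != x j.
Proof.
move=> hi hj; apply: contraNneq => e.
have := @cx_inj s 1 i j hi hj s_neq0 (oner_neq0 _).
by rewrite rmorph1 mul1r => /(_ e)[_ ->].
Qed.
Let sF_s i : (i < n)%N -> sF i (c s) = c s. Proof. by []. Qed.
Let sUD i u v : lift (sF i) (u + v) = lift (sF i) u + lift (sF i) v.
Proof. exact: liftD. Qed.
Let sUZ i a u : (i < n)%N -> lift (sF i) (a *: u) = sF i a *: lift (sF i) u.
Proof. by move=> _; exact: liftZ. Qed.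
Let sU_invol i u : (i < n)%N -> lift (sF i) (lift (sF i) u) = u.
Proof. by move=> hi; apply/ffunP => T; rewrite !ffunE sF_invol. Qed.
Let sU_braid i u : (i.+1 < n)%N -> lift (sF i) (lift (sF i.+1) (lift (sF i) u))
  = lift (sF i.+1) (lift (sF i) (lift (sF i.+1) u)).
Proof. by move=> hi; apply/ffunP => T; rewrite !ffunE sF_braid. Qed.
Let sU_comm i j u : (i.+1 < j)%N -> (j < n)%N ->
  lift (sF i) (lift (sF j) u) = lift (sF j) (lift (sF i) u).
Proof. by move=> hij hj; apply/ffunP => T; rewrite !ffunE sF_comm. Qed.
Let wUK : cancel (lift wF) (lift wFi).
Proof. by move=> u; apply/ffunP => T; rewrite !ffunE wFK. Qed.
Let wUiK : cancel (lift wFi) (lift wF).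
Proof. by move=> u; apply/ffunP => T; rewrite !ffunE wFiK. Qed.
Let wU_s i u : (i.+1 < n)%N -> lift wF (lift (sF i.+1) u) = lift (sF i) (lift wF u).
Proof. by move=> hi; apply/ffunP => T; rewrite !ffunE wF_s. Qed.
Let wU2_s u : lift wF (lift wF (lift (sF 0) u)) = lift (sF n.-1) (lift wF (lift wF u)).
Proof. by apply/ffunP => T; rewrite !ffunE wF2_s. Qed.
Let h_sU i j u : hl i (lift (sF j) u) = lift (sF j) (hl i u).
Proof. exact: hecke_lift. Qed.
Let h_wU i u : hl i (lift wF u) = lift wF (hl i u).
Proof. exact: hecke_lift. Qed.

Let sV_invol i u : (i < n)%N -> sV i (sV i u) = u.
Proof.
exact: (intertwiner_invol n_gt0 cs0 cq0 x_neq sx_neq sF_s sF_x sUD sUZ sU_invol h_sU hecke_quad).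
Qed.

Let sV_braid i u : (i.+1 < n)%N -> sV i (sV i.+1 (sV i u)) = sV i.+1 (sV i (sV i.+1 u)).
Proof.
exact: (intertwiner_braid n_gt0 cs0 cq0 x_neq sF_s sF_x sUD sUZ sU_braid h_sU
  hecke_quad hecke_braid).
Qed.

Let sV_comm i j u : (i.+1 < j)%N -> (j < n)%N -> sV i (sV j u) = sV j (sV i u).
Proof.
exact: (intertwiner_comm n_gt0 cs0 cq0 sF_s sF_x sUD sUZ sU_comm h_sU hecke_comm).
Qed.

Lemma rotVK : cancel rotV unrotV.
Proof. exact: (wtwistK n_gt0 cs0 cq0 wUK hecke_quad). Qed.

Lemma unrotVK : cancel unrotV rotV.
Proof. exact: (wtwistiK n_gt0 cs0 cq0 wUiK hecke_quad). Qed.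

Let rotV_s i u : (i.+1 < n)%N -> rotV (sV i.+1 u) = sV i (rotV u).
Proof.
exact: (wtwist_intertwiner (wF_c s) wF_xS (liftD wF) (liftZ wF) wU_s h_sU h_wU
  hecke_braid hecke_comm).
Qed.

Let rotV2_s u : rotV (rotV (sV 0 u)) = sV n.-1 (rotV (rotV u)).
Proof.
exact: (wtwist2_intertwiner n_gt0 cs0 cq0 x_neq (wF_c s) wF_x0 wF_xS (wF_c q)
  (liftD wF) (liftZ wF) wU2_s h_sU h_wU hecke_braid hecke_comm).
Qed.

Lemma sVZ i a u : (i < n)%N -> sV i (a *: u) = sF i a *: sV i u.
Proof. exact: (intertwinerZ _ _ _ sUZ). Qed.
Lemma sVD i u v : sV i (u + v) = sV i u + sV i v.
Proof. exact: (intertwinerD _ _ _ sUD). Qed.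
Lemma rotVZ a u : rotV (a *: u) = wF a *: rotV u.
Proof. exact: (wtwistZ _ _ (liftZ wF)). Qed.
Lemma rotVD u v : rotV (u + v) = rotV u + rotV v.
Proof. exact: (wtwistD _ _ (liftD wF)). Qed.
Lemma unrotVZ a u : unrotV (a *: u) = wFi a *: unrotV u.
Proof. by apply: (can_inj rotVK); rewrite unrotVK rotVZ wFiK unrotVK. Qed.
Lemma unrotVD u v : unrotV (u + v) = unrotV u + unrotV v.
Proof. by apply: (can_inj rotVK); rewrite unrotVK rotVD !unrotVK. Qed.

(** One sequence of generators builds the automorphism and the semilinear map at once. No quotient
    by relations is taken: [reach_eq] shows that the first component determines the second. *)
Inductive reach : (F -> F) -> (FV -> FV) -> Prop :=
| reach_id : reach id id
| reach_s i g B : (i < n)%N -> reach g B -> reach (fun f => sF i (g f)) (fun u => sV i (B u))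
| reach_w g B : reach g B -> reach (fun f => wF (g f)) (fun u => rotV (B u))
| reach_wi g B : reach g B -> reach (fun f => wFi (g f)) (fun u => unrotV (B u)).

Lemma reach_comp g B g' B' : reach g B -> reach g' B' ->
  reach (fun f => g' (g f)) (fun u => B' (B u)).
Proof.
move=> h; elim=> // *; [exact: reach_s | exact: reach_w | exact: reach_wi].
Qed.

Lemma reach_morph g B : reach g B ->
  [/\ forall f f', g (f + f') = g f + g f', forall f f', g (f * f') = g f * g f', g 1 = 1
    & (forall u v, B (u + v) = B u + B v) /\ (forall a u, B (a *: u) = g a *: B u)].
Proof.
elim=> [|i {}g {}B hi _ [gD gM g1 [BD BZ]]|{}g {}B _ [gD gM g1 [BD BZ]]
  |{}g {}B _ [gD gM g1 [BD BZ]]]; split=> //; try (split=> //).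
all: move=> *; rewrite ?gD ?gM ?g1 ?BD ?BZ ?rmorphD ?rmorphM ?rmorph1 //.
all: by rewrite ?sVD ?rotVD ?unrotVD ?sVZ ?rotVZ ?unrotVZ.
Qed.

Let X : Type := (F * FV)%type.
Let sX i (p : X) : X := (sF i p.1, sV i p.2).
Let wX (p : X) : X := (wF p.1, rotV p.2).
Let wXi (p : X) : X := (wFi p.1, unrotV p.2).
Let pX (g : F -> F) (B : FV -> FV) (p : X) : X := (g p.1, B p.2).

Let reach_affine g B : reach g B -> affine_reach n sX wX wXi (pX g B).
Proof.
elim=> [|i {}g {}B hi _ IH|{}g {}B _ IH|{}g {}B _ IH].
- have -> : pX id id = id; last exact: affine_reach_id.
  by apply: functional_extensionality => -[].
- exact: (affine_reach_s hi IH).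
- exact: (affine_reach_w IH).
- exact: (affine_reach_wi IH).
Qed.

Let sX_invol i p : (i < n)%N -> sX i (sX i p) = p.
Proof. by case: p => f u hi; rewrite /sX /= sF_invol ?sV_invol. Qed.
Let wXK : cancel wX wXi. Proof. by case=> f u; rewrite /wX /wXi /= wFK rotVK. Qed.
Let wXiK : cancel wXi wX. Proof. by case=> f u; rewrite /wX /wXi /= wFiK unrotVK. Qed.

(** The points q^a x_i, placed in the scalar factor. Indices above [n] get 0 because [s_e] is
    required for every [i]. *)
Let eX (a : int) (i : nat) : X := (if (i <= n)%N then c (q ^ a) * x i else 0, 0).

Let zero_morph (B : FV -> FV) : (forall u v, B (u + v) = B u + B v) -> B 0 = 0.
Proof. by move=> h; apply: (addrI (B 0)); rewrite -h !addr0. Qed.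

(** Both actions run together on [F * FV]. The criterion of [affine_reach_eq] is checked on scalar
    points only, but its conclusion covers the whole product, hence the vectors: this is the
    well-definedness of the twisted action. *)
Lemma reach_eq g B g' B' : reach g B -> reach g' B' ->
  (forall i, (i <= n)%N -> g (x i) = g' (x i)) -> g =1 g' /\ B =1 B'.
Proof.
move=> hg hg' h.
have E : forall p, pX g B p = pX g' B' p.
  apply: (@affine_reach_eq X n sX wX wXi n_gt0 sX_invol _ _ wXK wXiK _ _ eX).
  - by move=> i [f u] hi; exact: (congr2 pair (sF_braid _ hi) (sV_braid _ hi)).
  - by move=> i j [f u] hij hj; exact: (congr2 pair (sF_comm _ hij hj) (sV_comm _ hij hj)).
  - by move=> i [f u] hi; exact: (congr2 pair (wF_s _ hi) (rotV_s _ hi)).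
  - by move=> [f u]; exact: (congr2 pair (wF2_s f) (rotV2_s u)).
  - move=> j a i hj; rewrite /sX /eX /= sw_ltn //.
    apply: (congr2 pair); last by apply: zero_morph; exact: sVD.
    by case: ifP => hi; rewrite ?rmorph0 // rmorphM sF_c sF_x.
  - move=> a; rewrite /wX /eX /= leqnn.
    apply: (congr2 pair); last by apply: zero_morph; exact: rotVD.
    by rewrite rmorphM wF_c wF_x0 expfzDr // expr1z rmorphM mulrA.
  - move=> a i hi; rewrite /wX /eX /= hi (ltnW hi).
    apply: (congr2 pair); last by apply: zero_morph; exact: rotVD.
    by rewrite rmorphM wF_c wF_xS.
  - move=> a b i j hi hj; rewrite /eX hi hj => -[h1].
    by have [] := cx_inj hi hj (expfz_neq0 a q_neq0) (expfz_neq0 b q_neq0) h1;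
       move=> /q_inj.
  - exact: reach_affine.
  - exact: reach_affine.
  - move=> i hi; rewrite /pX /eX /= hi expr0z rmorph1 mul1r h //.
    have [_ _ _ [/zero_morph B0 _]] := reach_morph hg.
    have [_ _ _ [/zero_morph B0' _]] := reach_morph hg'.
    by apply: (congr2 pair); rewrite ?B0 ?B0'.
split=> [f|u]; first by have [] := E (f, 0).
by have [] := E (0, u).
Qed.

Lemma reach_inj g B : reach g B -> injective B.
Proof.
elim=> [|i {}g {}B hi _ IH|{}g {}B _ IH|{}g {}B _ IH] u v //.
- by move=> /(congr1 (sV i)); rewrite !sV_invol // => /IH.
- by move=> /(can_inj rotVK)/IH.
- by move=> /(can_inj unrotVK)/IH.
Qed.

Definition term := {t : (F -> F) * (FV -> FV) | reach t.1 t.2}.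
Definition fact (t : term) : F^o -> F^o := (sval t).1.
Definition vact (t : term) : FV -> FV := (sval t).2.

Definition formal (A : F -> F) (B : FV -> FV) : Prop := exists l : seq (F * term),
  (forall f, A f = formal_eval fact l f) /\ (forall u, B u = formal_eval vact l u).

Lemma formal_ext A A' B B' : A =1 A' -> B =1 B' -> formal A B -> formal A' B'.
Proof. by move=> hA hB [l [h1 h2]]; exists l; split=> *; rewrite -?hA -?hB. Qed.

Lemma formal_reach g B : reach g B -> formal g B.
Proof.
move=> h; exists [:: (1, exist _ (g, B) h)].
by split=> *; rewrite /formal_eval big_seq1 scale1r.
Qed.

Lemma formal_add A A' B B' : formal A B -> formal A' B' ->
  formal (fun f => A f + A' f) (fun u => B u + B' u).
Proof.
move=> [l [h1 h2]] [l' [h1' h2']]; exists (l ++ l').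
by split=> *; rewrite formal_eval_cat ?h1 ?h2 ?h1' ?h2'.
Qed.

Lemma formal_scale a A B : formal A B -> formal (fun f => a * A f) (fun u => a *: B u).
Proof.
move=> [l [h1 h2]]; exists [seq (a * p.1, p.2) | p <- l].
split=> v; rewrite ?h1 ?h2 /formal_eval big_map.
  by rewrite mulr_sumr; apply: eq_bigr => p _; exact: mulrA.
by rewrite scaler_sumr; apply: eq_bigr => p _; exact: scalerA.
Qed.

(** The product of a twisted group ring: a' g' after a g is a' g'(a) times the composite of g' and
    g. Semilinearity over the same automorphism gives the same coefficient on both sides. *)
Lemma formal_comp A A' B B' : formal A B -> formal A' B' ->
  formal (fun f => A' (A f)) (fun u => B' (B u)).
Proof.
move=> [l [h1 h2]] [l' [h1' h2']].
pose tcomp (t t' : term) : term := exist _ (_, _) (reach_comp (svalP t) (svalP t')).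
exists [seq (p'.1 * fact p'.2 p.1, tcomp p.2 p'.2) | p' <- l', p <- l].
split=> v; rewrite ?h1' ?h1 ?h2' ?h2 /formal_eval big_allpairs_dep /=; apply: eq_bigr => p' _;
  have [gD gM g1 [BD BZ]] := reach_morph (svalP p'.2).
- rewrite /fact (big_morph _ gD (_ : _ 0 = 0)); last first.
    by apply: (addrI ((sval p'.2).1 0)); rewrite -gD !addr0.
  rewrite scaler_sumr; apply: eq_bigr => p _ /=.
  by rewrite -scalerA; exact: (congr1 (fun z => p'.1 * z) (gM _ _)).
- rewrite /vact (big_morph _ BD (zero_morph BD)) scaler_sumr; apply: eq_bigr => p _ /=.
  by rewrite BZ scalerA.
Qed.

Definition tkey (t : term) : {ffun 'I_n.+1 -> F} := [ffun i : 'I_n.+1 => fact t (x i)].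

Let tkey_eq t t' : tkey t = tkey t' -> fact t =1 fact t' /\ vact t =1 vact t'.
Proof.
move=> e; apply: (reach_eq (svalP t) (svalP t')) => i hi.
by have /ffunP/(_ (Ordinal (hi : (i < n.+1)%N))) := e; rewrite !ffunE.
Qed.

Lemma formal_transfer_vector (L : F -> Prop) A B : L 1 ->
  (forall i f, (i <= n)%N -> L f -> L (x i * f)) ->
  formal A B -> (forall f, L f -> A f = 0) -> forall u, B u = 0.
Proof.
move=> L1 Lx [l [h1 h2]] h0 u; rewrite h2.
apply: (@formal_eval_transfer F n.+1 term tkey (fun i => x i) F^o F^o FV FV
  fact vact L l).
- by move=> i f; apply: Lx; rewrite -ltnS.
- by move=> t i f; rewrite ffunE; have [_ gM _ _] := reach_morph (svalP t); exact: gM.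
- move=> t; exists 1 => //; have [_ _ g1 _] := reach_morph (svalP t).
  by rewrite /fact g1 oner_neq0.
- by move=> t t' /tkey_eq[].
- by move=> t t' /tkey_eq[].
- by move=> f Lf; rewrite -h1 h0.
Qed.

(** Dedekind's argument needs a test vector that no group element kills; group elements act
    injectively, so any [fbasis T0] will do. Here the existence of a tableau enters. *)
Lemma formal_transfer_scalar (L : FV -> Prop) A B (T0 : I) : L (fbasis T0) ->
  (forall i u, (i <= n)%N -> L u -> L (x i *: u)) ->
  formal A B -> (forall u, L u -> B u = 0) -> forall f, A f = 0.
Proof.
move=> LT Lx [l [h1 h2]] h0 f; rewrite h1.
apply: (@formal_eval_transfer F n.+1 term tkey (fun i => x i) FV FV F^o F^o
  vact fact L l).
- by move=> i u; apply: Lx; rewrite -ltnS.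
- by move=> t i u; rewrite ffunE; have [_ _ _ [_ BZ]] := reach_morph (svalP t); exact: BZ.
- move=> t; exists (fbasis T0) => //; have [_ _ _ [BD _]] := reach_morph (svalP t).
  apply/eqP; rewrite /vact -(zero_morph BD) => /(reach_inj (svalP t)) /ffunP/(_ T0).
  by rewrite !ffunE eqxx => /eqP; rewrite oner_eq0.
- by move=> t t' /tkey_eq[].
- by move=> t t' /tkey_eq[].
- by move=> u Lu; rewrite -h2 h0.
Qed.

Lemma formal_demazure_lusztig i : (i < n)%N ->
  formal (fun f => demazure (c s) x i i.+1 * (f - sF i f) + c s * sF i f)
         (fun u => demazure (c s) x i i.+1 *: (u - lift (sF i) u) + hecke i (lift (sF i) u)).
Proof.
move=> hi; set b := demazure _ _ _ _.
have hb0 : c s - b != 0.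
  by apply: (sub_demazure_neq0 x_neq sx_neq) => //; lia.
apply: formal_ext (formal_add (formal_scale b (formal_reach reach_id))
  (formal_scale (c s - b) (formal_reach (reach_s hi reach_id)))) => v /=.
  by ring.
rewrite /sV /intertwiner /spectral -/b scalerA divff // scale1r.
rewrite /hl /=; lmod_coefs F [:: v; lift (sF i) v; hecke i (lift (sF i) v)]; ring.
Qed.

Lemma hecke_const i (v : I -> k) :
  hecke i [ffun T => c (v T)] = [ffun T' => c (\sum_T v T * hb i T T')].
Proof.
apply/ffunP => T'; rewrite !ffunE rmorph_sum; apply: eq_bigr => T _.
by rewrite ffunE rmorphM.
Qed.

Lemma coxeter_basis u : coxeter n hecke u = \sum_T u T *: coxeter n hecke (fbasis T).
Proof.
have lin l a v w : word_act hecke l (a *: v + w) = a *: word_act hecke l v + word_act hecke l w.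
  by elim: l v w => [|j l IH] v w //; rewrite !word_act_cons linearP IH.
pose g := word_act hecke (iota 0 n).
have g0 : g 0 = 0 by have := lin (iota 0 n) (-1) 0 0; rewrite scaler0 addr0 scaleN1r addNr.
have gD v w : g (v + w) = g v + g w by have := lin (iota 0 n) 1 v w; rewrite !scale1r.
rewrite {1}(fbasisE u) /coxeter -/g (big_morph g gD g0); apply: eq_bigr => T _.
by have := lin (iota 0 n) (u T) (fbasis T) 0; rewrite !addr0 -/g g0 addr0.
Qed.

Section Preservation.
Variable L : F -> Prop.
Hypothesis LD : forall f g, L f -> L g -> L (f + g).
Hypothesis L0 : L 0.
Hypothesis Lc : forall a f, L f -> L (c a * f).

Lemma hecke_preserves i (u : FV) : (forall T, L (u T)) -> forall T, L (hecke i u T).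
Proof.
move=> h T; rewrite ffunE; elim/big_rec: _ => // T' f _ hf.
by apply: LD => //; rewrite mulrC; apply: Lc.
Qed.

(** Unlike the intertwiners, the inverse Hecke generators s^-1 (h + 1 - s) have constant
    coefficients, so inverting the bold rotation creates no new denominators. *)
Lemma unrotV_preserves (u : FV) : (forall f, L f -> L (wFi f)) ->
  (forall T, L (u T)) -> forall T, L (unrotV u T).
Proof.
move=> Lw h T; rewrite /unrotV /wtwisti ffunE; apply: Lw.
elim: (descent 0 n) u h => [|i l IH] u h //; rewrite word_act_cons; apply: IH => T'.
have -> : hinv (c s) hl i u = c s^-1 *: (hecke i u + c (1 - s) *: u).
  by rewrite /hinv -scaleNr opprB rmorphB rmorph1 fmorphV.
rewrite ffunE; apply: (Lc s^-1); rewrite ffunE; apply: LD.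
  exact: (hecke_preserves i h T').
by rewrite ffunE; exact: Lc.
Qed.

(* [Phi A B] says that [A] and [B] are given by the same formal sum of group elements; the
   closure properties are all that the rest of the proof needs. *)
Record operator_calculus (Phi : (F -> F) -> (FV -> FV) -> Prop) : Prop := OperatorCalculus {
  oc_id : Phi id id;
  oc_add : forall A A' B B', Phi A B -> Phi A' B' ->
    Phi (fun f => A f + A' f) (fun u => B u + B' u);
  oc_scale : forall a A B, Phi A B -> Phi (fun f => a * A f) (fun u => a *: B u);
  oc_comp : forall A A' B B', Phi A B -> Phi A' B' ->
    Phi (fun f => A' (A f)) (fun u => B' (B u));
  oc_demazure : forall i, (i < n)%N ->
    Phi (fun f => demazure (c s) x i i.+1 * (f - sF i f) + c s * sF i f)
        (fun u => demazure (c s) x i i.+1 *: (u - lift (sF i) u) + hecke i (lift (sF i) u));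
  oc_rot : Phi wF (fun u => coxeter n hecke (lift wF u));
  oc_unrot : exists2 W, Phi wFi W &
    [/\ cancel (fun u => coxeter n hecke (lift wF u)) W,
        cancel W (fun u => coxeter n hecke (lift wF u)) &
        forall u : FV, (forall T, L (u T)) -> forall T, L (W u T)];
  oc_vector : forall A A' B B', Phi A B -> Phi A' B' ->
    (forall f, L f -> A f = A' f) -> B =1 B';
  oc_scalar : forall A A' B B', Phi A B -> Phi A' B' ->
    (forall u : FV, (forall T, L (u T)) -> B u = B' u) -> A =1 A'
}.

Lemma formal_calculus (T0 : I) : L 1 -> (forall f, L f -> L (wFi f)) ->
  (forall i f, (i <= n)%N -> L f -> L (x i * f)) -> operator_calculus formal.
Proof.
move=> L1 Lw Lx.
have fsub A A' B B' : formal A B -> formal A' B' ->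
    formal (fun f => A f + (-1) * A' f) (fun u => B u + (-1) *: B' u).
  by move=> h h'; apply: formal_add => //; apply: formal_scale.
split.
- exact: formal_reach reach_id.
- exact: formal_add.
- exact: formal_scale.
- exact: formal_comp.
- exact: formal_demazure_lusztig.
- exact: formal_reach (reach_w reach_id).
- exists unrotV; first exact: formal_reach (reach_wi reach_id).
  by split; [exact: rotVK | exact: unrotVK | move=> u; exact: unrotV_preserves].
- move=> A A' B B' h h' e u.
  have := formal_transfer_vector L1 Lx (fsub _ _ _ _ h h').
  move=> /(_ _ u)/eqP; rewrite scaleN1r subr_eq0 => H; apply/eqP/H => f Lf.
  by rewrite e // mulN1r subrr.
- move=> A A' B B' h h' e f.
  have LT : forall T, L (fbasis T0 T) by move=> T; rewrite ffunE; case: eqP.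
  have LxV i (u : FV) : (i <= n)%N -> (forall T, L (u T)) -> forall T, L ((x i *: u) T).
    by move=> hi hu T; rewrite ffunE; exact: (Lx _ _ hi (hu T)).
  have := @formal_transfer_scalar (fun u : FV => forall T, L (u T)) _ _ T0 LT LxV
    (fsub _ _ _ _ h h').
  move=> /(_ _ f)/eqP; rewrite mulN1r subr_eq0 => H; apply/eqP/H => u Lu.
  by rewrite e // scaleN1r subrr.
Qed.
End Preservation.

End AffineAction.

(** * Automorphisms of fraction fields *)

Section Fraction.
Local Open Scope quotient_scope.
Lemma frac_repr (R : idomainType) (f : {fraction R}) :
  f = (\n_(generic_quotient.repr f))%:F / (\d_(generic_quotient.repr f))%:F.
Proof.
set r := generic_quotient.repr f.
have dr0 : (\d_r)%:F != 0 :> {fraction R} by rewrite tofrac_eq0 denom_ratioP.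
apply: (mulIf dr0); rewrite mulfVK //.
rewrite -[f in LHS]generic_quotient.reprK -/r /FracField.tofrac; unlock.
rewrite -[LHS]FracField.pi_mul; apply/generic_quotient.eqmodP => /=.
rewrite /FracField.equivf /FracField.mulf.
by rewrite !numden_Ratio ?oner_neq0 ?mulr1 ?mulf_neq0 ?denom_ratioP // mulrC.
Qed.
End Fraction.

(** The body of [fmap] over an arbitrary domain, so that the two are convertible; by [frac_map_div]
    the chosen representative is immaterial when [sg] is an injective ring morphism. *)
Definition frac_map (R : idomainType) (sg : R -> R) (f : {fraction R}) : {fraction R} :=
  (sg (\n_(generic_quotient.repr f)))%:F / (sg (\d_(generic_quotient.repr f)))%:F.

Section FractionMap.
Variables (R : idomainType) (sg : {rmorphism R -> R}).
Hypothesis sg_inj : injective sg.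

Let sg_neq0 p : p != 0 -> sg p != 0.
Proof. by move=> p0; rewrite -(rmorph0 sg) (inj_eq sg_inj). Qed.

Lemma frac_map_div (a b : R) : b != 0 -> frac_map sg (a%:F / b%:F) = (sg a)%:F / (sg b)%:F.
Proof.
move=> b0; rewrite /frac_map; set f := a%:F / b%:F; set r := generic_quotient.repr f.
have d0 : \d_r != 0 by exact: denom_ratioP.
have e : \n_r * b = a * \d_r.
  apply/eqP; rewrite -tofrac_eq !tofracM.
  rewrite -eqr_div ?tofrac_eq0 //; apply/eqP.
  exact: (esym (frac_repr f)).
apply/eqP; rewrite eqr_div ?tofrac_eq0 ?sg_neq0 //.
by rewrite -!tofracM -!rmorphM e.
Qed.

Lemma frac_map_tofrac (a : R) : frac_map sg a%:F = (sg a)%:F.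
Proof.
have := @frac_map_div a 1 (oner_neq0 _).
by rewrite rmorph1 tofrac1 !divr1.
Qed.

Lemma frac_map_zmod_morphism : zmod_morphism (frac_map sg).
Proof.
move=> f g; rewrite (frac_repr f) (frac_repr g).
set a := \n__; set b := \d__; set c := \n__; set d := \d__.
have hb : b != 0 by exact: denom_ratioP.
have hd : d != 0 by exact: denom_ratioP.
have fr (x y z t : R) : y != 0 -> t != 0 ->
    x%:F / y%:F - z%:F / t%:F = (x * t - z * y)%:F / (y * t)%:F :> {fraction _}.
  by move=> y0 t0; rewrite tofracB !tofracM -mulNr addf_div ?tofrac_eq0 // mulNr.
rewrite fr // !frac_map_div ?mulf_neq0 // fr ?sg_neq0 //.
by rewrite !(rmorphM, rmorphB).
Qed.

Lemma frac_map_monoid_morphism : monoid_morphism (frac_map sg).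
Proof.
split; first by have := @frac_map_tofrac 1; rewrite rmorph1 tofrac1.
move=> f g; rewrite (frac_repr f) (frac_repr g).
set a := \n__; set b := \d__; set c := \n__; set d := \d__.
have hb : b != 0 by exact: denom_ratioP.
have hd : d != 0 by exact: denom_ratioP.
by rewrite mulf_div -!tofracM !frac_map_div ?mulf_neq0 // !rmorphM mulf_div.
Qed.

End FractionMap.

(** The injectivity proof is an argument so that the ring morphism structure can be attached to the
    function. *)
Definition frac_rmorph (R : idomainType) (sg : {rmorphism R -> R}) of injective sg :=
  frac_map sg.

Section FractionMorphism.
Variables (R : idomainType) (sg : {rmorphism R -> R}) (sg_inj : injective sg).
HB.instance Definition _ := GRing.isZmodMorphism.Build {fraction R} {fraction R}
  (frac_rmorph sg_inj) (frac_map_zmod_morphism sg_inj).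
HB.instance Definition _ := GRing.isMonoidMorphism.Build {fraction R} {fraction R}
  (frac_rmorph sg_inj) (frac_map_monoid_morphism sg_inj).
End FractionMorphism.

Lemma frac_rmorph_eq (R : idomainType) (F : fieldType) (g g' : {rmorphism {fraction R} -> F}) :
  (forall a : R, g a%:F = g' a%:F) -> g =1 g'.
Proof. by move=> h f; rewrite (frac_repr f) !fmorph_div !h. Qed.

(** * Rational functions and Laurent polynomials *)

(** The product rule of divided differences as skew derivations: [y'] and [z'] are the images of [y]
    and [z] under the exchange, [d] is the difference of the two variables. *)
Lemma twisted_leibniz (F : fieldType) (y z y' z' d : F) :
  (y * z - y' * z') / d = y * ((z - z') / d) + (y - y') / d * z'.
Proof. by ring. Qed.

Section RationalFunctions.
Variables (k : fieldType) (N : nat).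
Local Notation R := {mpoly k[N]}.
Local Notation F := {fraction R}.

Definition rvar (i : 'I_N) : F := ('X_i : R)%:F.
Definition rconst (c : k) : F := (c%:MP : R)%:F.

Lemma rconst_zmod_morphism : zmod_morphism rconst.
Proof. by move=> a b; rewrite /rconst mpolyCB tofracB. Qed.
Lemma rconst_monoid_morphism : monoid_morphism rconst.
Proof. by split=> [|a b]; rewrite /rconst ?mpolyC1 ?tofrac1 // mpolyCM tofracM. Qed.
HB.instance Definition _ := GRing.isZmodMorphism.Build k F rconst rconst_zmod_morphism.
HB.instance Definition _ := GRing.isMonoidMorphism.Build k F rconst rconst_monoid_morphism.

Lemma rvar_neq0 i : rvar i != 0.
Proof.
rewrite tofrac_eq0; apply/eqP => /(congr1 (mcoeff U_(i))).
by rewrite mcoeffXU eqxx mcoeff0 => /eqP; rewrite oner_eq0.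
Qed.

Lemma tofrac_mpolyE (P : R) :
  P%:F = \sum_(m <- msupp P) rconst P@_m * \prod_(i < N) rvar i ^+ m i.
Proof.
rewrite {1}(mpolyE P) rmorph_sum; apply: eq_bigr => m _ /=.
rewrite -mul_mpolyC tofracM; congr (_ * _).
by rewrite mpolyXE_id rmorph_prod; apply: eq_bigr => i _ /=; rewrite tofracXn.
Qed.

Lemma rational_rmorph_eq (F' : fieldType) (g g' : {rmorphism F -> F'}) :
  (forall c, g (rconst c) = g' (rconst c)) ->
  (forall i, g (rvar i) = g' (rvar i)) -> g =1 g'.
Proof.
move=> hc hx; apply: frac_rmorph_eq => P; rewrite tofrac_mpolyE !rmorph_sum.
apply: eq_bigr => m _; rewrite !rmorphM hc !rmorph_prod; congr (_ * _).
by apply: eq_bigr => i _; rewrite !rmorphXn hx.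
Qed.

Lemma rconst_rvar_inj c d i j : c != 0 -> d != 0 ->
  rconst c * rvar i = rconst d * rvar j -> c = d /\ i = j.
Proof.
move=> c0 d0; rewrite -!tofracM => /eqP; rewrite tofrac_eq !mul_mpolyC => /eqP e.
have := congr1 (mcoeff U_(i)) e; rewrite !mcoeffZ !mcoeffXU eqxx mulr1.
case: eqP => [->|_]; first by rewrite mulr1.
by rewrite mulr0 => ec; rewrite ec eqxx in c0.
Qed.

Definition lpoly (f : F) : Prop :=
  exists (P : R) (m : nat), f = P%:F / (\prod_(i < N) rvar i) ^+ m.

Let xp : F := \prod_(i < N) rvar i.
Let xp_neq0 : xp != 0.
Proof. by apply/prodf_neq0 => i _; exact: rvar_neq0. Qed.

Let xpE : xp = (\prod_(i < N) 'X_i : R)%:F.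
Proof. by rewrite rmorph_prod. Qed.

Lemma lpoly_tofrac (P : R) : lpoly P%:F.
Proof. by exists P, 0%N; rewrite expr0 divr1. Qed.

Lemma lpolyM f g : lpoly f -> lpoly g -> lpoly (f * g).
Proof.
move=> [P [m ->]] [Q [m' ->]]; exists (P * Q), (m + m')%N.
by rewrite tofracM exprD mulf_div.
Qed.

Lemma lpolyD f g : lpoly f -> lpoly g -> lpoly (f + g).
Proof.
move=> [P [m ->]] [Q [m' ->]]; rewrite -!/xp.
exists (P * (\prod_(i < N) 'X_i) ^+ m' + Q * (\prod_(i < N) 'X_i) ^+ m), (m + m')%N.
by rewrite -/xp tofracD !tofracM !tofracXn -!xpE addf_div ?expf_neq0 // exprD.
Qed.

Lemma lpoly_const c : lpoly (rconst c). Proof. exact: lpoly_tofrac. Qed.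
Lemma lpoly_var i : lpoly (rvar i). Proof. exact: lpoly_tofrac. Qed.

Lemma lpolyN f : lpoly f -> lpoly (- f).
Proof.
move=> h; rewrite -mulN1r; apply: lpolyM => //.
by have := lpoly_const (-1); rewrite rmorphN1.
Qed.

Lemma lpoly0 : lpoly 0.
Proof. by have := lpoly_const 0; rewrite rmorph0. Qed.

Lemma lpoly1 : lpoly 1.
Proof. by have := lpoly_const 1; rewrite rmorph1. Qed.

Lemma lpoly_varV i : lpoly (rvar i)^-1.
Proof.
exists (\prod_(j < N | j != i) 'X_j), 1%N.
rewrite expr1 rmorph_prod /= (bigD1 (P := xpredT) i) //= -/(rvar _).
set y := \prod_(j < N | j != i) rvar j.
have y0 : y != 0 by apply/prodf_neq0 => j _; exact: rvar_neq0.
by rewrite invfM mulrCA [y * _]divff ?mulr1.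
Qed.

Lemma lpoly_sum (I : Type) (r : seq I) (P : pred I) (f : I -> F) :
  (forall i, P i -> lpoly (f i)) -> lpoly (\sum_(i <- r | P i) f i).
Proof. by move=> h; elim/big_rec: _ => [|i x hi hx]; [exact: lpoly0 | apply: lpolyD; auto]. Qed.

Lemma lpoly_prod (I : Type) (r : seq I) (P : pred I) (f : I -> F) :
  (forall i, P i -> lpoly (f i)) -> lpoly (\prod_(i <- r | P i) f i).
Proof. by move=> h; elim/big_rec: _ => [|i x hi hx]; [exact: lpoly1 | apply: lpolyM; auto]. Qed.

Lemma lpolyX f m : lpoly f -> lpoly (f ^+ m).
Proof. by move=> h; elim: m => [|m IH]; [exact: lpoly1 | rewrite exprS; exact: lpolyM]. Qed.

Lemma lpoly_rmorph (g : {rmorphism F -> F}) f :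
  (forall c, g (rconst c) = rconst c) ->
  (forall i, lpoly (g (rvar i))) -> (forall i, lpoly (g (rvar i)^-1)) ->
  lpoly f -> lpoly (g f).
Proof.
move=> hc hx hxV [P [m ->]]; rewrite rmorphM; apply: lpolyM.
  rewrite tofrac_mpolyE rmorph_sum; apply: lpoly_sum => u _.
  rewrite rmorphM hc rmorph_prod; apply: lpolyM; first exact: lpoly_const.
  by apply: lpoly_prod => i _; rewrite rmorphXn; apply: lpolyX.
rewrite -exprVn -prodfV rmorphXn rmorph_prod; apply: lpolyX.
by apply: lpoly_prod.
Qed.

(** The denominator, a power of the product of all variables, is invariant under the exchange, so
    [f] may be taken polynomial, and then monomial by linearity. On single variables the quotient is
    1, -1 or 0, and the skew Leibniz rule extends this to monomials. *)
Lemma lpoly_divdiff (g : {rmorphism F -> F}) i j f : i != j ->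
  (forall c, g (rconst c) = rconst c) -> (forall l, g (rvar l) = rvar (tperm i j l)) ->
  lpoly f -> lpoly ((f - g f) / (rvar i - rvar j)).
Proof.
move=> hij hc hx [P [m ->]]; rewrite rmorphM fmorphV rmorphXn rmorph_prod.
have -> : \prod_(l < N) g (rvar l) = xp.
  rewrite /xp [RHS](reindex_inj (@perm_inj _ (tperm i j))).
  by apply: eq_bigr => l _; exact: hx.
rewrite -/xp -mulrBl mulrAC; apply: lpolyM; last first.
  by rewrite -exprVn -prodfV; apply: lpolyX; apply: lpoly_prod => l _; exact: lpoly_varV.
have d0 : rvar i - rvar j != 0.
  rewrite subr_eq0; apply/eqP => e; have := @rconst_rvar_inj 1 1 i j (oner_neq0 _) (oner_neq0 _).
  by rewrite rmorph1 !mul1r => /(_ e)[_ eij]; rewrite eij eqxx in hij.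
elim/mpolyind: P => [|c u P _ _ IH]; first by rewrite tofrac0 rmorph0 subrr mul0r; exact: lpoly0.
rewrite tofracD rmorphD opprD addrACA mulrDl; apply: lpolyD => //.
rewrite -mul_mpolyC tofracM rmorphM -/(rconst c) hc -mulrBr -mulrA.
apply: lpolyM; first exact: lpoly_const.
pose good y := [/\ lpoly y, lpoly (g y) & lpoly ((y - g y) / (rvar i - rvar j))].
have good1 : good 1.
  by rewrite /good rmorph1 subrr mul0r; split; [exact: lpoly1 | exact: lpoly1 | exact: lpoly0].
have goodM y z : good y -> good z -> good (y * z).
  move=> [y1 y2 y3] [z1 z2 z3]; rewrite /good rmorphM; split; try exact: lpolyM.
  by rewrite twisted_leibniz; apply: lpolyD; apply: lpolyM.
have good_var l : good (rvar l).
  rewrite /good hx; split; try exact: lpoly_var.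
  case: tpermP => [->|->|_ _]; rewrite ?divff ?subrr ?mul0r //;
    try exact: lpoly0; try exact: lpoly1.
  by rewrite -opprB mulNr divff //; apply: lpolyN; exact: lpoly1.
suff [] : good ('X_[u] : R)%:F by [].
rewrite mpolyXE_id rmorph_prod; elim/big_rec: _ => // l y _ hy; apply: (goodM _ _ _ hy).
by rewrite rmorphXn; elim: (u l) => [|e IHe]; rewrite ?expr0 // exprS;
  exact: goodM (good_var l) IHe.
Qed.

End RationalFunctions.

(** * Automorphisms of the rational function field: rotation and permutations *)

Section Automorphisms.
Variables (k : fieldType) (N : nat) (q : k).
Hypothesis q_neq0 : q != 0.
Local Notation R := {mpoly k[N]}.
Local Notation F := {fraction R}.

Lemma mpoly_rmorph_eq (A : comNzRingType) (g g' : {rmorphism R -> A}) :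
  (forall c, g c%:MP = g' c%:MP) -> (forall i, g 'X_i = g' 'X_i) -> g =1 g'.
Proof.
move=> hc hx P; rewrite (mpolyE P) !rmorph_sum; apply: eq_bigr => m _ /=.
rewrite -mul_mpolyC !rmorphM hc mpolyXE_id !rmorph_prod; congr (_ * _).
by apply: eq_bigr => i _ /=; rewrite !rmorphXn hx.
Qed.

Definition rot_tuple : N.-tuple R :=
  [tuple (if (i : nat) == 0%N then q *: 'X_(ord_pred i) else 'X_(ord_pred i)) | i < N].
Definition unrot_tuple : N.-tuple R :=
  [tuple (if (ordS i : nat) == 0%N then q^-1 *: 'X_(ordS i) else 'X_(ordS i)) | i < N].

Lemma comp_rotX i : 'X_i \mPo rot_tuple
  = (if (i : nat) == 0%N then q *: 'X_(ord_pred i) else 'X_(ord_pred i)).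
Proof. by rewrite comp_mpolyXU -tnth_nth tnth_mktuple. Qed.

Lemma comp_unrotX i : 'X_i \mPo unrot_tuple
  = (if (ordS i : nat) == 0%N then q^-1 *: 'X_(ordS i) else 'X_(ordS i)).
Proof. by rewrite comp_mpolyXU -tnth_nth tnth_mktuple. Qed.

(** Stated on polynomials because it supplies the injectivity with which the substitution extends to
    fractions. *)
Lemma comp_rotK : cancel (comp_mpoly rot_tuple) (comp_mpoly unrot_tuple).
Proof.
move=> P; apply: (mpoly_rmorph_eq (g := comp_mpoly unrot_tuple \o comp_mpoly rot_tuple)
  (g' := idfun)) => [c|i] /=; first by rewrite !comp_mpolyC.
rewrite comp_rotX; case: ifP => hi; rewrite ?comp_mpolyZ comp_unrotX ord_predK hi //.
by rewrite scalerA divff // scale1r.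
Qed.

Lemma comp_unrotK : cancel (comp_mpoly unrot_tuple) (comp_mpoly rot_tuple).
Proof.
move=> P; apply: (mpoly_rmorph_eq (g := comp_mpoly rot_tuple \o comp_mpoly unrot_tuple)
  (g' := idfun)) => [c|i] /=; first by rewrite !comp_mpolyC.
rewrite comp_unrotX; case: ifP => hi; rewrite ?comp_mpolyZ comp_rotX hi ordSK //.
by rewrite scalerA mulVf // scale1r.
Qed.

Definition rotF : F -> F := frac_rmorph (can_inj comp_rotK).
Definition unrotF : F -> F := frac_rmorph (can_inj comp_unrotK).
HB.instance Definition _ := GRing.RMorphism.on rotF.
HB.instance Definition _ := GRing.RMorphism.on unrotF.

Lemma rotF_const c : rotF (rconst N c) = rconst N c.
Proof.
rewrite /rotF /frac_rmorph frac_map_tofrac /=; last exact: (can_inj comp_rotK).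
by rewrite comp_mpolyC.
Qed.

Lemma unrotF_const c : unrotF (rconst N c) = rconst N c.
Proof.
rewrite /unrotF /frac_rmorph frac_map_tofrac /=; last exact: (can_inj comp_unrotK).
by rewrite comp_mpolyC.
Qed.

Lemma rotF_var i : rotF (rvar k i)
  = if (i : nat) == 0%N then rconst N q * rvar k (ord_pred i) else rvar k (ord_pred i).
Proof.
rewrite /rotF /frac_rmorph frac_map_tofrac /= ?comp_rotX; last exact: (can_inj comp_rotK).
by case: ifP => // _; rewrite -mul_mpolyC tofracM.
Qed.

Lemma unrotF_var i : unrotF (rvar k i)
  = if (ordS i : nat) == 0%N then rconst N q^-1 * rvar k (ordS i) else rvar k (ordS i).
Proof.
rewrite /unrotF /frac_rmorph frac_map_tofrac /= ?comp_unrotX; last exact: (can_inj comp_unrotK).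
by case: ifP => // _; rewrite -mul_mpolyC tofracM.
Qed.

Lemma rotFK : cancel rotF unrotF.
Proof.
move=> f; apply: (rational_rmorph_eq (g := unrotF \o rotF) (g' := idfun)) => [c|i] /=.
  by rewrite rotF_const unrotF_const.
rewrite rotF_var; case: ifP => hi; last by rewrite unrotF_var ord_predK hi.
rewrite rmorphM /= unrotF_const unrotF_var ord_predK hi.
by rewrite mulrA -rmorphM divff // rmorph1 mul1r.
Qed.

Lemma unrotFK : cancel unrotF rotF.
Proof.
move=> f; apply: (rational_rmorph_eq (g := rotF \o unrotF) (g' := idfun)) => [c|i] /=.
  by rewrite unrotF_const rotF_const.
rewrite unrotF_var; case: ifP => hi; last by rewrite rotF_var hi ordSK.
rewrite rmorphM /= rotF_const rotF_var hi ordSK.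
by rewrite mulrA -rmorphM mulVf // rmorph1 mul1r.
Qed.

Lemma lpoly_rotF f : lpoly f -> lpoly (rotF f).
Proof.
apply: (@lpoly_rmorph _ _ rotF) => [c|i|i] /=; first exact: rotF_const.
  rewrite rotF_var; case: ifP => _; last exact: lpoly_var.
  by apply: lpolyM; [exact: lpoly_const | exact: lpoly_var].
rewrite fmorphV /= rotF_var; case: ifP => _; last exact: lpoly_varV.
by rewrite invfM -fmorphV; apply: lpolyM; [exact: lpoly_const | exact: lpoly_varV].
Qed.

Lemma lpoly_unrotF f : lpoly f -> lpoly (unrotF f).
Proof.
apply: (@lpoly_rmorph _ _ unrotF) => [c|i|i] /=; first exact: unrotF_const.
  rewrite unrotF_var; case: ifP => _; last exact: lpoly_var.
  by apply: lpolyM; [exact: lpoly_const | exact: lpoly_var].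
rewrite fmorphV /= unrotF_var; case: ifP => _; last exact: lpoly_varV.
by rewrite invfM -fmorphV; apply: lpolyM; [exact: lpoly_const | exact: lpoly_varV].
Qed.

Definition permF (p : 'S_N) : F -> F := frac_rmorph (inj_msym (R := k) p).
HB.instance Definition _ p := GRing.RMorphism.on (permF p).

Lemma permF_const p c : permF p (rconst N c) = rconst N c.
Proof.
rewrite /permF /frac_rmorph frac_map_tofrac /=; last exact: inj_msym.
by rewrite -[c%:MP]mulr1 mul_mpolyC msymZ msym1 -mul_mpolyC mulr1.
Qed.

Lemma permF_var p i : permF p (rvar k i) = rvar k (p i).
Proof.
rewrite /permF /frac_rmorph frac_map_tofrac /=; last exact: inj_msym.
rewrite msymX; congr ('X_[_])%:F; apply/mnmP => j; rewrite mnmE !mnm1E.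
by rewrite -(inj_eq (@perm_inj _ p)) permKV.
Qed.

Lemma lpoly_permF p f : lpoly f -> lpoly (permF p f).
Proof.
apply: (@lpoly_rmorph _ _ (permF p)) => [c|i|i] /=; first exact: permF_const.
  by rewrite permF_var; exact: lpoly_var.
by rewrite fmorphV /= permF_var; exact: lpoly_varV.
Qed.

End Automorphisms.

(** * Reverse standard tableaux *)

Section Tableaux.
Variables (N : nat) (lam : seq nat).
Hypothesis hlam : is_partition N lam.
Implicit Types (T : Tab N lam) (k l : 'I_N).

Lemma tab_cell T k : (rowT T k < size lam)%N && (colT T k < nth 0%N lam (rowT T k))%N.
Proof. by case: T => t ht; case/and4P: (ht) => /forallP/(_ k). Qed.

Lemma tab_inj T k l : rowT T k = rowT T l -> colT T k = colT T l -> k = l.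
Proof.
case: T => t ht; case/and4P: (ht) => _ /injectiveP inj _ _ hr hc; apply: inj.
by rewrite [t k]surjective_pairing [t l]surjective_pairing; congr pair; apply: val_inj.
Qed.

Lemma tab_row T k l : rowT T k = rowT T l -> (colT T k < colT T l)%N -> (l < k)%N.
Proof.
case: T => t ht; case/and4P: (ht) => _ _ /forallP/(_ k)/forallP/(_ l)/implyP h _ hr hc.
by apply: h; apply/andP; split=> //; apply/eqP/val_inj.
Qed.

Lemma tab_col T k l : colT T k = colT T l -> (rowT T k < rowT T l)%N -> (l < k)%N.
Proof.
case: T => t ht; case/and4P: (ht) => _ _ _ /forallP/(_ k)/forallP/(_ l)/implyP h hr hc.
by apply: h; apply/andP; split=> //; apply/eqP/val_inj.
Qed.

(** A tableau is only required to place its entries injectively inside the diagram; the diagram has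
    [sumn lam = N] cells, so every cell is filled. *)
Lemma tab_surj T r c : (r < size lam)%N -> (c < nth 0%N lam r)%N ->
  exists k, rowT T k = r /\ colT T k = c.
Proof.
move=> hr hc.
pose cells := [seq (r', c') | r' <- iota 0 (size lam), c' <- iota 0 (nth 0%N lam r')].
pose im := [seq (rowT T k, colT T k) | k <- enum 'I_N].
have memc r' c' : ((r', c') \in cells) = (r' < size lam)%N && (c' < nth 0%N lam r')%N.
  apply/allpairsPdep/andP => [[r1 [c1 [h1 h2 [-> ->]]]]|[h1 h2]].
    by rewrite !mem_iota in h1 h2.
  by exists r', c'; split=> //; rewrite mem_iota.
have uim : uniq im.
  by rewrite map_inj_uniq ?enum_uniq // => k l [h1 h2]; exact: tab_inj h1 h2.
have sub : {subset im <= cells}.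
  by move=> p /mapP[k _ ->]; rewrite memc tab_cell.
have szc : (size cells <= size im)%N.
  rewrite size_map size_enum_ord size_allpairs_dep.
  case/and3P: hlam => _ _ /eqP <-.
  rewrite (eq_map (g := fun r' => nth 0%N lam r')); last by move=> r'; rewrite size_iota.
  by rewrite -/(mkseq _ _) mkseq_nth.
have [_ eqi] := uniq_min_size uim sub szc.
have : (r, c) \in im by rewrite eqi memc hr hc.
by case/mapP => k _ [-> ->]; exists k.
Qed.

Lemma part_leq r r' : (r <= r')%N -> (nth 0%N lam r' <= nth 0%N lam r)%N.
Proof.
move=> hrr'; have [hr'|hr'] := ltnP r' (size lam); last by rewrite nth_default.
case/and3P: hlam => hs _ _.
apply: (sorted_leq_nth (leT := geq)) => //; rewrite ?inE //.
- by move=> x y z /= h1 h2; exact: leq_trans h2 h1.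
- by move=> x /=.
- exact: leq_ltn_trans hr'.
Qed.

(** The row of [k] is the lower one, hence at least as long, so it has a cell in the column of [l].
    The entry [j] found there produces the contradictions below. *)
Lemma tab_corner T k l : (rowT T k < rowT T l)%N ->
  exists j, rowT T j = rowT T k /\ colT T j = colT T l.
Proof.
move=> h; have /andP[h1 _] := tab_cell T k; have /andP[_ h2] := tab_cell T l.
by apply: tab_surj => //; apply: leq_trans h2 _; apply: part_leq; exact: ltnW.
Qed.

Lemma tab_corner_col T k l : (colT T k < colT T l)%N ->
  exists j, rowT T j = rowT T l /\ colT T j = colT T k.
Proof.
move=> h; have /andP[h1 h2] := tab_cell T l.
by apply: tab_surj => //; exact: ltn_trans h h2.
Qed.

(** A cell between the two would hold an entry strictly between consecutive integers. *)
Lemma tab_same_row T k l : l = k.+1 :> nat -> rowT T k = rowT T l ->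
  colT T k = (colT T l).+1.
Proof.
move=> e hr; have kl : k != l by apply/eqP => ekl; rewrite ekl in e; lia.
have hc : (colT T l < colT T k)%N.
  case: (ltngtP (colT T l) (colT T k)) => // h.
    by have := tab_row hr h; lia.
  by have := tab_inj hr (esym h) => /eqP; rewrite (negPf kl).
have /andP[h1 h2] := tab_cell T k.
have [|j [hj1 hj2]] := @tab_surj T (rowT T k) (colT T l).+1 h1; first by lia.
have hlj : (j < l)%N by apply: (@tab_row T l j); rewrite ?hj1 ?hj2.
apply/eqP; rewrite eqn_leq hc andbT leqNgt; apply/negP => hc'.
have : (k < j)%N by apply: (@tab_row T j k); rewrite ?hj1 ?hj2.
lia.
Qed.

Lemma tab_same_col T k l : l = k.+1 :> nat -> colT T k = colT T l ->
  rowT T k = (rowT T l).+1.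
Proof.
move=> e hr; have kl : k != l by apply/eqP => ekl; rewrite ekl in e; lia.
have hc : (rowT T l < rowT T k)%N.
  case: (ltngtP (rowT T l) (rowT T k)) => // h.
    by have := tab_col hr h; lia.
  by have := tab_inj (esym h) hr => /eqP; rewrite (negPf kl).
have /andP[h1 h2] := tab_cell T k.
have [||j [hj1 hj2]] := @tab_surj T (rowT T l).+1 (colT T k); first by lia.
  by apply: leq_trans h2 _; apply: part_leq.
have hlj : (j < l)%N by apply: (@tab_col T l j); rewrite ?hj1 ?hj2.
apply/eqP; rewrite eqn_leq hc andbT leqNgt; apply/negP => hc'.
have : (k < j)%N by apply: (@tab_col T j k); rewrite ?hj1 ?hj2.
lia.
Qed.

(** Otherwise the entry in the row of [l] and the column of [k] would lie strictly between [k] and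
    [k.+1]. *)
Lemma tab_below T k l : l = k.+1 :> nat -> (rowT T l < rowT T k)%N ->
  colT T k != colT T l -> (colT T k < colT T l)%N.
Proof.
move=> e hr hc; rewrite ltn_neqAle hc leqNgt; apply/negP => hlt.
have [j [j1 j2]] := tab_corner hr.
have : (j < l)%N by apply: (@tab_row T l j); rewrite ?j1 ?j2.
have : (k < j)%N by apply: (@tab_col T j k); rewrite ?j1 ?j2.
lia.
Qed.

Lemma tab_above T k l : l = k.+1 :> nat -> (rowT T k < rowT T l)%N ->
  colT T k != colT T l -> (colT T l < colT T k)%N.
Proof.
move=> e hr hc; rewrite ltn_neqAle eq_sym hc leqNgt; apply/negP => hlt.
have [j [j1 j2]] := tab_corner hr.
have : (j < k)%N by apply: (@tab_row T k j); rewrite ?j1 ?j2.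
have : (l < j)%N by apply: (@tab_col T j l); rewrite ?j1 ?j2.
lia.
Qed.

(** Two entries on one diagonal span a rectangle. If [l] is the higher one, a corner entry is both
    smaller than [k] and larger than [l]. If [l] is the lower one, the two corner entries both lie
    strictly between [k] and [k.+2], hence coincide, in different cells. *)
Lemma tab_content2 T k l : l = k.+2 :> nat -> CT T k != CT T l.
Proof.
move=> e; apply/eqP; rewrite /CT => hct.
case: (ltngtP (rowT T k) (rowT T l)) => hr.
- have [j [j1 j2]] := tab_corner hr.
  have : (j < k)%N by apply: (@tab_row T k j); rewrite ?j1 ?j2 //; lia.
  have : (l < j)%N by apply: (@tab_col T j l); rewrite ?j1 ?j2 //; lia.
  lia.
- have [j [j1 j2]] := tab_corner hr.
  have [|i [i1 i2]] := @tab_corner_col T l k; first by lia.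
  have a1 : (j < l)%N by apply: (@tab_row T l j); rewrite ?j1 ?j2 //; lia.
  have a2 : (k < j)%N by apply: (@tab_col T j k); rewrite ?j1 ?j2 //; lia.
  have b1 : (k < i)%N by apply: (@tab_row T i k); rewrite ?i1 ?i2 //; lia.
  have b2 : (i < l)%N by apply: (@tab_col T l i); rewrite ?i1 ?i2 //; lia.
  have eij : i = j by apply: val_inj => /=; lia.
  by rewrite eij in i1; lia.
- have hc : colT T k = colT T l by lia.
  have := tab_inj hr hc => ekl; rewrite ekl in e; lia.
Qed.

(** Exchanging consecutive values changes only the comparison between [k] and [l], which share
    neither row nor column; so the result is reverse standard and the default of [tswap] is not
    reached. *)
Lemma tswapE T k l i : l = k.+1 :> nat -> rowT T k != rowT T l -> colT T k != colT T l ->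
  tabf (tswap T k l) i = tabf T (tperm k l i).
Proof.
move=> e hr hc; rewrite /tswap /tabf -[proj1_sig _]/(val _) insubdK ?ffunE //.
rewrite unfold_in; have ord (a b : 'I_N) : (tperm k l a < tperm k l b)%N ->
    (a < b)%N \/ a = l /\ b = k.
  have kl (i' : 'I_N) : i' <> k -> i' <> l -> (i' < k)%N || (l < i')%N.
    move=> h1 h2; have h1' : i' <> k :> nat by move=> h; apply: h1; exact: val_inj.
    have h2' : i' <> l :> nat by move=> h; apply: h2; exact: val_inj.
    by lia.
  case: tpermP => [->|->|/kl h1 /h1 {}h1]; case: tpermP => [->|->|/kl h2 /h2 {}h2] h;
    try (by left; lia); by right.
case: T hr hc => t ht; rewrite /rowT /colT /= => hr hc.
case/and4P: (ht) => /forallP h1 /injectiveP h2 /forallP h3 /forallP h4.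
apply/and4P; split.
- by apply/forallP => j; rewrite ffunE h1.
- by apply/injectiveP => a b; rewrite !ffunE => /h2/perm_inj.
- apply/forallP => a; apply/forallP => b; rewrite !ffunE; apply/implyP => hab.
  have /implyP/(_ hab)/ord[//|[eb ea]] := forallP (h3 (tperm k l a)) (tperm k l b).
  by move: hab; rewrite ea eb tpermL tpermR => /andP[/eqP hab _]; rewrite hab eqxx in hr.
- apply/forallP => a; apply/forallP => b; rewrite !ffunE; apply/implyP => hab.
  have /implyP/(_ hab)/ord[//|[eb ea]] := forallP (h4 (tperm k l a)) (tperm k l b).
  by move: hab; rewrite ea eb tpermL tpermR => /andP[/eqP hab _]; rewrite hab eqxx in hc.
Qed.

Lemma tab_exists : (0 < N)%N -> exists T : Tab N lam, True.
Proof.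
move=> N0; have /and3P[hs hp /eqP hsum] := hlam.
(* The cells are read row by row from the bottom and filled in decreasing order, so the entry
   encoded by [k] gets reading position [N - k.+1]. *)
pose rd (k : 'I_N) := (N - k.+1)%N.
have rd_lt k : (rd k < sumn lam)%N by rewrite hsum /rd; lia.
have szN : (size lam <= N)%N.
  rewrite -hsum; elim: (lam) hp => //= c l IH /andP[hc /IH]; lia.
have hrow k : (reshape_index lam (rd k) < N)%N.
  exact: leq_trans (reshape_indexP (rd_lt k)) szN.
have hcol k : (reshape_offset lam (rd k) < N)%N.
  by rewrite -[X in (_ < X)%N]hsum; apply: leq_ltn_trans (leq_subr _ _) (rd_lt k).
pose t := [ffun k => (Ordinal (hrow k), Ordinal (hcol k))].
suff ht : is_rst lam t by exists (exist _ t ht).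
apply/and4P; split.
- apply/forallP => k; rewrite ffunE /= reshape_indexP ?rd_lt //=.
  by rewrite reshape_offsetP ?rd_lt.
- apply/injectiveP => k l; rewrite !ffunE => -[h1 h2]; apply: val_inj => /=.
  have := reshape_indexK lam (rd k); rewrite h1 h2 reshape_indexK /rd.
  by have := ltn_ord k; have := ltn_ord l; lia.
- apply/forallP => k; apply/forallP => l; rewrite !ffunE /=; apply/implyP.
  move=> /andP[/eqP[h1] h2]; suff : ~~ (rd l <= rd k)%N by rewrite /rd; have := ltn_ord l; lia.
  by rewrite (reshape_leq lam) h1 ltnn eqxx /= -ltnNge.
- apply/forallP => k; apply/forallP => l; rewrite !ffunE /=; apply/implyP.
  move=> /andP[/eqP[h1] h2]; suff : ~~ (rd l <= rd k)%N by rewrite /rd; have := ltn_ord l; lia.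
  by rewrite (reshape_leq lam) ltnNge (ltnW h2) /= (gtn_eqF h2).
Qed.

End Tableaux.

(** * Ordinals and natural-number indices *)

Lemma hi_lo_neq N (j : 'I_N.-1) : lo j != hi j.
Proof. by rewrite -val_eqE /=; lia. Qed.

Lemma lo_inord m i : (i < m.+1)%N -> lo (inord i : 'I_m.+2.-1) = inord i.
Proof. by move=> h; apply: val_inj; rewrite /= !inordK //; lia. Qed.

Lemma hi_inord m i : (i < m.+1)%N -> hi (inord i : 'I_m.+2.-1) = inord i.+1.
Proof. by move=> h; apply: val_inj; rewrite /= !inordK //; lia. Qed.

Lemma inord_sw m i j : (i < m.+1)%N -> (j <= m.+1)%N ->
  tperm (lo (inord i : 'I_m.+2.-1)) (hi (inord i : 'I_m.+2.-1)) (inord j : 'I_m.+2)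
  = inord (sw i j).
Proof.
move=> hi0 hj; have inordE a b : (a <= m.+1)%N -> (b <= m.+1)%N ->
    (inord a == inord b :> 'I_m.+2) = (a == b).
  by move=> ha hb; rewrite -val_eqE /= !inordK.
rewrite lo_inord // hi_inord // /sw permE /= !inordE //; try lia.
by do !case: eqP.
Qed.

Section Generic.
Variables (k : fieldType) (m : nat).
Local Notation N := m.+2.
Local Notation n := m.+1.
Local Notation F := {fraction {mpoly k[N]}}.

Local Notation gconst := (@rconst k N).

Definition gvar (i : nat) : F := rvar k (inord i : 'I_N).
Definition gswap (i : nat) : F -> F :=
  permF (tperm (lo (inord i : 'I_N.-1)) (hi (inord i : 'I_N.-1))).
HB.instance Definition _ i := GRing.RMorphism.copy (gswap i)
  (permF (tperm (lo (inord i : 'I_N.-1)) (hi (inord i : 'I_N.-1)))).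
Lemma gswap_const i a : gswap i (gconst a) = gconst a.
Proof. exact: permF_const. Qed.

Lemma gswap_var i j : (i < n)%N -> (j <= n)%N -> gswap i (gvar j) = gvar (sw i j).
Proof. by move=> hi0 hj; rewrite /gvar /gswap permF_var inord_sw. Qed.

Lemma g_rmorph_eq (g g' : {rmorphism F -> F}) :
  (forall a, g (gconst a) = g' (gconst a)) ->
  (forall j, (j <= n)%N -> g (gvar j) = g' (gvar j)) -> g =1 g'.
Proof.
move=> hc hx; apply: rational_rmorph_eq => // i.
by have := hx i; rewrite /gvar inord_val; apply; rewrite -ltnS.
Qed.

Lemma gconst_var_inj a b i j : (i <= n)%N -> (j <= n)%N -> a != 0 -> b != 0 ->
  gconst a * gvar i = gconst b * gvar j -> a = b /\ i = j.
Proof.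
move=> hi0 hj a0 b0 /(rconst_rvar_inj a0 b0)[-> e]; split=> //.
by have := congr1 val e; rewrite /= !inordK.
Qed.

Variable q : k.
Hypothesis q_neq0 : q != 0.

Definition grot : F -> F := @rotF k N q q_neq0.
HB.instance Definition _ := GRing.RMorphism.copy grot (@rotF k N q q_neq0).
Definition gunrot : F -> F := @unrotF k N q q_neq0.
HB.instance Definition _ := GRing.RMorphism.copy gunrot (@unrotF k N q q_neq0).

Lemma grot_const a : grot (gconst a) = gconst a.
Proof. exact: rotF_const. Qed.

Lemma grot_var0 : grot (gvar 0) = gconst q * gvar n.
Proof.
rewrite /grot /gvar rotF_var inordK //=; congr (_ * rvar _ _).
by apply: val_inj; rewrite /= !inordK // add0n modn_small.
Qed.

Lemma grot_varS i : (i < n)%N -> grot (gvar i.+1) = gvar i.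
Proof.
move=> hi0; rewrite /grot /gvar rotF_var inordK //=; congr (rvar _ _).
apply: val_inj; rewrite /= !inordK // ?addSn /=; try lia.
by rewrite modnDr modn_small //; lia.
Qed.

Lemma grotK : cancel grot gunrot. Proof. exact: rotFK. Qed.
Lemma gunrotK : cancel gunrot grot. Proof. exact: unrotFK. Qed.

End Generic.

(** * The Hecke module of a partition *)

Section SeminormalCoefficients.
Variables (F : fieldType) (s : F).
Hypothesis s_neq0 : s != 0.
Hypothesis s_pow : forall z : int, s ^ z = 1 -> z = 0.

Definition scoefA (z : int) : F := (s - 1) / (1 - s ^ z).
Definition scoefB (z : int) : F := s * (1 - s ^ (z + 1)) * (1 - s ^ (z - 1)) / (1 - s ^ z) ^+ 2.

Lemma sub1_pow_neq0 z : z != 0 -> 1 - s ^ z != 0.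
Proof. by apply: contraNneq => /eqP; rewrite subr_eq0 eq_sym => /eqP/s_pow->. Qed.

Let s1_neq0 : 1 - s != 0.
Proof. by have := @sub1_pow_neq0 1 isT; rewrite expr1z. Qed.

(** The values at 1 and -1 are the eigenvalues for consecutive entries in a common column and a
    common row, so one formula gives the diagonal coefficient in every case of [heckeBasis]. *)
Lemma scoefA1 : scoefA 1 = -1.
Proof. by rewrite /scoefA expr1z -opprB mulNr divff. Qed.

Lemma scoefAN1 : scoefA (-1) = s.
Proof.
have h : s - 1 != 0 by rewrite -opprB oppr_eq0.
by rewrite /scoefA -invr_expz expr1z; field; rewrite s_neq0 h.
Qed.

Lemma scoefAN z : z != 0 -> scoefA (- z) = s - 1 - scoefA z.
Proof.
move=> hz; rewrite /scoefA -invr_expz.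
have h := sub1_pow_neq0 hz; have h' : s ^ z - 1 != 0 by rewrite -opprB oppr_eq0.
have hs := expfz_neq0 z s_neq0.
move: (s ^ z) h h' hs => y h h' hs; field.
by rewrite h h' hs.
Qed.

Lemma scoefBE z : z != 0 -> scoefB z = (1 + scoefA z) * (s - scoefA z).
Proof.
move=> hz; rewrite /scoefA /scoefB !expfzDr // expr1z -[s ^ (-1)]invr_expz expr1z.
have h := sub1_pow_neq0 hz; move: (s ^ z) h => y h; field.
by rewrite h s_neq0.
Qed.

Lemma scoefBN z : z != 0 -> scoefB z = (1 + scoefA (- z)) * (s - scoefA (- z)).
Proof. by move=> hz; rewrite scoefBE // scoefAN //; ring. Qed.

Lemma scoefB_neq0 z : z != 0 -> z != 1 -> z != -1 -> scoefB z != 0.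
Proof.
move=> h0 h1 h2; rewrite /scoefB mulf_neq0 ?invr_eq0 ?expf_neq0 ?sub1_pow_neq0 //.
by rewrite !mulf_neq0 ?sub1_pow_neq0 ?subr_eq0 // addr_eq0.
Qed.

(* When [i] lies below [i+1], solving the quadratic relation as in [heckeBasis] leaves the
   off-diagonal coefficient 1. *)
Lemma seminormal_lower (U : lmodType F) (u v : U) z : z != 0 -> scoefB z != 0 ->
  (scoefB z)^-1 *: ((s - 1 - scoefA z) *: (scoefA z *: u + scoefB z *: v) + s *: u)
  = scoefA (- z) *: v + 1 *: u.
Proof.
move=> hz hB; rewrite scoefAN //; have hE := scoefBE hz.
move: (scoefA z) (scoefB z) hE hB => a b hE hB.
lmod_coefs F [:: u; v]; first by field.
transitivity (b^-1 * ((1 + a) * (s - a))); first by ring.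
by rewrite -hE mulVf //; ring.
Qed.

Definition cell_content (p : nat * nat) : int := p.2%:Z - p.1%:Z.

Definition cell_weight (p : nat * nat) : F := s ^ cell_content p.

(** The off-diagonal coefficient as a function of two cells, 0 on a common row or column, where the
    swap is no tableau. The two directions are normalised unequally, by [scoefB] and 1; their
    product is the (1 + A)(s - A) demanded by [kapK]. *)
Definition cell_coef (p p' : nat * nat) : F :=
  if (p.1 == p'.1) || (p.2 == p'.2) then 0
  else if (p'.1 < p.1)%N then scoefB (cell_content p' - cell_content p) else 1.

Lemma cell_weight_neq0 p : cell_weight p != 0.
Proof. exact: expfz_neq0. Qed.

Lemma diag_coef_cell p p' :
  diag_coef s cell_weight p p' = scoefA (cell_content p' - cell_content p).
Proof. by rewrite /diag_coef /scoefA /cell_weight expfzDr // -invr_expz. Qed.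

Lemma exprz_inj_free a b : s ^ a = s ^ b -> a = b.
Proof.
move=> e; apply/eqP; rewrite -subr_eq0; apply/eqP/s_pow.
by rewrite expfzDr // -invr_expz e divff // expfz_neq0.
Qed.

End SeminormalCoefficients.

Section VariablePowers.
Variables (k : fieldType) (N : nat).

(** Total degree separates the powers. For the two indeterminates of [K] this says that neither is a
    root of unity. *)
Lemma rvar_pow_eq1 (i : 'I_N) (z : int) : rvar k i ^ z = 1 -> z = 0.
Proof.
have nat_case (d : nat) : rvar k i ^+ d = 1 -> d = 0%N.
  rewrite /rvar -tofracXn -tofrac1 => /eqP; rewrite tofrac_eq mpolyXn => /eqP.
  move=> /(congr1 (fun p => msize p)); rewrite msizeX msize1 mdegMn mdeg1 mul1n.
  by case.
case: z => d.
  by rewrite -exprnP => /nat_case ->.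
by rewrite NegzE -exprnN => /eqP; rewrite invr_eq1 => /eqP /nat_case.
Qed.

End VariablePowers.

Lemma sK_neq0 : sK != 0. Proof. exact: rvar_neq0. Qed.
Lemma qK_neq0 : qK != 0. Proof. exact: rvar_neq0. Qed.
Lemma sK_pow z : sK ^ z = 1 -> z = 0. Proof. exact: rvar_pow_eq1. Qed.
Lemma qK_inj a b : qK ^ a = qK ^ b -> a = b.
Proof. by apply: exprz_inj_free; [exact: qK_neq0 | exact: rvar_pow_eq1]. Qed.

(** * Seminormal form of the tableau module *)

Section HeckeTableaux.
Variables (m : nat) (lam : seq nat).
Local Notation N := m.+2.
Local Notation n := m.+1.
Hypothesis hlam : is_partition N lam.
Implicit Type T : Tab N lam.

Definition tab_pos T (a : nat) : nat * nat := (rowT T (inord a), colT T (inord a)).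
Definition tab_sg (i : nat) T : Tab N lam :=
  tswap T (lo (inord i : 'I_N.-1)) (hi (inord i : 'I_N.-1)).

Let nextE i : (i < n)%N -> (inord i.+1 : 'I_N) = (inord i : 'I_N).+1 :> nat.
Proof. by move=> h; rewrite !inordK //; lia. Qed.

Lemma tab_pos_sg i T : (i < n)%N ->
  cell_coef sK (tab_pos T i) (tab_pos T i.+1) != 0 ->
  forall a, (a <= n)%N -> tab_pos (tab_sg i T) a = tab_pos T (sw i a).
Proof.
move=> hi0 hk a ha; move: hk; rewrite /cell_coef /=.
case: ifP => [|/negbT]; first by rewrite eqxx.
rewrite negb_or => /andP[hr hc] _.
rewrite /tab_pos /rowT /colT /tab_sg lo_inord // hi_inord //.
rewrite tswapE ?nextE // -inord_sw // lo_inord // hi_inord //.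
Qed.

Lemma tab_pos_inj T T' : (forall a, (a <= n)%N -> tab_pos T a = tab_pos T' a) -> T = T'.
Proof.
move=> h; apply: val_inj; apply/ffunP => i.
have := h i; rewrite /tab_pos inord_val -ltnS ltn_ord => /(_ isT)[h1 h2].
have e1 : (tabf T i).1 = (tabf T' i).1 by apply: val_inj.
have e2 : (tabf T i).2 = (tabf T' i).2 by apply: val_inj.
by change (tabf T i = tabf T' i); rewrite [LHS]surjective_pairing e1 e2 -surjective_pairing.
Qed.

(** Entries decrease along rows and columns, so [i] sits immediately to the right of [i.+1] in a
    common row and immediately above it in a common column; otherwise one of the two is both
    strictly higher and strictly further left. *)
Variant adjacent_spec T (i : nat) : Prop :=
| AdjacentRow of (tab_pos T i).1 = (tab_pos T i.+1).1 &
    (tab_pos T i).2 = (tab_pos T i.+1).2.+1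
| AdjacentCol of (tab_pos T i).2 = (tab_pos T i.+1).2 &
    (tab_pos T i).1 = (tab_pos T i.+1).1.+1
| AdjacentUpper of ((tab_pos T i.+1).1 < (tab_pos T i).1)%N &
    ((tab_pos T i).2 < (tab_pos T i.+1).2)%N
| AdjacentLower of ((tab_pos T i).1 < (tab_pos T i.+1).1)%N &
    ((tab_pos T i.+1).2 < (tab_pos T i).2)%N.

Lemma adjacentP T i : (i < n)%N -> adjacent_spec T i.
Proof.
move=> hi0; have e := nextE hi0.
have [hr|hr] := eqVneq (rowT T (inord i)) (rowT T (inord i.+1)).
  by apply: AdjacentRow => //=; exact: (tab_same_row hlam e hr).
have [hc|hc] := eqVneq (colT T (inord i)) (colT T (inord i.+1)).
  by apply: AdjacentCol => //=; exact: (tab_same_col hlam e hc).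
move: hr; rewrite neq_ltn => /orP[hr|hr].
  by apply: AdjacentLower => //=; exact: (tab_above hlam e hr hc).
by apply: AdjacentUpper => //=; exact: (tab_below hlam e hr hc).
Qed.

Lemma tab_kapK i T : (i < n)%N ->
  cell_coef sK (tab_pos T i) (tab_pos T i.+1) * cell_coef sK (tab_pos T i.+1) (tab_pos T i)
  = (1 + diag_coef sK (cell_weight sK) (tab_pos T i) (tab_pos T i.+1))
    * (sK - diag_coef sK (cell_weight sK) (tab_pos T i) (tab_pos T i.+1)).
Proof.
move=> hi0; rewrite !diag_coef_cell ?sK_neq0 //.
case: (adjacentP T hi0); move: (tab_pos T i) (tab_pos T i.+1) => [r c] [r' c'] /=;
  rewrite /cell_coef /cell_content /=.
- move=> -> ->; rewrite eqxx /= mul0r.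
  have -> : c'%:Z - r'%:Z - (c'.+1%:Z - r'%:Z) = -1 by lia.
  by rewrite scoefAN1 ?subrr ?mulr0 //; [exact: sK_neq0 | exact: sK_pow].
- move=> -> ->; rewrite eqxx orbT mul0r.
  have -> : c'%:Z - r'%:Z - (c'%:Z - r'.+1%:Z) = 1 by lia.
  by rewrite scoefA1 ?subrr ?mul0r //; exact: sK_pow.
- move=> hr hc; rewrite (gtn_eqF hr) (ltn_eqF hr) (ltn_eqF hc) (gtn_eqF hc) hr ltnNge (ltnW hr) /=.
  rewrite mulr1; apply: scoefBE; [exact: sK_neq0 | exact: sK_pow | lia].
- move=> hr hc; rewrite (gtn_eqF hr) (ltn_eqF hr) (ltn_eqF hc) (gtn_eqF hc) hr ltnNge (ltnW hr) /=.
  have hz : c%:Z - r%:Z - (c'%:Z - r'%:Z) != 0 by lia.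
  rewrite mul1r (scoefBN sK_neq0 sK_pow hz).
  by have -> : c'%:Z - r'%:Z - (c%:Z - r%:Z) = - (c%:Z - r%:Z - (c'%:Z - r'%:Z)) by lia.
Qed.

Lemma tab_cont_neq1 i T : (i < n)%N ->
  cell_weight sK (tab_pos T i) != cell_weight sK (tab_pos T i.+1).
Proof.
move=> hi0; apply/eqP => /(exprz_inj_free sK_neq0 sK_pow).
case: (adjacentP T hi0); move: (tab_pos T i) (tab_pos T i.+1) => [r c] [r' c'] /=;
  rewrite /cell_content /=; lia.
Qed.

Lemma tab_cont_neq2 i T : (i.+1 < n)%N ->
  cell_weight sK (tab_pos T i) != cell_weight sK (tab_pos T i.+2).
Proof.
move=> hi0; apply/eqP => /(exprz_inj_free sK_neq0 sK_pow) e.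
have h : (inord i.+2 : 'I_N) = (inord i : 'I_N).+2 :> nat by rewrite !inordK //; lia.
have /eqP[] := tab_content2 hlam T h; exact: e.
Qed.

Lemma heckeBasis_seminormal i T : (i < n)%N ->
  heckeBasis (inord i : 'I_N.-1) T
  = diag_coef sK (cell_weight sK) (tab_pos T i) (tab_pos T i.+1) *: basisV T
    + cell_coef sK (tab_pos T i) (tab_pos T i.+1) *: basisV (tab_sg i T).
Proof.
move=> hi0; rewrite diag_coef_cell ?sK_neq0 //.
have swap_content : (rowT T (inord i) != rowT T (inord i.+1)) ->
    (colT T (inord i) != colT T (inord i.+1)) ->
    CT (tab_sg i T) (inord i.+1) - CT (tab_sg i T) (inord i)
    = - (CT T (inord i.+1) - CT T (inord i)).
  move=> hr hc; rewrite /CT /rowT /colT /tab_sg lo_inord // hi_inord //.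
  by rewrite !(@tswapE N lam hlam T _ _ _ (nextE hi0) hr hc) tpermL tpermR [RHS]opprB.
rewrite /heckeBasis lo_inord // hi_inord //.
have -> : tswap T (inord i : 'I_N) (inord i.+1) = tab_sg i T.
  by rewrite /tab_sg lo_inord // hi_inord.
rewrite /cell_coef; case: (adjacentP T hi0) => /= h1 h2.
- rewrite h1 eqxx /= scale0r addr0; congr (_ *: _).
  have -> : cell_content (tab_pos T i.+1) - cell_content (tab_pos T i) = -1.
    by rewrite /cell_content; move: h1 h2; rewrite /=; lia.
  by rewrite scoefAN1 //; [exact: sK_neq0 | exact: sK_pow].
- rewrite h1 h2 eqxx orbT scale0r addr0 eqn_leq ltnn /=.
  have -> : cell_content (tab_pos T i.+1) - cell_content (tab_pos T i) = 1.
    by rewrite /cell_content; move: h1 h2; rewrite /=; lia.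
  by rewrite scoefA1 ?scaleN1r //; exact: sK_pow.
- by rewrite (gtn_eqF h1) (ltn_eqF h2) h1.
- rewrite (ltn_eqF h1) (gtn_eqF h2) ltnNge (ltnW h1) /=.
  have hr : rowT T (inord i) != rowT T (inord i.+1) by rewrite (ltn_eqF h1).
  have hc : colT T (inord i) != colT T (inord i.+1) by rewrite (gtn_eqF h2).
  rewrite (swap_content hr hc).
  have -> : cell_content (tab_pos T i.+1) - cell_content (tab_pos T i)
      = CT T (inord i.+1) - CT T (inord i) by [].
  (* Row and column both change, so the difference is at most -2; its opposite is at least 2, where
     [scoefB] is nonzero and can be inverted. *)
  have : CT T (inord i.+1) - CT T (inord i) < -1 by rewrite /CT; lia.
  move: (CT T _ - CT T _) => z hz; rewrite -[X in scoefA sK X]opprK.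
  apply: (seminormal_lower sK_neq0 sK_pow); first by lia.
  by apply: (scoefB_neq0 sK_neq0 sK_pow); lia.
Qed.

Lemma tab_hbE i T T' : (i < n)%N -> heckeBasis (inord i : 'I_N.-1) T T'
  = diag_coef sK (cell_weight sK) (tab_pos T i) (tab_pos T i.+1) * (T == T')%:R
    + cell_coef sK (tab_pos T i) (tab_pos T i.+1) * (tab_sg i T == T')%:R.
Proof. by move=> hi0; rewrite heckeBasis_seminormal // !ffunE. Qed.

End HeckeTableaux.

(** * The isomorphism *)

Section Laurent.
Variable N : nat.

Lemma toLK (f : Fx N) : laurent f -> proj1_sig (toL f) = f.
Proof. by move=> h; rewrite /toL; case: excluded_middle_informative. Qed.

Lemma L_inj (p p' : L N) : proj1_sig p = proj1_sig p' -> p = p'.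
Proof.
case: p p' => [f hf] [f' hf'] /= e; case: f' / e hf' => hf'.
by congr exist; exact: Classical_Prop.proof_irrelevance.
Qed.

Lemma laurentD (f g : Fx N) : laurent f -> laurent g -> laurent (f + g).
Proof. exact: lpolyD. Qed.
Lemma laurentM (f g : Fx N) : laurent f -> laurent g -> laurent (f * g).
Proof. exact: lpolyM. Qed.
Lemma laurentN (f : Fx N) : laurent f -> laurent (- f).
Proof. exact: lpolyN. Qed.
Lemma laurent_const c : laurent (cF N c). Proof. exact: lpoly_const. Qed.
Lemma laurent_var (i : 'I_N) : laurent (xF i). Proof. exact: lpoly_var. Qed.
Lemma laurent_varV (i : 'I_N) : laurent (xF i)^-1. Proof. exact: lpoly_varV. Qed.
Lemma laurent_one : laurent (1 : Fx N). Proof. exact: lpoly1. Qed.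
Lemma laurent_sum (I : Type) (r : seq I) (f : I -> Fx N) :
  (forall i, laurent (f i)) -> laurent (\sum_(i <- r) f i).
Proof. move=> h; exact: (@lpoly_sum K N I r xpredT f (fun i _ => h i)). Qed.

Lemma fswE (j : 'I_N.-1) (f : Fx N) : fsw j f = permF (tperm (lo j) (hi j)) f.
Proof. by []. Qed.

Lemma wsubstE : wsubst N = rot_tuple N qK.
Proof. reflexivity. Qed.

Lemma fwE (f : Fx N) : fw f = rotF qK_neq0 f.
Proof. by rewrite /fw /wpol wsubstE /rotF /frac_rmorph /frac_map /fmap. Qed.

Lemma laurent_fsw (j : 'I_N.-1) (f : Fx N) : laurent f -> laurent (fsw j f).
Proof. rewrite fswE; exact: lpoly_permF. Qed.

Lemma laurent_fw (f : Fx N) : laurent f -> laurent (fw f).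
Proof. rewrite fwE; exact: lpoly_rotF. Qed.

Lemma laurent_divdiff (j : 'I_N.-1) (f : Fx N) : laurent f -> laurent (divdiff j f).
Proof.
move=> hf; rewrite /divdiff -mulrA; apply: laurentM.
  apply: laurentM; last exact: laurent_var.
  by apply: laurentD; [exact: laurent_one | apply: laurentN; exact: laurent_const].
rewrite fswE; apply: lpoly_divdiff hf; first exact: hi_lo_neq.
  by move=> c; exact: permF_const.
by move=> l; exact: permF_var.
Qed.

End Laurent.

Section Calculus.
Variables (m : nat) (lam : seq nat).
Local Notation N := m.+2.
Local Notation n := m.+1.
Hypothesis hlam : is_partition N lam.

Definition constK : {rmorphism K -> Fx N} := @rconst K N.
Definition swapK (i : nat) : {rmorphism Fx N -> Fx N} := @gswap K m i.
Definition rotK : {rmorphism Fx N -> Fx N} := @grot K m qK qK_neq0.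
Definition unrotK : {rmorphism Fx N -> Fx N} := @gunrot K m qK qK_neq0.
Definition hecke_matrix (i : nat) (T T' : Tab N lam) : K := heckeBasis (inord i : 'I_N.-1) T T'.

Lemma calculus_exists : exists Phi, operator_calculus constK n sK (@gvar K m) swapK
  rotK unrotK hecke_matrix (@laurent N) Phi.
Proof.
have [T0 _] := tab_exists hlam isT.
eexists; apply: (@formal_calculus K (Fx N) constK n qK sK (@gvar K m) swapK rotK unrotK
  isT qK_neq0 qK_inj sK_neq0 _ _ _ _ _ _ _ _ _ (Tab N lam) (nat * nat)%type
  (@tab_pos m lam) (cell_weight sK) (cell_coef sK) (@tab_sg m lam) hecke_matrix) => //.
- by move=> i a; exact: gswap_const.
- by move=> a; exact: grot_const.
- by move=> i j; exact: gswap_var.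
- exact: grot_var0.
- by move=> i; exact: grot_varS.
- exact: grotK.
- exact: gunrotK.
- exact: g_rmorph_eq.
- by move=> a b i j; exact: gconst_var_inj.
- by move=> p; exact: cell_weight_neq0 sK_neq0 p.
- by move=> i T; exact: tab_pos_sg.
- by move=> T T'; exact: tab_pos_inj.
- by move=> i T; exact: tab_kapK.
- by move=> i T; exact: tab_cont_neq1.
- by move=> i T; exact: tab_cont_neq2.
- by move=> i T T'; exact: tab_hbE.
- exact: laurentD.
- exact: lpoly0.
- by move=> a f; apply: laurentM; exact: laurent_const.
- exact: laurent_one.
- by move=> f; exact: lpoly_unrotF.
- by move=> i f _; apply: laurentM; exact: laurent_var.
Qed.

End Calculus.

(** * Corresponding operators on Laurent polynomials and Laurent vectors *)

Section Isomorphism.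
Variables (m : nat) (lam : seq nat).
Local Notation N := m.+2.
Local Notation n := m.+1.
Local Notation FT := (FV (Fx N) (Tab N lam)).
Variable Phi : (Fx N -> Fx N) -> (FT -> FT) -> Prop.
Hypothesis calc : operator_calculus (constK m) n sK (@gvar K m) (@swapK m)
  (rotK m) (unrotK m) (@hecke_matrix m lam) (@laurent N) Phi.

Local Notation LVN := (LV N lam).

Definition vecF (G : LVN) : FT := [ffun T => proj1_sig (G T)].
Definition vecL (u : FT) : LVN := fun T => toL (u T).

Lemma vecLK (u : FT) : (forall T, laurent (u T)) -> vecF (vecL u) = u.
Proof. by move=> h; apply/ffunP => T; rewrite ffunE toLK. Qed.

Lemma vecF_inj (G G' : LVN) : vecF G = vecF G' -> G = G'.
Proof.
move=> /ffunP e; apply: functional_extensionality => T; apply: L_inj.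
by have := e T; rewrite !ffunE.
Qed.

Lemma laurent_vecF G T : laurent (vecF G T).
Proof. by rewrite ffunE; exact: proj2_sig. Qed.

(** Both operators are restrictions of operators on rational functions and rational vectors; the
    group elements occurring in these need not preserve Laurent elements one by one, only the total
    operator does. *)
Definition related (f : L N -> L N) (f' : LVN -> LVN) : Prop := exists A B,
  [/\ Phi A B, forall p, proj1_sig (f p) = A (proj1_sig p) & forall G, vecF (f' G) = B (vecF G)].

(** One direction makes the correspondence a well-defined map, the other makes it injective.
    Equality on Laurent elements is lifted to all rational ones by [oc_vector] and [oc_scalar]. *)
Lemma related_eq f f' g g' : related f f' -> related g g' -> (f = g <-> f' = g').
Proof.
move=> [A [B [hAB hA hB]]] [A' [B' [hAB' hA' hB']]]; split=> e.
  have E : B =1 B'.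
    apply: (oc_vector calc hAB hAB') => p hp.
    by have := hA (exist _ p hp); rewrite e hA'.
  by apply: functional_extensionality => G; apply: vecF_inj; rewrite hB hB' E.
have E : A =1 A'.
  apply: (oc_scalar calc hAB hAB') => u hu.
  by rewrite -(vecLK hu) -hB -hB' e.
by apply: functional_extensionality => p; apply: L_inj; rewrite hA hA' E.
Qed.

Lemma related_id : related id id.
Proof. by exists id, id; split=> //; exact: (oc_id calc). Qed.

Lemma related_mul f f' g g' : related f f' -> related g g' ->
  related (opmul f g) (opmul f' g').
Proof.
move=> [A [B [hAB hA hB]]] [A' [B' [hAB' hA' hB']]].
exists (fun f => A' (A f)), (fun u => B' (B u)); split.
- exact: (oc_comp calc hAB hAB').
- by move=> p; rewrite /opmul hA' hA.
- by move=> G; rewrite /opmul hB' hB.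
Qed.

Lemma related_add f f' g g' : related f f' -> related g g' ->
  related (opadd (@addL N) f g) (opadd (@addLV N lam) f' g').
Proof.
move=> [A [B [hAB hA hB]]] [A' [B' [hAB' hA' hB']]].
exists (fun f => A f + A' f), (fun u => B u + B' u); split.
- exact: (oc_add calc hAB hAB').
- move=> p; rewrite /opadd /addL toLK; last by apply: laurentD; exact: proj2_sig.
  by rewrite hA hA'.
- move=> G; rewrite /opadd /addLV -hB -hB'; apply/ffunP => T.
  by rewrite !ffunE /addL toLK //; apply: laurentD; exact: proj2_sig.
Qed.

Lemma related_scl c f f' : related f f' ->
  related (opscl (@scaleL N) c f) (opscl (@scaleLV N lam) c f').
Proof.
move=> [A [B [hAB hA hB]]].
exists (fun f => cF N c * A f), (fun u => (cF N c : Fx N) *: B u); split.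
- exact: (oc_scale calc (cF N c) hAB).
- move=> p; rewrite /opscl /scaleL toLK ?hA //.
  by apply: laurentM; [exact: laurent_const | rewrite -hA; exact: proj2_sig].
- move=> G; rewrite /opscl /scaleLV -hB; apply/ffunP => T.
  rewrite !ffunE /scaleL toLK //.
  by apply: laurentM; [exact: laurent_const | exact: proj2_sig].
Qed.

Lemma divdiffE (j : 'I_N.-1) (f : Fx N) :
  divdiff j f = demazure (constK m sK) (@gvar K m) j j.+1 * (f - swapK m j f).
Proof.
have elo : lo j = inord j by rewrite -{1}(inord_val j) lo_inord.
have ehi : hi j = inord j.+1 by rewrite -{1}(inord_val j) hi_inord.
have esw : swapK m j f = fsw j f by rewrite /swapK /= /gswap inord_val.
rewrite /divdiff esw elo ehi; exact: mulrAC.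
Qed.

Lemma related_T (j : 'I_N.-1) : related (TxL j) (@BT N lam j).
Proof.
have esw f : swapK m j f = fsw j f by rewrite /swapK /= /gswap inord_val.
have lf (p : L N) : laurent (fsw j (proj1_sig p)) by apply: laurent_fsw; exact: proj2_sig.
have ld (p : L N) : laurent (divdiff j (proj1_sig p)).
  by apply: laurent_divdiff; exact: proj2_sig.
eexists; eexists; split; first exact: (oc_demazure calc (ltn_ord j)).
  move=> p; rewrite /TxL toLK; last first.
    by apply: laurentD => //; apply: laurentM => //; exact: laurent_const.
  by rewrite divdiffE esw.
move=> G; apply/ffunP => T'; rewrite ffunE /BT toLK; last first.
  apply: laurentD => //; apply: laurent_sum => T.
  by apply: laurentM => //; exact: laurent_const.
rewrite divdiffE; rewrite [RHS]ffunE; congr (_ + _).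
  by rewrite !ffunE.
rewrite ffunE; apply: eq_bigr => T _.
by rewrite !ffunE esw /hecke_matrix inord_val.
Qed.

Lemma word_hecke (l : seq 'I_N.-1) (v : V N lam) :
  word_act (hecke (constK m) (@hecke_matrix m lam)) (map val l)
    [ffun T => constK m (v T)]
  = [ffun T => constK m (foldl (fun v j => heckeV j v) v l T)].
Proof.
elim: l v => [|j l IH] v //.
rewrite map_cons word_act_cons hecke_const; apply: etrans (IH (heckeV j v)).
congr word_act.
apply/ffunP => T'; rewrite !ffunE; congr (constK m _).
rewrite /heckeV sum_ffunE; apply: eq_bigr => T _.
by rewrite ffunE /hecke_matrix inord_val.
Qed.

Lemma coxeter_basisV (T : Tab N lam) :
  coxeter n (hecke (constK m) (@hecke_matrix m lam)) (fbasis (Fx N) T)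
  = [ffun T' => cF N (wV (basisV T) T')].
Proof.
rewrite /wV -(word_hecke (enum 'I_N.-1) (basisV T)) val_enum_ord; congr word_act.
by apply/ffunP => T'; rewrite !ffunE rmorph_nat.
Qed.

Lemma rot_scalar (p : L N) : proj1_sig (@wL N p) = rotK m (proj1_sig p).
Proof. by rewrite /wL toLK ?fwE //; apply: laurent_fw; exact: proj2_sig. Qed.

Lemma rot_vector (G : LVN) : vecF (@Bw N lam G)
  = coxeter n (hecke (constK m) (@hecke_matrix m lam)) (lift (rotK m) (vecF G)).
Proof.
rewrite coxeter_basis; apply/ffunP => T'; rewrite ffunE /Bw toLK; last first.
  apply: laurent_sum => T; apply: laurentM; last exact: laurent_const.
  by apply: laurent_fw; exact: proj2_sig.
rewrite sum_ffunE; apply: eq_bigr => T _.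
by rewrite coxeter_basisV !ffunE fwE.
Qed.

Lemma related_x (i : 'I_N) : related (mulxL i) (@Bx N lam i).
Proof.
exists (fun f => xF i * f), (fun u => (xF i : Fx N) *: u); split.
- exact: (oc_scale calc (xF i) (oc_id calc)).
- by move=> p; rewrite /mulxL toLK //; apply: laurentM; [exact: laurent_var | exact: proj2_sig].
- move=> G; apply/ffunP => T; rewrite !ffunE /Bx toLK //.
  by apply: laurentM; [exact: laurent_var | exact: proj2_sig].
Qed.

(** [A'] and [B'] preserve Laurent elements, so [toL] never takes its default value and the inverses
    can be restricted. *)
Lemma related_isinv f f' A B A' B' :
  (forall p, proj1_sig (f p) = A (proj1_sig p)) -> (forall G, vecF (f' G) = B (vecF G)) ->
  Phi A' B' -> cancel A A' -> cancel A' A -> cancel B B' -> cancel B' B ->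
  (forall p, laurent p -> laurent (A' p)) ->
  (forall u : FT, (forall T, laurent (u T)) -> forall T, laurent (B' u T)) ->
  exists g g', [/\ isinv f g, isinv f' g' & related g g'].
Proof.
move=> hf hf' hP AK AK' BK BK' lA lB.
have lA' (p : L N) : laurent (A' (proj1_sig p)) by apply: lA; exact: proj2_sig.
have lB' G T : laurent (B' (vecF G) T) by apply: lB => T'; exact: laurent_vecF.
exists (fun p => toL (A' (proj1_sig p))), (fun G => vecL (B' (vecF G))); split.
- split=> p; apply: L_inj; first by rewrite toLK // hf AK.
  by rewrite hf toLK // AK'.
- split=> G; apply: vecF_inj; first by rewrite vecLK // hf' BK.
  by rewrite hf' vecLK // BK'.
- exists A', B'; split=> // [p|G]; first by rewrite toLK.
  by rewrite vecLK.
Qed.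

(** The generating sets contain an inverse only as some map satisfying [isinv]; uniqueness
    identifies it with the constructed one. *)
Lemma isinv_unique (Y : Type) (f g g' : Y -> Y) : isinv f g -> isinv f g' -> g = g'.
Proof.
move=> [fK _] [_ gK']; apply: functional_extensionality => y.
by rewrite -{1}(gK' y) fK.
Qed.

Lemma rot_isinv : exists g g', [/\ isinv (@wL N) g, isinv (@Bw N lam) g' & related g g'].
Proof.
have [W hW [WK WK' lW]] := oc_unrot calc.
apply: (related_isinv rot_scalar rot_vector hW _ _ WK WK' _ lW).
- exact: grotK.
- exact: gunrotK.
- by move=> p; exact: lpoly_unrotF.
Qed.

Lemma x_isinv i : exists g g', [/\ isinv (mulxL i) g, isinv (@Bx N lam i) g' & related g g'].
Proof.
have xi0 : xF i != 0 :> Fx N by exact: rvar_neq0.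
apply: (@related_isinv _ _ (fun f => xF i * f) (fun u => (xF i : Fx N) *: u)
  (fun f => (xF i)^-1 * f) (fun u => ((xF i)^-1 : Fx N) *: u)).
- by move=> p; rewrite /mulxL toLK //; apply: laurentM; [exact: laurent_var | exact: proj2_sig].
- move=> G; apply/ffunP => T; rewrite !ffunE /Bx toLK //.
  by apply: laurentM; [exact: laurent_var | exact: proj2_sig].
- exact: (oc_scale calc (xF i)^-1 (oc_id calc)).
- exact: mulKf.
- exact: mulVKf.
- exact: scalerK.
- exact: scalerKV.
- by move=> p; apply: laurentM; exact: laurent_varV.
- by move=> u hu T; rewrite ffunE; apply: laurentM => //; exact: laurent_varV.
Qed.

Lemma related_rot : related (@wL N) (@Bw N lam).
Proof.
eexists; eexists; split; first exact: (oc_rot calc).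
  exact: rot_scalar.
exact: rot_vector.
Qed.

Lemma gens_related f : gens_x f -> exists2 f', gens_bold (lam := lam) f' & related f f'.
Proof.
case=> [[j ->]|[->|[hf|[[i ->]|[i hf]]]]].
- by exists (@BT N lam j); [left; exists j | exact: related_T].
- by exists (@Bw N lam); [right; left | exact: related_rot].
- have [g [g' [hg hg' hr]]] := rot_isinv.
  exists g'; first by right; right; left.
  by rewrite (isinv_unique hf hg).
- by exists (@Bx N lam i); [right; right; right; left; exists i | exact: related_x].
- have [g [g' [hg hg' hr]]] := x_isinv i.
  exists g'; first by right; right; right; right; exists i.
  by rewrite (isinv_unique hf hg).
Qed.

Lemma gens_related_bold f' : gens_bold (lam := lam) f' ->
  exists2 f, gens_x f & related f f'.
Proof.
case=> [[j ->]|[->|[hf|[[i ->]|[i hf]]]]].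
- by exists (TxL j); [left; exists j | exact: related_T].
- by exists (@wL N); [right; left | exact: related_rot].
- have [g [g' [hg hg' hr]]] := rot_isinv.
  exists g; first by right; right; left.
  by rewrite (isinv_unique hf hg').
- by exists (mulxL i); [right; right; right; left; exists i | exact: related_x].
- have [g [g' [hg hg' hr]]] := x_isinv i.
  exists g; first by right; right; right; right; exists i.
  by rewrite (isinv_unique hf hg').
Qed.

Local Notation algx := (gen_alg (@addL N) (@scaleL N) (@gens_x N)).
Local Notation algb := (gen_alg (@addLV N lam) (@scaleLV N lam) (@gens_bold N lam)).

Lemma alg_related f : algx f -> exists2 f', algb f' & related f f'.
Proof.
elim=> [{}f /gens_related[f' hf' hr]||{}f g _ [f' hf' hr] _ [g' hg' hr']
  |c {}f _ [f' hf' hr]|{}f g _ [f' hf' hr] _ [g' hg' hr']].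
- by exists f' => //; exact: ga_gen.
- by exists id; [exact: ga_one | exact: related_id].
- by exists (opadd (@addLV N lam) f' g'); [exact: ga_add | exact: related_add].
- by exists (opscl (@scaleLV N lam) c f'); [exact: ga_scl | exact: related_scl].
- by exists (opmul f' g'); [exact: ga_mul | exact: related_mul].
Qed.

Lemma alg_related_bold f' : algb f' -> exists2 f, algx f & related f f'.
Proof.
elim=> [{}f' /gens_related_bold[f hf hr]||{}f' g' _ [f hf hr] _ [g hg hr']
  |c {}f' _ [f hf hr]|{}f' g' _ [f hf hr] _ [g hg hr']].
- by exists f => //; exact: ga_gen.
- by exists id; [exact: ga_one | exact: related_id].
- by exists (opadd (@addL N) f g); [exact: ga_add | exact: related_add].
- by exists (opscl (@scaleL N) c f); [exact: ga_scl | exact: related_scl].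
- by exists (opmul f g); [exact: ga_mul | exact: related_mul].
Qed.

Lemma iso_exists : exists phi : (L N -> L N) -> (LVN -> LVN),
  [/\ is_alg_iso (@addL N) (@scaleL N) (@gens_x N)
        (@addLV N lam) (@scaleLV N lam) (@gens_bold N lam) phi,
      forall j : 'I_N.-1, phi (TxL j) = BT j,
      phi (@wL N) = @Bw N lam & forall i : 'I_N, phi (mulxL i) = Bx i].
Proof.
(* [phi] chooses along the correspondence; where nothing corresponds its value is arbitrary, and
   [is_alg_iso] only looks at members of the algebra. *)
pose phi f := epsilon (inhabits (id : LVN -> LVN)) (fun f' => related f f').
have phiE f f' : related f f' -> phi f = f'.
  move=> h; have h' : related f (phi f) by apply: epsilon_spec; exists f'.
  exact: (iffLR (related_eq h' h) erefl).
have phi_rel f : algx f -> related f (phi f).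
  by move=> /alg_related[f' _ h]; rewrite (phiE _ _ h).
exists phi; split.
- split; first by move=> f /alg_related[f' hf' /phiE->].
  split; first by move=> g /alg_related_bold[f hf /phiE e]; exists f.
  split; first by move=> f f' /phi_rel h /phi_rel h'; exact: (iffRL (related_eq h h')).
  split; first by move=> f f' /phi_rel h /phi_rel h'; apply: phiE; exact: related_add.
  split; first by move=> c f /phi_rel h; apply: phiE; exact: related_scl.
  split; first by move=> f f' /phi_rel h /phi_rel h'; apply: phiE; exact: related_mul.
  exact/phiE/related_id.
- by move=> j; exact/phiE/related_T.
- exact/phiE/related_rot.
- by move=> i; exact/phiE/related_x.
Qed.

End Isomorphism.

Theorem theorem3p1 (N : nat) (hN : (2 <= N)%N) (lam : seq nat)
    (hlam : is_partition N lam) :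
  exists phi : (L N -> L N) -> (LV N lam -> LV N lam),
    [/\ is_alg_iso (@addL N) (@scaleL N) (@gens_x N)
                   (@addLV N lam) (@scaleLV N lam) (@gens_bold N lam) phi,
        (forall j : 'I_N.-1, phi (TxL j) = BT j),
        phi (@wL N) = @Bw N lam &
        (forall i : 'I_N, phi (mulxL i) = Bx i)].
Proof.
(* Writing [N] as [m.+2] makes the number [m.+1] of Hecke generators positive, as the word arguments
   require. *)
case: N hN hlam => [|[|m]] // _ hlam.
have [Phi calc] := calculus_exists hlam.
exact: (iso_exists calc).
Qed.
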